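(* Let $M$ be the connected sum of two $3$-manifolds $M_1$ and $M_2$, and let $G_i=\pi_1(M_i)$ for $i=1,2$. Suppose that for each $i\in\{1,2\}$, $G_i$ is bi-orderable if and only if $G_i$ has no generalized torsion element. Then $G=\pi_1(M)$ is bi-orderable if and only if $G$ has no generalized torsion element.
   Context: A group $G$ is bi-orderable if it admits a strict total ordering $<$ such that $g<h$ implies $agb<ahb$ for all $g,h,a,b\in G$; the trivial group is considered bi-orderable. A generalized torsion element of a group $G$ is a non-trivial element $g\in G$ such that some non-empty finite product of conjugates of $g$ equals the identity, i.e. there are $k\ge 1$ and $a_1,\dots,a_k\in G$ with $(a_1^{-1}ga_1)(a_2^{-1}ga_2)\cdots(a_k^{-1}ga_k)=1$. *)

(* Defs.v *)
From HB Require Import structures.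
From mathcomp Require Import all_boot all_order all_algebra.
From mathcomp Require Import all_classical all_reals all_analysis.
From mathcomp Require Import homotopy ring lra.
Import Order.TTheory GRing.Theory Num.Theory.
Import numFieldNormedType.Exports.

Set Implicit Arguments.
Unset Strict Implicit.
Unset Printing Implicit Defensive.

Local Open Scope classical_set_scope.
Local Open Scope ring_scope.

Section biorder.
Local Open Scope group_scope.

Definition bi_orderable (G : groupType) : Prop :=
  exists lt : rel G,
    [/\ irreflexive lt, transitive lt,
        forall g h : G, g <> h -> lt g h \/ lt h g &
        forall g h a b : G, lt g h -> lt (a * g * b) (a * h * b)].

(* [g ^ a] is the conjugate [a^-1 * (g * a)]. *)
Definition generalized_torsion (G : groupType) (g : G) : Prop :=
  g <> 1 /\ exists2 s : seq G, s <> [::] & \prod_(a <- s) g ^ a = 1.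

End biorder.

Definition unit_itv (R : realType) : Type := set_type (`[0, 1] : set R).

Section unit_interval.
Variable R : realType.
Local Notation I := (unit_itv R).

HB.instance Definition _ := Topological.copy I (set_type (`[0, 1] : set R)).

Let clamp_subproof (t : R) :
  Num.min 1 (Num.max 0 t) \in (`[0, 1]%classic : set R).
Proof.
apply/mem_set; rewrite /= in_itv /= ge_min lexx le_min ler01 /=.
by rewrite le_max lexx.
Qed.

Definition clamp (t : R) : I := @exist R (fun x => x \in (`[0, 1]%classic : set R)) _ (clamp_subproof t).

Definition itv_val (t : I) : R := set_val t.

Lemma itv_valK : cancel itv_val clamp.
Proof.
move=> [t Ht]; apply: eq_exist => /=.
have := set_mem Ht; rewrite /itv_val /= set_valE /= in_itv /= => /andP[t0 t1].
by rewrite max_r // min_r.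
Qed.

Lemma clamp_val (t : R) : itv_val (clamp t) = Num.min 1 (Num.max 0 t).
Proof. by []. Qed.

Let zero_one_subproof : clamp 0 != clamp 1.
Proof.
apply/eqP => /(congr1 itv_val); rewrite !clamp_val.
rewrite maxxx (max_r ler01) minxx (min_r ler01) => /eqP.
by rewrite eq_sym oner_eq0.
Qed.

HB.instance Definition _ := isBiPointed.Build I zero_one_subproof.

Lemma clamp0 : clamp 0 = zero :> I. Proof. by []. Qed.

Lemma clamp1 : clamp 1 = one :> I. Proof. by []. Qed.

Lemma clamp_le0 (t : R) : t <= 0 -> clamp t = zero.
Proof.
move=> t0; apply: (can_inj itv_valK); rewrite /zero /= !clamp_val.
by rewrite max_l // maxxx.
Qed.

Lemma clamp_ge1 (t : R) : 1 <= t -> clamp t = one.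
Proof.
move=> t1; apply: (can_inj itv_valK); rewrite /one /= !clamp_val.
by rewrite (max_r ler01) minxx max_r ?(le_trans ler01) // min_l.
Qed.

Lemma itv_val0 : itv_val zero = 0.
Proof. by rewrite /zero /= clamp_val maxxx min_r. Qed.

Lemma itv_val1 : itv_val one = 1.
Proof. by rewrite /one /= clamp_val max_r // minxx. Qed.

Lemma itv_val_continuous : continuous (itv_val : I -> R).
Proof. exact: initial_continuous. Qed.

Lemma clamp_continuous : continuous clamp.
Proof.
apply: continuous_comp_initial => t.
apply: continuous_min; first exact: cvg_cst.
by apply: continuous_max; [exact: cvg_cst|exact: cvg_id].
Qed.

End unit_interval.

Section continuity.
Context {T U V : topologicalType} {R : realType}.

Lemma continuous_compose (g : U -> V) (f : T -> U) :
  continuous g -> continuous f -> continuous (fun z => g (f z)).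
Proof. by move=> cg cf z; apply: continuous_comp; [exact: cf|exact: cg]. Qed.

Lemma continuous_pair (f : T -> U) (g : T -> V) :
  continuous f -> continuous g -> continuous (fun z => (f z, g z)).
Proof.
move=> cf cg z.
by apply: (@cvg_pair _ _ _ _ (nbhs (f z)) (nbhs (g z))); [exact: cf|exact: cg].
Qed.

Lemma continuous_pi1 : continuous (fun z : T * U => z.1).
Proof. by move=> z; exact: cvg_fst. Qed.

Lemma continuous_pi2 : continuous (fun z : T * U => z.2).
Proof. by move=> z; exact: cvg_snd. Qed.

Lemma continuous_affine (f : T -> R) (a b : R) :
  continuous f -> continuous (fun z => a * f z + b).
Proof.
move=> cf z; apply: cvgD; last exact: cvg_cst.
by apply: cvgM; [exact: cvg_cst|exact: cf].
Qed.

Lemma continuous_scale (f : T -> R) (a : R) :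
  continuous f -> continuous (fun z => a * f z).
Proof. by move=> cf z; apply: cvgM; [exact: cvg_cst|exact: cf]. Qed.

Lemma continuous_flip (f : T -> R) (a : R) :
  continuous f -> continuous (fun z => a - f z).
Proof. by move=> cf z; apply: cvgB; [exact: cvg_cst|exact: cf]. Qed.

End continuity.

Lemma continuous_paste (R : realType) (T X : topologicalType) (f g : T -> X)
    (u : T -> R) (c : R) :
  continuous f -> continuous g -> continuous u ->
  (forall z, u z = c -> f z = g z) ->
  continuous (fun z => if u z <= c then f z else g z).
Proof.
move=> cf cg cu fg; apply/continuous_subspace_setT.
have -> : [set: T] = (u @^-1` [set r | r <= c]) `|` (u @^-1` [set r | c <= r]).
  by apply/esym/seteqP; split => z //= _; exact/orP/le_total.
apply: withinU_continuous.
- by apply: preimage_closed (@closed_le _ c) => z _; exact: cu.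
- by apply: preimage_closed (@closed_ge _ c) => z _; exact: cu.
- apply: (@subspace_eq_continuous _ _ _ f); last exact: continuous_subspaceT.
  by move=> z /set_mem /= uz; rewrite /from_subspace uz.
- apply: (@subspace_eq_continuous _ _ _ g); last exact: continuous_subspaceT.
  move=> z /set_mem /= uz; rewrite /from_subspace; case: ifPn => // uz'.
  by rewrite fg //; apply/eqP; rewrite eq_le uz uz'.
Qed.

Section homotopy.
Variables (R : realType) (X : topologicalType).
Local Notation I := (unit_itv R).
Implicit Types x y z w : X.

(* The first coordinate of [H] is the deformation parameter; the endpoints stay
   fixed. *)
Definition path_homotopy x y (p q : {path I from x to y}) (H : I * I -> X) :=
  [/\ continuous H,
      forall t, H (zero, t) = p t, forall t, H (one, t) = q t,
      forall s, H (s, zero) = x & forall s, H (s, one) = y].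

Definition path_homotopic x y (p q : {path I from x to y}) : Prop :=
  exists H, path_homotopy p q H.

Lemma path_clamp_continuous x y (p : {path I from x to y}) :
  continuous (fun t : R => p (clamp t)).
Proof.
apply: continuous_compose; first exact: cts_fun.
exact: clamp_continuous.
Qed.

Lemma path_homotopicI x y (p q : {path I from x to y}) (h : R * R -> X) :
  continuous h ->
  (forall t : I, h (0, itv_val t) = p t) ->
  (forall t : I, h (1, itv_val t) = q t) ->
  (forall s, h (s, 0) = x) -> (forall s, h (s, 1) = y) ->
  path_homotopic p q.
Proof.
move=> ch h0 h1 hx hy.
exists (fun st => h (itv_val st.1, itv_val st.2)); split => [|t|t|s|s] /=.
- apply: (continuous_compose ch); apply: continuous_pair;
    apply: (continuous_compose (@itv_val_continuous R));
    [exact: continuous_pi1|exact: continuous_pi2].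
- by rewrite itv_val0 h0.
- by rewrite itv_val1 h1.
- by rewrite itv_val0 hx.
- by rewrite itv_val1 hy.
Qed.

Lemma path_homotopicE x y (p q : {path I from x to y}) :
  path_homotopic p q -> exists h : R * R -> X,
  [/\ continuous h,
      forall s t, s <= 0 -> h (s, t) = p (clamp t),
      forall s t, 1 <= s -> h (s, t) = q (clamp t),
      forall s t, t <= 0 -> h (s, t) = x & forall s t, 1 <= t -> h (s, t) = y].
Proof.
move=> [H [cH H0 H1 Hx Hy]].
exists (fun st => H (clamp st.1, clamp st.2)); split => [|s t|s t|s t|s t] /=.
- apply: (continuous_compose cH); apply: continuous_pair;
    apply: (continuous_compose (@clamp_continuous R));
    [exact: continuous_pi1|exact: continuous_pi2].
- by move=> /clamp_le0 ->; rewrite H0.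
- by move=> /clamp_ge1 ->; rewrite H1.
- by move=> /clamp_le0 ->; rewrite Hx.
- by move=> /clamp_ge1 ->; rewrite Hy.
Qed.

Lemma path_reparam x y (p q : {path I from x to y}) u v
    (r : {path I from u to v}) (phi psi : R -> R) :
  continuous phi -> continuous psi ->
  phi 0 = psi 0 -> phi 1 = psi 1 ->
  (forall t : I, p t = r (clamp (phi (itv_val t)))) ->
  (forall t : I, q t = r (clamp (psi (itv_val t)))) ->
  path_homotopic p q.
Proof.
move=> cphi cpsi e0 e1 pE qE.
apply: (@path_homotopicI _ _ _ _ (fun st : R * R =>
  r (clamp (phi st.2 + st.1 * (psi st.2 - phi st.2))))) => [|t|t|s|s] /=.
- have c2 (f : R -> R) : continuous f -> continuous (fun st : R * R => f st.2).
    by move=> cf; apply: continuous_compose => //; exact: continuous_pi2.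
  apply: continuous_compose; [exact: cts_fun|].
  apply: (continuous_compose (@clamp_continuous R)) => z.
  apply: cvgD; first exact: c2.
  apply: cvgM; first exact: cvg_fst.
  by apply: cvgB; exact: c2.
- by rewrite mul0r addr0 pE.
- by rewrite mul1r addrC subrK qE.
- by rewrite e0 subrr mulr0 addr0 -e0 -[0]itv_val0 -pE path_zero.
- by rewrite e1 subrr mulr0 addr0 -e1 -[1]itv_val1 -pE path_one.
Qed.

Lemma path_homotopic_refl x y (p : {path I from x to y}) : path_homotopic p p.
Proof.
apply: (@path_reparam _ _ _ _ _ _ p id id) => // t; rewrite ?itv_valK //.
Qed.

Lemma path_homotopic_sym x y (p q : {path I from x to y}) :
  path_homotopic p q -> path_homotopic q p.
Proof.
move=> /path_homotopicE[h [ch hp hq hx hy]].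
apply: (@path_homotopicI _ _ _ _ (fun st => h (1 - st.1, st.2)))
  => [|t|t|s|s] /=.
- apply: (continuous_compose ch); apply: continuous_pair;
    last exact: continuous_pi2.
  exact/continuous_flip/continuous_pi1.
- by rewrite subr0 hq // itv_valK.
- by rewrite subrr hp // itv_valK.
- by rewrite hx.
- by rewrite hy.
Qed.

Lemma path_homotopic_trans x y (p q r : {path I from x to y}) :
  path_homotopic p q -> path_homotopic q r -> path_homotopic p r.
Proof.
move=> /path_homotopicE[h [ch hp hq hx hy]].
move=> /path_homotopicE[k [ck kq kr kx ky]].
apply: (@path_homotopicI _ _ _ _ (fun st : R * R => if st.1 <= 1/2
   then h (2 * st.1, st.2) else k (2 * st.1 - 1, st.2))) => [|t|t|s|s] /=.
- apply: continuous_paste => [|||st /= ->].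
  + apply: (continuous_compose ch); apply: continuous_pair;
      last exact: continuous_pi2.
    exact/continuous_scale/continuous_pi1.
  + apply: (continuous_compose ck); apply: continuous_pair;
      last exact: continuous_pi2.
    exact/continuous_affine/continuous_pi1.
  + exact: continuous_pi1.
  + by rewrite hq ?kq //; lra.
- by rewrite ifT ?hp ?itv_valK //; lra.
- by rewrite ifF ?kr ?itv_valK //; lra.
- by case: ifP => _; rewrite ?hx ?kx.
- by case: ifP => _; rewrite ?hy ?ky.
Qed.

Definition path_cat_fun x y z (p : {path I from x to y})
    (q : {path I from y to z}) (t : I) : X :=
  if itv_val t <= 1/2 then p (clamp (2 * itv_val t))
  else q (clamp (2 * itv_val t - 1)).

Lemma path_cat_continuous x y z (p : {path I from x to y})
  (q : {path I from y to z}) : continuous (path_cat_fun p q).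
Proof.
apply: continuous_paste => [|||t ->].
+ apply: continuous_compose; [exact: cts_fun|].
  apply: (continuous_compose (@clamp_continuous R)).
  exact/continuous_scale/itv_val_continuous.
+ apply: continuous_compose; [exact: cts_fun|].
  apply: (continuous_compose (@clamp_continuous R)).
  exact/continuous_affine/itv_val_continuous.
+ exact: itv_val_continuous.
+ by rewrite clamp_ge1 ?clamp_le0 ?path_one ?path_zero //; lra.
Qed.

Lemma path_cat0 x y z (p : {path I from x to y}) (q : {path I from y to z}) :
  path_cat_fun p q zero = x.
Proof.
by rewrite /path_cat_fun itv_val0 ifT ?clamp_le0 ?path_zero //; lra.
Qed.

Lemma path_cat1 x y z (p : {path I from x to y}) (q : {path I from y to z}) :
  path_cat_fun p q one = z.
Proof.
by rewrite /path_cat_fun itv_val1 ifF ?clamp_ge1 ?path_one //; lra.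
Qed.

Definition path_cat x y z (p : {path I from x to y}) (q : {path I from y to z})
    : {path I from x to z} :=
  mk_path (@path_cat_continuous x y z p q) (path_cat0 p q) (path_cat1 p q).

Definition path_rev_fun x y (p : {path I from x to y}) (t : I) : X :=
  p (clamp (1 - itv_val t)).

Lemma path_rev_continuous x y (p : {path I from x to y}) :
  continuous (path_rev_fun p).
Proof.
apply: continuous_compose; [exact: cts_fun|].
  apply: (continuous_compose (@clamp_continuous R)).
exact/continuous_flip/itv_val_continuous.
Qed.

Lemma path_rev0 x y (p : {path I from x to y}) : path_rev_fun p zero = y.
Proof. by rewrite /path_rev_fun itv_val0 subr0 path_one. Qed.

Lemma path_rev1 x y (p : {path I from x to y}) : path_rev_fun p one = x.
Proof. by rewrite /path_rev_fun itv_val1 subrr path_zero. Qed.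

Definition path_rev x y (p : {path I from x to y}) : {path I from y to x} :=
  mk_path (@path_rev_continuous x y p) (path_rev0 p) (path_rev1 p).

Definition path_cst x : {path I from x to x} := @cst I X x.

Lemma path_catE x y z (p : {path I from x to y}) (q : {path I from y to z}) t :
  path_cat p q t = if itv_val t <= 1/2 then p (clamp (2 * itv_val t))
                   else q (clamp (2 * itv_val t - 1)).
Proof. by []. Qed.

Lemma path_revE x y (p : {path I from x to y}) t :
  path_rev p t = p (clamp (1 - itv_val t)).
Proof. by []. Qed.

Lemma path_cat_homotopic x y z (p p' : {path I from x to y})
    (q q' : {path I from y to z}) :
  path_homotopic p p' -> path_homotopic q q' ->
  path_homotopic (path_cat p q) (path_cat p' q').
Proof.
move=> /path_homotopicE[h [ch hp hp' hx hy]].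
move=> /path_homotopicE[k [ck kq kq' ky kz]].
apply: (@path_homotopicI _ _ _ _ (fun st : R * R => if st.2 <= 1/2
   then h (st.1, 2 * st.2) else k (st.1, 2 * st.2 - 1))) => [|t|t|s|s] /=.
- apply: continuous_paste => [|||st /= ->].
  + apply: (continuous_compose ch); apply: continuous_pair;
      first exact: continuous_pi1.
    exact/continuous_scale/continuous_pi2.
  + apply: (continuous_compose ck); apply: continuous_pair;
      first exact: continuous_pi1.
    exact/continuous_affine/continuous_pi2.
  + exact: continuous_pi2.
  + by rewrite hy ?ky //; lra.
- by rewrite path_catE hp // kq.
- by rewrite path_catE hp' // kq'.
- by rewrite ifT ?hx //; lra.
- by rewrite ifF ?kz //; lra.
Qed.

Lemma path_rev_homotopic x y (p p' : {path I from x to y}) :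
  path_homotopic p p' -> path_homotopic (path_rev p) (path_rev p').
Proof.
move=> /path_homotopicE[h [ch hp hp' hx hy]].
apply: (@path_homotopicI _ _ _ _ (fun st : R * R => h (st.1, 1 - st.2)))
  => [|t|t|s|s] /=.
- apply: (continuous_compose ch); apply: continuous_pair;
    first exact: continuous_pi1.
  exact/continuous_flip/continuous_pi2.
- by rewrite path_revE hp.
- by rewrite path_revE hp'.
- by rewrite subr0 hy.
- by rewrite subrr hx.
Qed.

Let mulc_continuous (a b : R) : continuous (fun t : R => a * t + b).
Proof.
by move=> t; apply: cvgD; [apply: cvgM; [exact: cvg_cst|exact: cvg_id]|
  exact: cvg_cst].
Qed.

Let min_continuous (f g : R -> R) :
  continuous f -> continuous g -> continuous (fun t => Num.min (f t) (g t)).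
Proof. by move=> cf cg t; apply: continuous_min; [exact: cf|exact: cg]. Qed.

Let max_continuous (f g : R -> R) :
  continuous f -> continuous g -> continuous (fun t => Num.max (f t) (g t)).
Proof. by move=> cf cg t; apply: continuous_max; [exact: cf|exact: cg]. Qed.

Let id_continuous : continuous (@id R).
Proof. by move=> t; exact: cvg_id. Qed.

Lemma path_cst_cat x y (p : {path I from x to y}) :
  path_homotopic (path_cat (path_cst x) p) p.
Proof.
apply: (@path_reparam _ _ _ _ _ _ p (fun t => Num.max 0 (2 * t + -1)) id) => //.
- by apply: max_continuous; [move=> ?; exact: cvg_cst|exact: mulc_continuous].
- by rewrite max_l //; lra.
- by rewrite max_r //; lra.
- move=> t; rewrite path_catE; case: ifPn => ht /=.
    by rewrite clamp_le0 ?path_zero // ge_max lexx /=; lra.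
  by rewrite max_r //; lra.
- by move=> t; rewrite itv_valK.
Qed.

Lemma path_cat_cst x y (p : {path I from x to y}) :
  path_homotopic (path_cat p (path_cst y)) p.
Proof.
apply: (@path_reparam _ _ _ _ _ _ p (fun t => Num.min 1 (2 * t + 0)) id) => //.
- by apply: min_continuous; [move=> ?; exact: cvg_cst|exact: mulc_continuous].
- by rewrite min_r //; lra.
- by rewrite min_l //; lra.
- move=> t; rewrite path_catE; case: ifPn => ht /=.
    by rewrite min_r ?addr0 //; lra.
  by rewrite clamp_ge1 ?path_one // le_min lexx /=; lra.
- by move=> t; rewrite itv_valK.
Qed.

Lemma path_cat_rev x y (p : {path I from x to y}) :
  path_homotopic (path_cat p (path_rev p)) (path_cst x).
Proof.
apply: (@path_reparam _ _ _ _ _ _ p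
  (fun t => Num.min (2 * t + 0) (-2 * t + 2)) (fun=> 0)) => //.
- by apply: min_continuous; exact: mulc_continuous.
- by move=> ?; exact: cvg_cst.
- by rewrite min_l //; lra.
- by rewrite min_r //; lra.
- move=> t; rewrite path_catE; case: ifPn => ht.
    by rewrite min_l ?addr0 //; lra.
  have t1 : itv_val t <= 1.
    by rewrite -[t]itv_valK clamp_val ge_min lexx.
  rewrite path_revE clamp_val (@max_r _ _ 0); last lra.
  rewrite (@min_r _ _ 1); last lra.
  by rewrite min_r; [congr (p (clamp _))|]; lra.
- by move=> t; rewrite clamp_le0 // path_zero.
Qed.

Lemma path_rev_cat x y (p : {path I from x to y}) :
  path_homotopic (path_cat (path_rev p) p) (path_cst y).
Proof.
have H := path_cat_rev (path_rev p).
apply: path_homotopic_trans H; apply: path_cat_homotopic.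
  exact: path_homotopic_refl.
apply: (@path_reparam _ _ _ _ _ _ p id id) => // t; first by rewrite itv_valK.
rewrite !path_revE !clamp_val itv_valK; congr (p _).
rewrite -[LHS]itv_valK -[RHS]itv_valK clamp_val; congr clamp.
have : 0 <= itv_val t <= 1.
  by rewrite -[t]itv_valK clamp_val ge_min lexx le_min ler01 le_max lexx.
move=> /andP[t0 t1]; rewrite (@max_r _ _ 0 (1 - itv_val t)); last lra.
rewrite (@min_r _ _ 1 (1 - itv_val t)); last lra.
by rewrite subKr max_r // min_r.
Qed.

Lemma path_catA x y z w (p : {path I from x to y}) (q : {path I from y to z})
    (r : {path I from z to w}) :
  path_homotopic (path_cat p (path_cat q r)) (path_cat (path_cat p q) r).
Proof.
apply: path_homotopic_sym.
apply: (@path_reparam _ _ _ _ _ _ (path_cat p (path_cat q r)) (fun t =>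
  Num.min (2 * t + 0) (Num.min (1 * t + 1/4) (1/2 * t + 1/2))) id) => //.
- apply: min_continuous; first exact: mulc_continuous.
  by apply: min_continuous; exact: mulc_continuous.
- by rewrite min_l ?le_min; lra.
- by rewrite min_r [Num.min _ _]min_r; lra.
- move=> t.
  have /andP[t0 t1] : 0 <= itv_val t <= 1.
    by rewrite -[t]itv_valK clamp_val ge_min lexx le_min ler01 le_max lexx.
  have cE (u : R) : 0 <= u <= 1 -> itv_val (clamp u) = u.
    by move=> /andP[u0 u1]; rewrite clamp_val max_r // min_r.
  set a := itv_val t in t0 t1 *.
  set m := Num.min (2 * a + 0) _.
  have [a4|a4] := leP a (1/4).
    have -> : m = 2 * a by rewrite /m addr0 min_l // le_min; lra.
    rewrite !path_catE -/a ifT; last lra.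
    rewrite (cE (2 * a)); last lra.
    rewrite ifT; last lra.
    by rewrite ifT //; lra.
  have [a2|a2] := leP a (1/2).
    have -> : m = a + 1/4.
      by rewrite /m mul1r [Num.min (a + _) _]min_l ?min_r //; lra.
    rewrite !path_catE -/a ifT; last lra.
    rewrite (cE (2 * a)); last lra.
    rewrite (cE (a + 1/4)); last lra.
    rewrite (cE (2 * (a + 1/4) - 1)); last lra.
    rewrite ifF; last lra.
    rewrite ifF; last lra.
    by rewrite ifT; [congr (q (clamp _))|]; lra.
  have -> : m = 1/2 * a + 1/2.
    by rewrite /m mul1r [Num.min (a + _) _]min_r ?min_r //; lra.
  rewrite !path_catE -/a ifF; last lra.
  rewrite (cE (1/2 * a + 1/2)); last lra.
  rewrite (cE (2 * (1/2 * a + 1/2) - 1)); last lra.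
  rewrite ifF; last lra.
  by rewrite ifF; [congr (r (clamp _))|]; lra.
- by move=> t; rewrite itv_valK.
Qed.

End homotopy.

Section fundamental_group.
Variables (R : realType) (X : topologicalType) (x : X).
Local Notation I := (unit_itv R).
Local Notation loop := {path I from x to x}.
Local Open Scope quotient_scope.

Definition loop_eqv (p q : loop) : bool := `[< path_homotopic p q >].

Let loop_eqv_refl : reflexive loop_eqv.
Proof. by move=> p; apply/asboolP; exact: path_homotopic_refl. Qed.

Let loop_eqv_sym : symmetric loop_eqv.
Proof.
by move=> p q; apply/asboolP/asboolP; exact: path_homotopic_sym.
Qed.

Let loop_eqv_trans : transitive loop_eqv.
Proof.
move=> q p r /asboolP pq /asboolP qr; apply/asboolP.
exact: path_homotopic_trans pq qr.
Qed.

Canonical loop_eqv_equiv :=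
  EquivRel loop_eqv loop_eqv_refl loop_eqv_sym loop_eqv_trans.

Definition fundamental_group : Type := {eq_quot loop_eqv}.

HB.instance Definition _ := Choice.on fundamental_group.
HB.instance Definition _ := Quotient.on fundamental_group.
HB.instance Definition _ := EqQuotient.on fundamental_group.

Definition homotopy_class (p : loop) : fundamental_group :=
  \pi_fundamental_group p.

Lemma homotopy_classP (p q : loop) :
  homotopy_class p = homotopy_class q <-> path_homotopic p q.
Proof.
split; first by move=> /eqmodP /asboolP.
by move=> pq; apply/eqmodP/asboolP.
Qed.

Lemma homotopy_class_surj (a : fundamental_group) : homotopy_class (repr a) = a.
Proof. exact: reprK. Qed.

Definition pi1_mul (a b : fundamental_group) : fundamental_group :=
  homotopy_class (path_cat (repr a) (repr b)).

Definition pi1_one : fundamental_group := homotopy_class (path_cst R x).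

Definition pi1_inv (a : fundamental_group) : fundamental_group :=
  homotopy_class (path_rev (repr a)).

Lemma pi1_mulE (p q : loop) :
  pi1_mul (homotopy_class p) (homotopy_class q) = homotopy_class (path_cat p q).
Proof.
by apply/homotopy_classP/path_cat_homotopic;
  apply/homotopy_classP; exact: homotopy_class_surj.
Qed.

Lemma pi1_invE (p : loop) :
  pi1_inv (homotopy_class p) = homotopy_class (path_rev p).
Proof.
by apply/homotopy_classP/path_rev_homotopic/homotopy_classP;
  exact: homotopy_class_surj.
Qed.

Let pi1_mulA : associative pi1_mul.
Proof.
move=> a b c; rewrite -[a]homotopy_class_surj -[b]homotopy_class_surj.
rewrite -[c]homotopy_class_surj !pi1_mulE.
by apply/homotopy_classP; exact: path_catA.
Qed.

Let pi1_mul1 : left_id pi1_one pi1_mul.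
Proof.
move=> a; rewrite -[a]homotopy_class_surj pi1_mulE.
by apply/homotopy_classP; exact: path_cst_cat.
Qed.

Let pi1_1mul : right_id pi1_one pi1_mul.
Proof.
move=> a; rewrite -[a]homotopy_class_surj pi1_mulE.
by apply/homotopy_classP; exact: path_cat_cst.
Qed.

Let pi1_mulV : left_inverse pi1_one pi1_inv pi1_mul.
Proof.
move=> a; rewrite -[a]homotopy_class_surj pi1_invE pi1_mulE.
by apply/homotopy_classP; exact: path_rev_cat.
Qed.

Let pi1_Vmul : right_inverse pi1_one pi1_inv pi1_mul.
Proof.
move=> a; rewrite -[a]homotopy_class_surj pi1_invE pi1_mulE.
by apply/homotopy_classP; exact: path_cat_rev.
Qed.

HB.instance Definition _ := isGroup.Build fundamental_group
  pi1_mulA pi1_mul1 pi1_1mul pi1_mulV pi1_Vmul.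

End fundamental_group.

Definition homeomorphic (X Y : topologicalType) : Prop :=
  exists (f : X -> Y) (g : Y -> X),
    [/\ continuous f, continuous g, cancel f g & cancel g f].

Definition open_embedding (X Y : topologicalType) (f : X -> Y) : Prop :=
  [/\ continuous f, injective f & forall U, open U -> open (f @` U)].

Definition half_space (R : realType) : set 'rV[R]_3 :=
  [set v | 0 <= v ord0 ord_max].
Arguments half_space R : clear implicits.

(* Connected topological 3-manifolds, possibly noncompact and possibly with
   boundary: charts take values in the closed half-space. *)
Record manifold3 (R : realType) (M : topologicalType) : Prop := Manifold3 {
  manifold3_hausdorff : hausdorff_space M;
  manifold3_second_countable : @second_countable M;
  manifold3_connected : connected [set: M];
  manifold3_chart : forall p : M, exists2 U : set M, open_nbhs p U &
    exists phi : set_type U -> set_type (half_space R), open_embedding phi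
}.

Definition open_ball3 (R : realType) : set 'rV[R]_3 :=
  [set v | \sum_i v ord0 i ^+ 2 < 1].
Arguments open_ball3 R : clear implicits.

Definition sphere2 (R : realType) : set 'rV[R]_3 :=
  [set v | \sum_i v ord0 i ^+ 2 = 1].
Arguments sphere2 R : clear implicits.

(* An embedding of the closed unit 3-ball in the interior of M, given together
   with an extension to an open embedding of the whole of R^3, so that the
   ball is tame. *)
Record ball_embedding (R : realType) (M : topologicalType) := BallEmbedding {
  ball_emb :> 'rV[R]_3 -> M;
  ball_embP : open_embedding ball_emb
}.

(* The two summands form a family indexed by [bool]. *)
Section connected_sum.
Variables (R : realType) (M : bool -> topologicalType).
Variable f : forall i, ball_embedding R (M i).
Local Open Scope quotient_scope.

Definition punctured (i : bool) : set (M i) := ~` (f i @` open_ball3 R).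
Arguments punctured i : clear implicits.

Definition punctured_sum := {i : bool & set_type (punctured i)}.

HB.instance Definition _ := Topological.on punctured_sum.

(* Distinct points are identified when they are the images [f i v] and [f j v]
   of the same point [v] of the sphere; since [f i] is injective, this only
   happens for [i != j].  Precomposing [f i] with the radial extension of a
   self-homeomorphism of the sphere yields every other gluing of the two
   boundary spheres. *)
Definition glued (a b : punctured_sum) : bool :=
  `[< a = b \/ exists2 v, sphere2 R v &
        f (tag a) v = \val (tagged a) /\ f (tag b) v = \val (tagged b) >].

Let glued_refl : reflexive glued.
Proof. by move=> a; apply/asboolP; left. Qed.

Let glued_sym : symmetric glued.
Proof.
by move=> a b; apply/asboolP/asboolP => -[->|[v Sv [va vb]]];
  by [left|right; exists v].
Qed.

Let glued_trans : transitive glued.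
Proof.
move=> b a c /asboolP[->//|[v Sv [va vb]]] /asboolP[<-|[w Sw [wb wc]]].
  by apply/asboolP; right; exists v.
have [_ finj _] := ball_embP (f (tag b)).
have vw : v = w by apply: finj; rewrite vb wb.
by apply/asboolP; right; exists v => //; rewrite {2}vw.
Qed.

Canonical glued_equiv := EquivRel glued glued_refl glued_sym glued_trans.

Definition connected_sum : Type := quotient_topology {eq_quot glued}.

HB.instance Definition _ := Topological.on connected_sum.

End connected_sum.

Definition is_connected_sum (R : realType) (M : topologicalType)
    (N : bool -> topologicalType) : Prop :=
  exists f : forall i, ball_embedding R (N i),
    homeomorphic M (connected_sum f).

(* Main.v *)
Require Import Defs.
From mathcomp Require Import all_boot all_order all_algebra.
From mathcomp Require Import all_classical all_reals all_analysis.
From HB Require Import structures.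
From mathcomp Require Import homotopy ring lra zify.
Import Order.TTheory GRing.Theory Num.Theory.
Import numFieldNormedType.Exports.

(** One implication holds in every group: if [g] is positive for a bi-order,
    then so are its conjugates and their products, so a product of conjugates of
    [g] is not trivial ([bi_orderable_torsion_free]).

    For the converse, the fundamental group [G] of the connected sum is the free
    product of the two groups [G_i], because the sphere along which the summands
    are glued is simply connected.  The factors embed in [G]; so if [G] has no
    generalized torsion element, neither has [G_i], and by hypothesis [G_i] is
    bi-orderable.  It remains to know that a free product of two bi-orderable
    groups is bi-orderable, which is Vinogradov's theorem.

    Vinogradov's theorem ([free_product_bi_orderable]).  Let [A] and [B] be
    bi-ordered and let [S] be the group ring over the integers of [A * B], the
    product ordered lexicographically.  Calling an element of [S] positive when
    its leading coefficient is positive makes [S] an ordered domain in which the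
    elements of the group are positive.  Conjugating [diag(a, 1)] by an upper
    and [diag(1, b)] by a lower unipotent matrix with off-diagonal entry [t]
    gives a representation of the free product by 2x2 matrices over [S[t]].  It
    is faithful: for a reduced word of length [n] the coefficient of [t^n] is,
    up to its position in the matrix, the product of the nonzero elements [1 - c]
    for the letters [c].  Its constant terms are diagonal with positive entries,
    and multiplying by such a matrix does not change the sign of the first
    nonzero coefficient of a matrix, so comparing two matrices by the sign of
    the first nonzero coefficient of their difference is a bi-order.

    The free product decomposition ([pi1_connected_sum]).  Both halves of van
    Kampen's theorem are proved through cocycles: functions [F] that send each
    path of [X] to an element of a group [H], invariant under homotopies that
    fix the ends, and multiplicative under concatenation; in other words, functors
    from the fundamental groupoid of [X] to [H].  They can be glued along an open
    cover ([glue_cocycle]): a path is cut into pieces that lie in one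
    member of the cover.  The connected sum is covered by two open sets, the
    [i]-th one being homeomorphic to [N i] minus the centre of its ball, and they
    meet in a copy of R^3 minus a point, the two parametrizations of which differ
    by the inversion v |-> v / |v|^2 ([piece_emb], [piece_overlap]).  Likewise [N i]
    is covered by [N i] minus the centre and by a copy of R^3.  On R^3, and on R^3
    minus a point, every cocycle is a coboundary, so that after a change of gauge
    all cocycles are trivial on the overlaps and the gluing condition holds
    automatically ([connected_sum_free_product]). *)

Set Implicit Arguments.
Unset Strict Implicit.
Unset Printing Implicit Defensive.

Local Open Scope ring_scope.

(** * Homomorphisms, bi-orders and generalized torsion *)

Definition is_hom (G H : groupType) (f : G -> H) := {morph f : a b / (a * b)%g}.

Section HomTheory.
Variables (G H : groupType) (f : G -> H) (fM : is_hom f).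

Lemma hom1 : f 1%g = 1%g.
Proof. by apply: (@mulgI _ (f 1%g)); rewrite -fM !mulg1. Qed.

Lemma homV a : f a^-1%g = (f a)^-1%g.
Proof. by apply: (@mulgI _ (f a)); rewrite -fM !mulgV hom1. Qed.

Lemma hom_conj a b : f (a ^ b)%g = (f a ^ f b)%g.
Proof. by rewrite /conjg !fM homV. Qed.

Lemma hom_prod I (s : seq I) (F : I -> G) :
  f (\prod_(i <- s) F i)%g = (\prod_(i <- s) f (F i))%g.
Proof.
by elim: s => [|i s IH]; rewrite ?big_nil ?hom1 // !big_cons fM IH.
Qed.

Lemma generalized_torsion_hom g : (forall a, f a = 1%g -> a = 1%g) ->
  generalized_torsion g -> generalized_torsion (f g).
Proof.
move=> f1 [g1 [s s0 sE]]; split; first by move=> /f1.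
exists (map f s); first by case: s s0 {sE}.
rewrite big_map -[RHS]hom1 -sE hom_prod.
by apply: eq_bigr => a _; rewrite hom_conj.
Qed.

Lemma bi_orderable_hom : (forall a, f a = 1%g -> a = 1%g) ->
  bi_orderable H -> bi_orderable G.
Proof.
move=> f1 [lt [irr tr tot inv]].
exists (fun a b => lt (f a) (f b)); split => [a|b a c|a b ab|a b c d ab].
- exact: irr.
- exact: tr.
- apply: tot => fab; apply: ab; apply: (@mulIg _ b^-1%g).
  by rewrite mulgV; apply: f1; rewrite fM homV fab mulgV.
- by rewrite !fM; exact: inv.
Qed.

End HomTheory.

Lemma bi_orderable_torsion_free (G : groupType) :
  bi_orderable G -> ~ exists g : G, generalized_torsion g.
Proof.
case=> lt [irr tr tot inv] [g [g1 [s s0 sE]]].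
have inv1 a b c : lt a b -> lt (c * a)%g (c * b)%g.
  by move=> /(@inv _ _ c 1%g); rewrite !mulg1.
have invC a b c : lt a b -> lt (a * c)%g (b * c)%g.
  by move=> /(@inv _ _ 1%g c); rewrite !mul1g.
have pos : lt 1%g g -> forall s : seq G, s <> [::] ->
    lt 1%g (\prod_(a <- s) g ^ a)%g.
  move=> g0; have gJ a : lt 1%g (g ^ a)%g.
    by rewrite -(conj1g a) /conjg; apply: inv1; exact: invC.
  elim=> // a [|b t] IH _; first by rewrite big_seq1.
  rewrite big_cons; apply: tr (gJ a) _.
  by rewrite -[X in lt X]mulg1; apply/inv1/IH.
have neg : lt g 1%g -> forall s : seq G, s <> [::] ->
    lt (\prod_(a <- s) g ^ a)%g 1%g.
  move=> g0; have gJ a : lt (g ^ a)%g 1%g.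
    by rewrite -(conj1g a) /conjg; apply: inv1; exact: invC.
  elim=> // a [|b t] IH _; first by rewrite big_seq1.
  rewrite big_cons; apply: tr (gJ a).
  by rewrite -[X in lt _ X]mulg1; apply/inv1/IH.
by case: (tot _ _ g1) => [/neg|/pos] /(_ _ s0); rewrite sE irr.
Qed.

(** * Integral group rings *)

Section GroupRing.
Variable K : groupType.

Definition translate (s : seq (int * K)) (v : K -> int) (k : K) : int :=
  \sum_(e <- s) e.1 * v (e.2^-1 * k)%g.

(** The group ring acts faithfully on the functions [K -> int] by left
    translations.  Identifying its elements with these operators makes the
    product a composition, so that its associativity needs no proof; the lists
    of pairs (coefficient, group element) only serve as representatives. *)
Record group_ring := GroupRing {
  group_ring_op :> (K -> int) -> K -> int;
  group_ringP : exists s, group_ring_op = translate s }.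

HB.instance Definition _ := gen_eqMixin group_ring.
HB.instance Definition _ := gen_choiceMixin group_ring.

Lemma group_ring_eq (T U : group_ring) : T =2 U -> T = U.
Proof.
case: T U => [T hT] [U hU] /= TU.
have E : T = U by apply/funext => v; apply/funext => k; exact: TU.
by case: _ / E hU => hU; rewrite (Prop_irrelevance hT hU).
Qed.

Definition of_seq s := GroupRing (ex_intro _ s erefl).

Lemma of_seq_surj (T : group_ring) : exists s, T = of_seq s.
Proof.
case: T => T hT; have [s sE] := hT; exists s.
by apply: group_ring_eq => v k /=; rewrite sE.
Qed.

Lemma translate_nil v k : translate [::] v k = 0.
Proof. by rewrite /translate big_nil. Qed.

Lemma translate_cons e s v k :
  translate (e :: s) v k = e.1 * v (e.2^-1 * k)%g + translate s v k.
Proof. by rewrite /translate big_cons. Qed.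

Lemma translate_cat s t v k :
  translate (s ++ t) v k = translate s v k + translate t v k.
Proof. by rewrite /translate big_cat. Qed.

Definition prods (s t : seq (int * K)) :=
  [seq (e.1 * f.1, (e.2 * f.2)%g) | e <- s, f <- t].

Lemma translate_prods s t v k :
  translate (prods s t) v k = translate s (translate t v) k.
Proof.
rewrite /translate /prods big_allpairs_dep; apply: eq_bigr => e _.
rewrite mulr_sumr; apply: eq_bigr => f _ /=.
by rewrite invgM mulrA -mulgA.
Qed.

Lemma translate_opp s v k :
  translate [seq (- e.1, e.2) | e <- s] v k = - translate s v k.
Proof.
by rewrite /translate big_map -sumrN; apply: eq_bigr => e _; rewrite mulNr.
Qed.

Lemma add_subproof (T U : group_ring) :
  exists s, (fun v k => T v k + U v k) = translate s.
Proof.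
have [s ->] := of_seq_surj T; have [t ->] := of_seq_surj U.
by exists (s ++ t); apply/funext => v; apply/funext => k; rewrite translate_cat.
Qed.

Lemma opp_subproof (T : group_ring) :
  exists s, (fun v k => - T v k) = translate s.
Proof.
have [s ->] := of_seq_surj T; exists [seq (- e.1, e.2) | e <- s].
by apply/funext => v; apply/funext => k; rewrite translate_opp.
Qed.

Lemma mul_subproof (T U : group_ring) :
  exists s, (fun v => T (U v)) = translate s.
Proof.
have [s ->] := of_seq_surj T; have [t ->] := of_seq_surj U.
exists (prods s t); apply/funext => v; apply/funext => k.
by rewrite translate_prods.
Qed.

Let zero := of_seq [::].
Let one := of_seq [:: (1, 1%g)].
Let add T U := GroupRing (add_subproof T U).
Let opp T := GroupRing (opp_subproof T).
Let mul T U := GroupRing (mul_subproof T U).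

Let addA : associative add.
Proof. by move=> T U V; apply: group_ring_eq => v k /=; rewrite addrA. Qed.
Let addC : commutative add.
Proof. by move=> T U; apply: group_ring_eq => v k /=; rewrite addrC. Qed.
Let add0 : left_id zero add.
Proof.
by move=> T; apply: group_ring_eq => v k /=; rewrite translate_nil add0r.
Qed.
Let addN : left_inverse zero opp add.
Proof.
by move=> T; apply: group_ring_eq => v k /=; rewrite translate_nil addNr.
Qed.

HB.instance Definition _ := GRing.isZmodule.Build group_ring addA addC add0 addN.

Let oneE v : one v = v.
Proof.
apply/funext => k; rewrite /= translate_cons translate_nil /= mul1r addr0.
by rewrite invg1 mul1g.
Qed.
Let mulA : associative mul.
Proof. by move=> T U V; apply: group_ring_eq. Qed.
Let mul1 : left_id one mul.
Proof.
move=> T; apply: group_ring_eq => v k.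
by rewrite [LHS]/= [_ _ k](congr1 (@^~ k) (oneE _)).
Qed.
Let mul_1 : right_id one mul.
Proof.
by move=> T; apply: group_ring_eq => v k /=; rewrite [translate _ v]oneE.
Qed.
Let mulDl : left_distributive mul +%R.
Proof. by move=> T U V; apply: group_ring_eq. Qed.
Let mulDr : right_distributive mul +%R.
Proof.
move=> T U V; have [s ->] := of_seq_surj T; apply: group_ring_eq => v k /=.
rewrite /translate -big_split /=; apply: eq_bigr => e _.
by rewrite -mulrDr.
Qed.
Let one_neq0 : one != 0.
Proof.
apply/eqP => /(congr1 (fun T : group_ring => T (fun=> 1) 1%g)).
by rewrite oneE /= translate_nil => /eqP; rewrite oner_eq0.
Qed.

HB.instance Definition _ := GRing.Zmodule_isNzRing.Build group_ring
  mulA mul1 mul_1 mulDl mulDr one_neq0.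

Lemma of_seq_cat s t : of_seq (s ++ t) = of_seq s + of_seq t.
Proof. by apply: group_ring_eq => v k; exact: translate_cat. Qed.

Lemma of_seq_prods s t : of_seq (prods s t) = of_seq s * of_seq t.
Proof. by apply: group_ring_eq => v k; exact: translate_prods. Qed.

Lemma of_seq_opp s : of_seq [seq (- e.1, e.2) | e <- s] = - of_seq s.
Proof. by apply: group_ring_eq => v k; exact: translate_opp. Qed.

Definition gmon (k : K) : group_ring := of_seq [:: (1, k)].

Lemma gmon1 : gmon 1%g = 1. Proof. by []. Qed.

Lemma gmonM k l : gmon (k * l)%g = gmon k * gmon l.
Proof. by rewrite /gmon -of_seq_prods /prods /= mulr1. Qed.

Section Order.
Variable lt : rel K.
Hypothesis lt_irr : irreflexive lt.
Hypothesis lt_trans : transitive lt.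
Hypothesis lt_total : forall g h, g <> h -> lt g h \/ lt h g.
Hypothesis ltM : forall g h a b, lt g h -> lt (a * g * b)%g (a * h * b)%g.

Definition leading (c : int) (m : K) (s : seq (int * K)) :=
  (0 < c) && all (fun e => lt e.2 m) s.

(** [T] is positive if it has a representative whose largest group element
    occurs exactly once, with a positive coefficient. *)
Definition gpos (T : group_ring) :=
  exists c m s, leading c m s /\ T = of_seq ((c, m) :: s).

Let ltMl g h a : lt g h -> lt (a * g)%g (a * h)%g.
Proof. by move=> /(@ltM _ _ a 1%g); rewrite !mulg1. Qed.
Let ltMr g h a : lt g h -> lt (g * a)%g (h * a)%g.
Proof. by move=> /(@ltM _ _ 1%g a); rewrite !mul1g. Qed.

Lemma gpos_neq0 T : gpos T -> T <> 0.
Proof.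
move=> [c [m [s [/andP[c0 /allP sm] ->]]]].
(* the value at [m] of the image of the Dirac function at 1 is the coefficient
   of [m] *)
move=> /(congr1 (fun T : group_ring => T (fun k => (k == 1%g)%:R) m)) /=.
rewrite translate_nil translate_cons /= mulVg eqxx mulr1 /translate.
rewrite big_seq big1 ?addr0 => [c0'|e /sm em]; first by rewrite c0' in c0.
have [/eqP|] := eqVneq _ 1%g; last by rewrite mulr0.
rewrite mulg_eq1 => /eqP /invg_inj e2; move: em.
by rewrite e2 lt_irr.
Qed.

Lemma of_seqE T s : of_seq s = T -> forall v k, translate s v k = T v k.
Proof. by move=> <-. Qed.

Lemma of_seq_consC e f s : of_seq (e :: f :: s) = of_seq (f :: e :: s).
Proof. by apply: group_ring_eq => v k /=; rewrite !translate_cons addrCA. Qed.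

Lemma gposD T U : gpos T -> gpos U -> gpos (T + U).
Proof.
have key c m s d n t : leading c m s -> leading d n t -> lt n m ->
    leading c m (s ++ (d, n) :: t).
  move=> /andP[c0 sm] /andP[_ tn] nm; rewrite /leading c0 all_cat sm /= nm /=.
  by apply: sub_all tn => e /= en; exact: lt_trans nm.
move=> [c [m [s [csm ->]]]] [d [n [t [dtn ->]]]]; rewrite -of_seq_cat /=.
have [mn|mn] := pselect (m = n).
  subst n; exists (c + d), m, (s ++ t); split.
    move: csm dtn => /andP[c0 sm] /andP[d0 tm].
    by rewrite /leading addr_gt0 // all_cat sm.
  apply: group_ring_eq => v k /=.
  by rewrite !(translate_cons, translate_cat) /= mulrDl addrA addrACA !addrA.
have [nm|nm] := lt_total mn.
  exists d, n, (t ++ (c, m) :: s); split; first exact: key.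
  rewrite -!cat_cons !of_seq_cat; exact: addrC.
by exists c, m, (s ++ (d, n) :: t); split; first exact: key.
Qed.

(** The product of the leading terms dominates all the other products of terms:
    this is where invariance of the order on both sides is used. *)
Lemma gposM T U : gpos T -> gpos U -> gpos (T * U).
Proof.
move=> [c [m [s [/andP[c0 /allP sm] ->]]]] [d [n [t [/andP[d0 /allP tn] ->]]]].
pose r := [seq (c * f.1, (m * f.2)%g) | f <- t].
pose q := prods s ((d, n) :: t).
exists (c * d), (m * n)%g, (r ++ q); split; last by rewrite -of_seq_prods.
rewrite /leading mulr_gt0 //=; apply/allP => e; rewrite mem_cat => /orP[].
  by move=> /mapP[f /tn fn ->] /=; exact: ltMl.
move=> /allpairsP[[a b] /= [/sm am + ->]] /=.
rewrite inE => /predU1P[->|/tn bn] /=; first exact: ltMr.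
by apply: lt_trans (ltMr _ am); exact: ltMl.
Qed.

Lemma gpos_mon k : gpos (gmon k).
Proof. by exists 1, k, [::]. Qed.

Lemma gpos_monB k l : lt k l -> gpos (gmon l - gmon k).
Proof.
move=> kl; exists 1, l, [:: (-1, k)]; split; first by rewrite /leading /= kl.
by rewrite /gmon -of_seq_opp -of_seq_cat.
Qed.

(** Terms are merged one at a time; when two of them cancel, the induction
    hypothesis is applied to what remains, hence the bound on the size. *)
Lemma leading_exists n (s : seq (int * K)) : (size s <= n)%N ->
  of_seq s = 0 \/ exists (c : int) m t, [/\ c != 0, all (fun e => lt e.2 m) t,
    (size t < size s)%N & of_seq s = of_seq ((c, m) :: t)].
Proof.
elim: n s => [|n IH] [|[c m] s] //= sn; [by left|by left|].
have [s0|[d [l [t [d0 tl ts sE]]]]] := IH s sn.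
  have [c0|c0] := eqVneq c 0.
    left; apply: group_ring_eq => v k /=.
    by rewrite translate_cons (of_seqE s0) c0 mul0r add0r.
  right; exists c, m, [::]; split => //.
  apply: group_ring_eq => v k.
  by rewrite /= !translate_cons; congr (_ + _); exact: of_seqE s0 v k.
have E : of_seq ((c, m) :: s) = of_seq ((c, m) :: (d, l) :: t).
  apply: group_ring_eq => v k.
  by rewrite /= (translate_cons _ s) (of_seqE sE) /= !translate_cons.
have [ml|ml] := pselect (m = l).
  subst l; have [cd|cd] := eqVneq (c + d) 0.
    have E' : of_seq ((c, m) :: s) = of_seq t.
      rewrite E; apply: group_ring_eq => v k /=.
      by rewrite !translate_cons /= addrA -mulrDl cd mul0r add0r.
    rewrite E'; have [|->|] := IH t; [exact: leq_trans (ltnW ts) sn|by left|].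
    move=> [c' [m' [t' [? ? t't ?]]]]; right; exists c', m', t'; split => //.
    by apply: ltn_trans t't _; rewrite ltnS ltnW.
  right; exists (c + d), m, t; split => //; first exact: ltnW.
  rewrite E; apply: group_ring_eq => v k /=.
  by rewrite !translate_cons /= addrA -mulrDl.
have [{}ml|{}ml] := lt_total ml.
  right; exists d, l, ((c, m) :: t); split => //=; first by rewrite ml.
  by rewrite E of_seq_consC.
have [c0|c0] := eqVneq c 0.
  right; exists d, l, t; split => //; first exact: ltnW.
  by rewrite E c0; apply: group_ring_eq => v k;
    rewrite /= translate_cons mul0r add0r.
right; exists c, m, ((d, l) :: t); split => //=.
rewrite ml /=; apply: sub_all tl => e /= el; exact: lt_trans ml.
Qed.

Lemma gpos_total T : [\/ T = 0, gpos T | gpos (- T)].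
Proof.
have [s ->] := of_seq_surj T.
have [->|[c [m [t [c0 tm _ ->]]]]] := leading_exists (leqnn (size s)).
  exact: Or31.
have [c1|c1] := ltP 0 c.
  by apply: Or32; exists c, m, t; rewrite /leading c1.
apply: Or33; exists (- c), m, [seq (- e.1, e.2) | e <- t].
rewrite -of_seq_opp /=; split => //; rewrite /leading oppr_gt0 lt_neqAle.
rewrite all_map; apply/andP; split; first by rewrite c0.
by apply: sub_all tm.
Qed.

End Order.
End GroupRing.

(** * Matrices with polynomial entries *)

Section RingUnits.
Variable S : nzRingType.

Record ring_unit := RingUnit {
  unit_val : S; unit_inv : S;
  unit_valV : unit_val * unit_inv = 1; unit_Vval : unit_inv * unit_val = 1 }.

HB.instance Definition _ := gen_eqMixin ring_unit.
HB.instance Definition _ := gen_choiceMixin ring_unit.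

Lemma ring_unit_inj (u v : ring_unit) : unit_val u = unit_val v -> u = v.
Proof.
case: u v => [u u' uu' u'u] [v v' vv' v'v] /= uv; subst v.
have E : u' = v' by rewrite -[u']mulr1 -vv' mulrA u'u mul1r.
subst v'; by rewrite (Prop_irrelevance uu' vv') (Prop_irrelevance u'u v'v).
Qed.

Let one := RingUnit (mulr1 (1 : S)) (mulr1 (1 : S)).
Let inv (u : ring_unit) := RingUnit (unit_Vval u) (unit_valV u).

Lemma unit_mul_subproof (u v : ring_unit) :
  unit_val u * unit_val v * (unit_inv v * unit_inv u) = 1.
Proof. by rewrite mulrA -(mulrA (unit_val u)) unit_valV mulr1 unit_valV. Qed.

Lemma unit_mul_subproof' (u v : ring_unit) :
  unit_inv v * unit_inv u * (unit_val u * unit_val v) = 1.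
Proof. by rewrite mulrA -(mulrA (unit_inv v)) unit_Vval mulr1 unit_Vval. Qed.

Let mul u v := RingUnit (unit_mul_subproof u v) (unit_mul_subproof' u v).

Let mulA : associative mul.
Proof. by move=> u v w; apply: ring_unit_inj; rewrite /= mulrA. Qed.
Let mul1 : left_id one mul.
Proof. by move=> u; apply: ring_unit_inj; rewrite /= mul1r. Qed.
Let mul_1 : right_id one mul.
Proof. by move=> u; apply: ring_unit_inj; rewrite /= mulr1. Qed.
Let mulV : left_inverse one inv mul.
Proof. by move=> u; apply: ring_unit_inj; rewrite /= unit_Vval. Qed.
Let mul_V : right_inverse one inv mul.
Proof. by move=> u; apply: ring_unit_inj; rewrite /= unit_valV. Qed.

HB.instance Definition _ := isGroup.Build ring_unit mulA mul1 mul_1 mulV mul_V.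

Lemma ring_unitM (u v : ring_unit) : unit_val (u * v)%g = unit_val u * unit_val v.
Proof. by []. Qed.

End RingUnits.

Section Matrix2.
Variable S : nzRingType.
Implicit Types x y z w : S.

Definition mx2 x y z w : 'M[S]_2 := \matrix_(i, j)
  if i == ord0 then if j == ord0 then x else y
  else if j == ord0 then z else w.

Lemma mx2_surj (T : 'M[S]_2) : exists x y z w, T = mx2 x y z w.
Proof.
exists (T ord0 ord0), (T ord0 ord_max), (T ord_max ord0), (T ord_max ord_max).
apply/matrixP => i j; rewrite mxE.
have C (k : 'I_2) : k = if k == ord0 then ord0 else ord_max.
  by case: k => [[|[|//]] ?]; apply: val_inj.
by rewrite {1}(C i) {1}(C j); case: (i == ord0); case: (j == ord0).
Qed.

Lemma mx2_inj x y z w x' y' z' w' : mx2 x y z w = mx2 x' y' z' w' ->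
  [/\ x = x', y = y', z = z' & w = w'].
Proof.
move=> /matrixP E; split.
- by have := E ord0 ord0; rewrite !mxE.
- by have := E ord0 ord_max; rewrite !mxE.
- by have := E ord_max ord0; rewrite !mxE.
- by have := E ord_max ord_max; rewrite !mxE.
Qed.

Lemma mx2M x y z w x' y' z' w' : mx2 x y z w * mx2 x' y' z' w' =
  mx2 (x * x' + y * z') (x * y' + y * w') (z * x' + w * z') (z * y' + w * w').
Proof.
apply/matrixP => i j; rewrite !mxE !big_ord_recl big_ord0 !mxE /= addr0.
by case: (i == ord0); case: (j == ord0).
Qed.

Lemma mx2D x y z w x' y' z' w' : mx2 x y z w + mx2 x' y' z' w' =
  mx2 (x + x') (y + y') (z + z') (w + w').
Proof.
by apply/matrixP => i j; rewrite !mxE; case: (i == ord0); case: (j == ord0).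
Qed.

Lemma mx2N x y z w : - mx2 x y z w = mx2 (- x) (- y) (- z) (- w).
Proof.
by apply/matrixP => i j; rewrite !mxE; case: (i == ord0); case: (j == ord0).
Qed.

Lemma mx2_1 : mx2 1 0 0 1 = 1.
Proof.
apply/matrixP => i j; rewrite !mxE.
by case: i => [[|[|//]] ?]; case: j => [[|[|//]] ?].
Qed.

Lemma mx2_0 : mx2 0 0 0 0 = 0.
Proof. by apply/matrixP => i j; rewrite !mxE; do 2 case: ifP. Qed.

End Matrix2.

Section MatrixRep.
Variable S : nzRingType.
Local Notation P := {poly 'M[S]_2}.

(** With [u] the elementary matrix [1 + t E12] and [l := 1 + t E21], [rep false c]
    is the conjugate [u * diag(c, 1) * u^-1] and [rep true c] is the conjugate
    [l * diag(1, c) * l^-1]; this is why [rep i] is multiplicative. *)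
Definition rdiag (i : bool) (c : S) : 'M[S]_2 :=
  if i then mx2 1 0 0 c else mx2 c 0 0 1.
Definition roff (i : bool) (c : S) : 'M[S]_2 :=
  if i then mx2 0 0 c 0 else mx2 0 c 0 0.

Definition rep (i : bool) (c : S) : P :=
  (rdiag i c)%:P + (roff i (1 - c))%:P * 'X.

Lemma rep1 i : rep i 1 = 1.
Proof.
rewrite /rep subrr; have -> : roff i 0 = 0 by case: i; exact: mx2_0.
by rewrite mul0r addr0; have -> : rdiag i 1 = 1 by case: i; exact: mx2_1.
Qed.

Lemma repM i c d : rep i (c * d) = rep i c * rep i d.
Proof.
rewrite /rep mulrDl !mulrDr -!polyCM addrA.
have E0 : (roff i (1 - c))%:P * 'X * ((roff i (1 - d))%:P * 'X) = 0 :> P.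
  rewrite mulrA -(mulrA _ 'X) -(commr_polyX _%:P) mulrA -polyCM.
  have -> : roff i (1 - c) * roff i (1 - d) = 0; last by rewrite !mul0r.
  by case: i; rewrite mx2M !(mul0r, mulr0, addr0) mx2_0.
rewrite E0 {E0} addr0 mulrA -polyCM -mulrA -(commr_polyX _%:P) mulrA -polyCM.
rewrite -addrA -mulrDl -polyCD; congr (_%:P + _%:P * 'X).
  by case: i; rewrite mx2M !(mul0r, mulr0, mul1r, mulr1, addr0, add0r).
have H : c * (1 - d) + (1 - c) = 1 - c * d.
  by rewrite mulrBr mulr1 addrC addrA subrK.
by case: i; rewrite !mx2M mx2D !(mul0r, mulr0, mul1r, mulr1, addr0, add0r, H).
Qed.

Lemma coef_repM0 i c (Q : P) : (rep i c * Q)`_0 = rdiag i c * Q`_0.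
Proof.
rewrite /rep mulrDl coefD coefCM -mulrA -commr_polyX mulrA coefMX eqxx.
by rewrite addr0.
Qed.

Lemma coef_repMS i c (Q : P) n :
  (rep i c * Q)`_n.+1 = rdiag i c * Q`_n.+1 + roff i (1 - c) * Q`_n.
Proof.
by rewrite /rep mulrDl coefD coefCM -mulrA -commr_polyX mulrA coefMX coefCM.
Qed.

End MatrixRep.

Section OrderedMatrices.
Variables (S : nzRingType) (pos : S -> Prop).
Hypothesis pos_neq0 : forall x, pos x -> x <> 0.
Hypothesis posD : forall x y, pos x -> pos y -> pos (x + y).
Hypothesis posM : forall x y, pos x -> pos y -> pos (x * y).
Hypothesis pos_total : forall x, [\/ x = 0, pos x | pos (- x)].

Lemma pos_mul_neq0 (x y : S) : x <> 0 -> y <> 0 -> x * y <> 0.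
Proof.
case: (pos_total x) => // px _; case: (pos_total y) => // py _.
- exact: pos_neq0 (posM px py).
- by move=> xy; apply: (pos_neq0 (posM px py)); rewrite mulrN xy oppr0.
- by move=> xy; apply: (pos_neq0 (posM px py)); rewrite mulNr xy oppr0.
- by move=> xy; apply: (pos_neq0 (posM px py)); rewrite mulrNN xy.
Qed.

(** Reading the entries one by one is compatible with products by diagonal matrices
    with positive entries, because these preserve the sign of each entry. *)
Definition mpos (T : 'M[S]_2) := exists x y z w, T = mx2 x y z w /\
  (pos x \/ x = 0 /\ (pos y \/ y = 0 /\ (pos z \/ z = 0 /\ pos w))).

Lemma mpos_neq0 T : mpos T -> T <> 0.
Proof.
move=> [x [y [z [w [-> h]]]]]; rewrite -mx2_0 => /mx2_inj[xE yE zE wE].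
by move: h => [|[_ [|[_ [|[_]]]]]] /pos_neq0.
Qed.

Lemma mposD T U : mpos T -> mpos U -> mpos (T + U).
Proof.
move=> [x [y [z [w [-> h]]]]] [x' [y' [z' [w' [-> h']]]]]; rewrite mx2D.
do 4 eexists; split; first by [].
move: h => [p|[-> [p|[-> [p|[-> p]]]]]];
  move: h' => [p'|[-> [p'|[-> [p'|[-> p']]]]]]; rewrite ?addr0 ?add0r;
  have := posD p p'; tauto.
Qed.

Lemma mpos_total T : [\/ T = 0, mpos T | mpos (- T)].
Proof.
have [x [y [z [w ->]]]] := mx2_surj T; rewrite mx2N.
have [x0|px|px] := pos_total x.
- have [y0|py|py] := pos_total y.
  + have [z0|pz|pz] := pos_total z.
    * have [w0|pw|pw] := pos_total w.
      - by apply: Or31; rewrite x0 y0 z0 w0 mx2_0.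
      - by apply: Or32; do 4 eexists; split; first by []; tauto.
      - by apply: Or33; do 4 eexists; split; first by [];
          rewrite x0 y0 z0 oppr0; tauto.
    * by apply: Or32; do 4 eexists; split; first by []; tauto.
    * by apply: Or33; do 4 eexists; split; first by [];
        rewrite x0 y0 oppr0; tauto.
  + by apply: Or32; do 4 eexists; split; first by []; tauto.
  + by apply: Or33; do 4 eexists; split; first by []; rewrite x0 oppr0; tauto.
- by apply: Or32; do 4 eexists; split; first by []; tauto.
- by apply: Or33; do 4 eexists; split; first by []; tauto.
Qed.

Definition pos_diag (D : 'M[S]_2) :=
  exists p q, [/\ pos p, pos q & D = mx2 p 0 0 q].

Lemma mposMl D T : pos_diag D -> mpos T -> mpos (D * T).
Proof.
move=> [p [q [pp pq ->]]] [x [y [z [w [-> h]]]]].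
rewrite mx2M !(mul0r, addr0, add0r); do 4 eexists; split; first by [].
move: h => [h|[-> [h|[-> [h|[-> h]]]]]]; rewrite ?mulr0;
  have := posM pp h; have := posM pq h; tauto.
Qed.

Lemma mposMr D T : pos_diag D -> mpos T -> mpos (T * D).
Proof.
move=> [p [q [pp pq ->]]] [x [y [z [w [-> h]]]]].
rewrite mx2M !(mulr0, addr0, add0r); do 4 eexists; split; first by [].
move: h => [h|[-> [h|[-> [h|[-> h]]]]]]; rewrite ?mul0r;
  have := posM h pp; have := posM h pq; tauto.
Qed.

Local Notation P := {poly 'M[S]_2}.

Definition ppos (Q : P) :=
  exists n, (forall m, (m < n)%N -> Q`_m = 0) /\ mpos Q`_n.

Lemma ppos_neq0 (Q : P) : ppos Q -> Q <> 0.
Proof. by move=> [n [_ /mpos_neq0 Qn]] Q0; apply: Qn; rewrite Q0 coef0. Qed.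

Lemma pposD (Q U : P) : ppos Q -> ppos U -> ppos (Q + U).
Proof.
move=> [n [Qlt Qn]] [m [Ult Um]]; have [nm|mn|nm] := ltngtP n m.
- exists n; split=> [k kn|]; last by rewrite coefD Ult // addr0.
  by rewrite coefD Qlt // Ult ?addr0 //; exact: ltn_trans nm.
- exists m; split=> [k km|]; last by rewrite coefD Qlt // add0r.
  by rewrite coefD Qlt ?Ult ?addr0 //; exact: ltn_trans mn.
- subst m; exists n; split=> [k kn|]; first by rewrite coefD Qlt // Ult ?addr0.
  by rewrite coefD; exact: mposD.
Qed.

Lemma ppos_total (Q : P) : [\/ Q = 0, ppos Q | ppos (- Q)].
Proof.
have [->|Q0] := eqVneq Q 0; first exact: Or31.
have ex : exists n, Q`_n != 0.
  by exists (size Q).-1; rewrite -/(lead_coef Q) lead_coef_eq0.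
case: (ex_minnP ex) => n /eqP Qn Qmin.
have Qlt m : (m < n)%N -> Q`_m = 0.
  by move=> mn; apply/eqP; apply: contraTT mn => /Qmin; rewrite -leqNgt.
have [//|p|p] := mpos_total Q`_n; [apply: Or32|apply: Or33]; exists n => //.
by rewrite coefN; split => // m /Qlt; rewrite coefN => ->; rewrite oppr0.
Qed.

(** The lowest coefficient of [U * Q] is that of [Q], with rows rescaled by
    positive elements. *)
Lemma pposMl (U Q : P) : pos_diag U`_0 -> ppos Q -> ppos (U * Q).
Proof.
move=> pU [n [Qlt Qn]]; exists n; split=> [m mn|].
  rewrite coefM big1 // => j _; rewrite Qlt ?mulr0 //.
  by apply: leq_ltn_trans mn; exact: leq_subr.
rewrite coefM big_ord_recl subn0 big1 ?addr0 => [|j _]; first exact: mposMl.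
by rewrite Qlt ?mulr0 //= /bump /= -subn_gt0; have := ltn_ord j; lia.
Qed.

Lemma pposMr (U Q : P) : pos_diag U`_0 -> ppos Q -> ppos (Q * U).
Proof.
move=> pU [n [Qlt Qn]]; exists n; split=> [m mn|].
  rewrite coefM big1 // => j _; rewrite Qlt ?mul0r //.
  by apply: leq_ltn_trans mn; rewrite -ltnS.
rewrite coefM big_ord_recr /= subnn big1 ?add0r => [|j _]; first exact: mposMr.
by rewrite Qlt ?mul0r.
Qed.

End OrderedMatrices.

(** * Free products of bi-orderable groups *)

Lemma bi_orderable_prod (G H : groupType) :
  bi_orderable G -> bi_orderable H -> bi_orderable (G * H)%type.
Proof.
move=> [lt [irr tr tot inv]] [lt' [irr' tr' tot' inv']].
exists (fun a b => lt a.1 b.1 || (a.1 == b.1) && lt' a.2 b.2).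
split => [[a a']|[b b'] [a a'] [c c']|[a a'] [b b']|[a a'] [b b'] [c c'] [d d']]
  /=.
- by rewrite irr irr' andbF.
- move=> /orP[ab|/andP[/eqP -> ab]] /orP[bc|/andP[/eqP <- bc]].
  + by rewrite (tr _ _ _ ab bc).
  + by rewrite ab.
  + by rewrite bc.
  + by rewrite eqxx (tr' _ _ _ ab bc) orbT.
- have [<-|/eqP ab] := eqVneq a b.
    rewrite !irr /= => ab; apply: tot' => ab'; apply: ab; congr (_, _).
    exact: ab'.
  by move=> _; case: (tot _ _ ab) => ->; [left|right].
- move=> /orP[/inv ab|/andP[/eqP -> /inv' ab]]; first by rewrite ab.
  by rewrite eqxx ab orbT.
Qed.

Section FreeProduct.
Variables (Gs : bool -> groupType) (G : groupType) (phi : forall i, Gs i -> G).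

Definition free_product : Prop :=
  [/\ forall i, is_hom (@phi i),
      forall g, exists s : seq {i & Gs i},
        g = (\prod_(e <- s) phi (tagged e))%g &
      forall (H : groupType) (alpha : forall i, Gs i -> H),
        (forall i, is_hom (@alpha i)) ->
        exists2 rho : G -> H, is_hom rho & forall i x, rho (phi x) = alpha i x].

Hypothesis fp : free_product.

Let phiM i : is_hom (@phi i). Proof. by case: fp. Qed.

(** The universal property, applied to the identity of one factor and the
    trivial morphism on the other one, yields a retraction onto each factor. *)
Lemma free_product_inj i (x : Gs i) : phi x = 1%g -> x = 1%g.
Proof.
case: fp => _ _ univ.
pose a0 j : Gs j -> Gs false := if j then fun=> 1%g else id.
pose a1 j : Gs j -> Gs true := if j then id else fun=> 1%g.
have a0M j : is_hom (a0 j) by case: j => u v //=; rewrite mulg1.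
have a1M j : is_hom (a1 j) by case: j => u v //=; rewrite mulg1.
have [r0 r0M r0E] := univ _ _ a0M; have [r1 r1M r1E] := univ _ _ a1M.
case: i x => x x1; [have := r1E true x|have := r0E false x];
  by rewrite x1 hom1.
Qed.

(** The elements that have a reduced expression; the index is the factor of its
    first letter. *)
Inductive reduced : bool -> G -> Prop :=
| Reduced1 i (x : Gs i) : x <> 1%g -> reduced i (phi x)
| ReducedM i (x : Gs i) g :
    x <> 1%g -> reduced (~~ i) g -> reduced i (phi x * g)%g.

Lemma reduced_exists g : g <> 1%g -> exists i, reduced i g.
Proof.
have [_ gen _] := fp; have [s ->] := gen g.
elim: s {g} => [|[j y] s IH]; rewrite ?big_nil // big_cons /=.
set g := (\prod_(_ <- _) _)%g in IH *.
have [->|y1] := pselect (y = 1%g); first by rewrite hom1 // mul1g.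
have [->|/IH[i ig]] := pselect (g = 1%g); first by exists j; rewrite mulg1; left.
have neg (k l : bool) : l != k -> k = ~~ l by case: k; case: l.
case: {g IH} i _ / ig y y1 => i x => [x1|g x1 ig] y y1.
  have [E|/neg E] := eqVneq j i; last first.
    by move=> _; exists j; right => //; rewrite -E; left.
  subst j; rewrite -phiM => xy; exists i; left => E.
  by apply: xy; rewrite E hom1.
have [E|/neg E] := eqVneq j i; last first.
  by move=> _; exists j; right => //; rewrite -E; right.
subst j; rewrite mulgA -phiM => _.
have [->|xy] := pselect (y * x = 1)%g; last by exists i; right.
by exists (~~ i); rewrite hom1 // mul1g.
Qed.

Section Order.
Hypothesis ordGs : forall i, bi_orderable (Gs i).

Let K : groupType := (Gs false * Gs true)%type.
Let emb i : Gs i -> K :=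
  if i return Gs i -> K then fun x => (1%g, x) else fun x => (x, 1%g).
Let embM i : is_hom (@emb i).
Proof.
case: i => x y.
  by rewrite -[LHS]/(1%g, x * y)%g -[RHS]/(1 * 1, x * y)%g mulg1.
by rewrite -[LHS]/(x * y, 1%g)%g -[RHS]/(x * y, 1 * 1)%g mulg1.
Qed.
Let emb1 i x : @emb i x = 1%g -> x = 1%g.
Proof. by case: i x => x []. Qed.

Let S : nzRingType := group_ring K.
Let P : nzRingType := {poly 'M[S]_2}.

Let alpha_subproof i (x : Gs i) :
  rep i (gmon (emb x)) * rep i (gmon (emb x^-1)%g) = 1.
Proof. by rewrite -repM -gmonM -embM mulgV (hom1 (@embM i)) gmon1 rep1. Qed.

Let alpha_subproof' i (x : Gs i) :
  rep i (gmon (emb x^-1)%g) * rep i (gmon (emb x)) = 1.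
Proof. by rewrite -repM -gmonM -embM mulVg (hom1 (@embM i)) gmon1 rep1. Qed.

Let alpha i (x : Gs i) : ring_unit P :=
  RingUnit (alpha_subproof x) (alpha_subproof' x).

Let alphaM i : is_hom (@alpha i).
Proof.
by move=> x y; apply: ring_unit_inj; rewrite ring_unitM /= embM gmonM repM.
Qed.

(** Vinogradov's theorem.  The matrices [M g] represent [G] faithfully, and the order
    on matrices is pulled back along this representation. *)
Theorem free_product_bi_orderable : bi_orderable G.
Proof.
have [lt [irr tr tot inv]] := bi_orderable_prod (ordGs false) (ordGs true).
pose pos := @gpos K lt.
have pos0 := gpos_neq0 irr.
have posD := gposD tr tot.
have posM := gposM tr inv.
have posT := gpos_total tr tot.
have [_ gen univ] := fp; have [rho rhoM rhoE] := univ _ _ alphaM.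
pose M (g : G) : {poly 'M[S]_2} := unit_val (rho g).
have MM g h : M (g * h)%g = M g * M h by rewrite /M rhoM.
have M1 : M 1%g = 1 by rewrite /M hom1.
have Mphi i (x : Gs i) : M (phi x) = rep i (gmon (emb x)) by rewrite /M rhoE.
have diag g : pos_diag pos (M g)`_0.
  have [s ->] := gen g; elim: s => [|[i x] s [p [q [pp pq E]]]].
    rewrite big_nil M1 coef1; exists 1, 1; rewrite mx2_1; split => //;
      exact: (gpos_mon lt 1%g).
  rewrite big_cons MM Mphi coef_repM0 E.
  have pe := gpos_mon lt (emb x).
  case: i x pe => x pe /=; rewrite /rdiag mx2M !(mulr0, mul0r, addr0, add0r, mul1r).
    by exists p, (gmon (emb x) * q); split => //; exact: posM.
  by exists (gmon (emb x) * p), q; split => //; exact: posM.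
have B0 i (x : Gs i) : x <> 1%g -> 1 - gmon (emb x) <> 0.
  move=> x1; have /tot[|] : emb x <> 1%g by move=> /emb1.
    by move=> /(gpos_monB)/pos0; rewrite gmon1.
  move=> /(gpos_monB)/pos0 h E; apply: h; rewrite -[LHS]opprK opprB gmon1 E.
  exact: oppr0.
(* the coefficient of [t^n.+1] in a reduced word of length [n.+1] is nonzero, and
   it lives in the row of the first letter; the next letter on the left, which
   belongs to the other factor, moves it to the other row *)
have top i g : reduced i g -> exists n z w,
    [/\ z <> 0 \/ w <> 0,
        (M g)`_n.+1 = if i then mx2 0 0 z w else mx2 z w 0 0 &
        forall m, (n.+1 < m)%N -> (M g)`_m = 0].
  elim=> {i g} [i x x1|i x g x1 _ [n [z [w [zw E lt_n]]]]].
    rewrite Mphi; exists 0; move: (gmon _) (B0 _ _ x1) => c bx.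
    have cE m : (rep i (c))`_m.+1 =
        if m == 0 then roff i (1 - c) else 0.
      by rewrite -[rep _ _]mulr1 coef_repMS !coef1 /= mulr0 add0r;
        case: (m) => [|k]; rewrite ?mulr1 ?mulr0.
    exists (if i then 1 - c else 0),
           (if i then 0 else 1 - c).
    split; first by case: (i) bx; tauto.
      by rewrite cE /= /roff; case: (i).
    by move=> [//|[//|m]] _; rewrite cE.
  rewrite MM Mphi; move: (gmon _) (B0 _ _ x1) => c bx.
  exists n.+1, ((1 - c) * z), ((1 - c) * w).
  have nz u : u <> 0 -> (1 - c) * u <> 0.
    exact: (pos_mul_neq0 pos0 posM posT).
  split; first by move: (nz z) (nz w); tauto.
    rewrite coef_repMS lt_n // mulr0 add0r E.
    by case: (i); rewrite mx2M !(mulr0, mul0r, addr0, add0r).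
  move=> [//|m] nm; rewrite coef_repMS !lt_n ?mulr0 ?addr0 //; lia.
have Minj g : M g = 1 -> g = 1%g.
  move=> Mg; apply: contrapT => /reduced_exists[i /top[n [z [w [zw + _]]]]].
  rewrite Mg coef1 mulr0n -mx2_0.
  by case: (i) => /mx2_inj[*]; case: zw; apply; congruence.
have Minj2 g h : M g = M h -> g = h.
  move=> E; apply: (@mulIg _ h^-1%g); rewrite mulgV; apply: Minj.
  by rewrite MM E -MM mulgV.
pose ppos := ppos pos.
exists (fun g h => `[< ppos (M h - M g) >]); split.
- by move=> g; apply/asboolP => /(ppos_neq0 pos0); rewrite subrr.
- move=> h g k /asboolP gh /asboolP hk; apply/asboolP.
  have := pposD posD gh hk; rewrite addrC.
  by have -> : M k - M h + (M h - M g) = M k - M g by rewrite addrA subrK.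
- move=> g h gh; have [E|p|p] := ppos_total posT (M h - M g).
  + by case: gh; apply: Minj2; apply/esym/eqP; rewrite -subr_eq0 E.
  + by left; apply/asboolP.
  + by right; apply/asboolP; rewrite opprB in p.
- move=> g h a b /asboolP gh; apply/asboolP.
  rewrite !MM -mulrBl -mulrBr; apply: pposMr => //; exact: pposMl.
Qed.

End Order.
End FreeProduct.

(** * Continuous functions of a real variable *)

Local Open Scope classical_set_scope.

Section ContinuousFunctions.
Context {T : topologicalType} {R : realType}.
Implicit Types f g : T -> R.

Lemma ctsD f g : continuous f -> continuous g -> continuous (fun z => f z + g z).
Proof. by move=> cf cg z; apply: cvgD; [exact: cf|exact: cg]. Qed.

Lemma ctsB f g : continuous f -> continuous g -> continuous (fun z => f z - g z).
Proof. by move=> cf cg z; apply: cvgB; [exact: cf|exact: cg]. Qed.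

Lemma ctsM f g : continuous f -> continuous g -> continuous (fun z => f z * g z).
Proof. by move=> cf cg z; apply: cvgM; [exact: cf|exact: cg]. Qed.

Lemma cts_min f g :
  continuous f -> continuous g -> continuous (fun z => Num.min (f z) (g z)).
Proof. by move=> cf cg z; apply: continuous_min; [exact: cf|exact: cg]. Qed.

Lemma cts_max f g :
  continuous f -> continuous g -> continuous (fun z => Num.max (f z) (g z)).
Proof. by move=> cf cg z; apply: continuous_max; [exact: cf|exact: cg]. Qed.

Lemma cts_cst {U : topologicalType} (c : U) : continuous (fun _ : T => c).
Proof. by move=> z; exact: cvg_cst. Qed.

Lemma cts_id : continuous (fun z : T => z).
Proof. by move=> z; exact: cvg_id. Qed.

Lemma cts_fst {U V : topologicalType} (f : T -> U * V) :
  continuous f -> continuous (fun z => (f z).1).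
Proof. by move=> cf; apply: (continuous_compose (@continuous_pi1 U V)). Qed.

Lemma cts_snd {U V : topologicalType} (f : T -> U * V) :
  continuous f -> continuous (fun z => (f z).2).
Proof. by move=> cf; apply: (continuous_compose (@continuous_pi2 U V)). Qed.

End ContinuousFunctions.

(** Total functions on the real line are used as paths and as homotopies; only
    their restriction to the unit interval matters, and precomposing with
    [truncate] turns a function that is meaningful there into a total one. *)
Definition truncate {R : realType} (t : R) : R := Num.min 1 (Num.max 0 t).

(** The choice of a lemma is dictated by the syntax of the function: leaving it to
    unification is very slow. *)
Ltac cts_step := cbv beta; lazymatch goal with
  | |- continuous (fun z => (@?a z, @?b z)) =>
      refine (@continuous_pair _ _ _ a b _ _)
  | |- continuous (fun z => truncate _) => rewrite /truncate
  | |- continuous (fun z => itv_val (@?a z)) =>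
      refine (@continuous_compose _ _ _ _ a (@itv_val_continuous _) _)
  | |- continuous (fun z => Num.min (@?a z) (@?b z)) =>
      refine (@cts_min _ _ a b _ _)
  | |- continuous (fun z => Num.max (@?a z) (@?b z)) =>
      refine (@cts_max _ _ a b _ _)
  | |- continuous (fun z => @?a z - @?b z) =>
      refine (@ctsB _ _ a b _ _)
  | |- continuous (fun z => @?a z + @?b z) =>
      refine (@ctsD _ _ a b _ _)
  | |- continuous (fun z => @?a z * @?b z) =>
      refine (@ctsM _ _ a b _ _)
  | |- continuous (fun z => z) => exact: cts_id
  | |- continuous (fun z => fst z) => exact: continuous_pi1
  | |- continuous (fun z => snd z) => exact: continuous_pi2
  | |- continuous (fun z => fst (@?a z)) => refine (@cts_fst _ _ _ a _)
  | |- continuous (fun z => snd (@?a z)) => refine (@cts_snd _ _ _ a _)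
  | H : continuous ?p |- continuous (fun z => ?p (@?a z)) =>
      refine (@continuous_compose _ _ _ p a H _)
  | |- continuous itv_val => exact: itv_val_continuous
  | |- continuous _ => first [assumption | exact: cts_cst]
  end.
Ltac cts := repeat cts_step.

Section Truncate.
Context {R : realType}.
Implicit Types t : R.

Lemma truncate_continuous : continuous (@truncate R).
Proof. by rewrite /truncate; cts. Qed.

Lemma truncate_id t : 0 <= t -> t <= 1 -> truncate t = t.
Proof. by move=> t0 t1; rewrite /truncate max_r // min_r. Qed.

Lemma truncate_ge0 t : 0 <= truncate t.
Proof. by rewrite /truncate le_min ler01 le_max lexx. Qed.

Lemma truncate_le1 t : truncate t <= 1.
Proof. by rewrite /truncate ge_min lexx. Qed.

Lemma truncate0 : truncate (0 : R) = 0.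
Proof. by rewrite truncate_id. Qed.

Lemma truncate1 : truncate (1 : R) = 1.
Proof. by rewrite truncate_id. Qed.

Lemma truncate_flip t : truncate (1 - t) = 1 - truncate t.
Proof.
rewrite /truncate; case/orP: (le_total t 0) => t0.
  by rewrite (max_l t0) (min_r ler01) subr0 max_r ?min_l //; lra.
rewrite (max_r t0); case/orP: (le_total t 1) => t1.
  by rewrite (min_r t1) max_r ?min_r //; lra.
by rewrite (min_l t1) subrr max_l ?min_r //; lra.
Qed.

Lemma itv_val_ge0 (t : unit_itv R) : 0 <= itv_val t.
Proof. by rewrite -[t]itv_valK clamp_val truncate_ge0. Qed.

Lemma itv_val_le1 (t : unit_itv R) : itv_val t <= 1.
Proof. by rewrite -[t]itv_valK clamp_val truncate_le1. Qed.

End Truncate.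

(** Compactness of an interval in the form of an induction principle: a relation
    between the ends of intervals that is additive and holds for all the small
    intervals holds for the whole interval.  It replaces subdivisions and Lebesgue
    numbers throughout. *)
Lemma itv_ind {R : realType} (P : R -> R -> Prop) (a b : R) : a <= b ->
  (forall u v w, u <= v -> v <= w -> P u v -> P v w -> P u w) ->
  (forall t, a <= t <= b -> exists2 e, 0 < e & forall u v,
     a <= u -> u <= v -> v <= b -> t - e < u -> v < t + e -> P u v) ->
  P a b.
Proof.
move=> ab Ptrans Ploc.
pose E : set R := [set t | a <= t <= b /\ P a t].
have Ea : E a.
  have [|e e0 Pe] := Ploc a; first by rewrite lexx.
  by split; [rewrite lexx|apply: Pe => //; lra].
have supE : has_sup E by split; [exists a|exists b => t [/andP[]]].
have aS : a <= sup E by apply: sup_upper_bound.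
have Sb : sup E <= b.
  by apply: ge_sup; [exists a|move=> t [/andP[]]].
have [|e e0 Pe] := Ploc (sup E); first by rewrite aS.
have [t [/andP[at_ tb] Pt] te] := sup_adherent e0 supE.
have tS : t <= sup E by apply: sup_upper_bound => //; split; rewrite ?at_.
have key v : sup E <= v -> v <= b -> v < sup E + e -> P a v.
  by move=> Sv vb ve; apply: Ptrans Pt (Pe _ _ _ _ _ _ _) => //; lra.
suff -> : b = sup E by apply: key => //; lra.
apply/eqP; rewrite eq_le Sb andbT leNgt; apply/negP => Sb'.
pose v := Num.min b (sup E + e / 2).
have Sv : sup E < v by rewrite /v lt_min Sb' /=; lra.
have vb : v <= b by rewrite /v ge_min lexx.
have ve : v < sup E + e by rewrite /v gt_min; apply/orP; right; lra.
have : v <= sup E.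
  apply: sup_upper_bound => //; split; last by apply: key => //; exact: ltW.
  by rewrite vb andbT (le_trans aS) // ltW.
by rewrite leNgt Sv.
Qed.

(** * Cocycles on paths *)

Section Subpaths.
Context {R : realType} {X : topologicalType}.
Implicit Types (p : R -> X).

Definition subpath p (a b t : R) : X := p (a + t * (b - a)).

Lemma subpath_continuous p a b : continuous p -> continuous (subpath p a b).
Proof. by move=> cp; rewrite /subpath; cts. Qed.

Lemma subpath0 p a b : subpath p a b 0 = p a.
Proof. by rewrite /subpath mul0r addr0. Qed.

Lemma subpath1 p a b : subpath p a b 1 = p b.
Proof. by rewrite /subpath mul1r addrC subrK. Qed.

Lemma subpath01 p : subpath p 0 1 = p.
Proof. by apply/funext => t; rewrite /subpath subr0 mulr1 add0r. Qed.

Lemma subpath_sub p a b u v :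
  subpath (subpath p a b) u v = subpath p (a + u * (b - a)) (a + v * (b - a)).
Proof.
by apply/funext => t; rewrite /subpath; congr p; ring.
Qed.

End Subpaths.

(** A cocycle is a functor from the fundamental groupoid of [X] to [H].  The
    second axiom has no condition on the order of [a], [b] and [c]; it thus also
    says that constant paths are sent to 1 and reversed paths to inverses. *)
Record cocycle {R : realType} {X : topologicalType} {H : groupType}
    (F : (R -> X) -> H) : Prop := Cocycle {
  cocycle_homotopy : forall h : R * R -> X, continuous h ->
    (forall s, h (s, 0) = h (0, 0)) -> (forall s, h (s, 1) = h (0, 1)) ->
    F (fun t => h (0, t)) = F (fun t => h (1, t));
  cocycle_cat : forall p, continuous p -> forall a b c : R,
    (F (subpath p a b) * F (subpath p b c))%g = F (subpath p a c) }.

Section CocycleTheory.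
Context {R : realType} {X : topologicalType} {H : groupType}.
Variable F : (R -> X) -> H.
Hypothesis Fc : cocycle F.
Implicit Types p q : R -> X.

Lemma cocycle_reparam p (phi psi : R -> R) : continuous p ->
  continuous phi -> continuous psi -> phi 0 = psi 0 -> phi 1 = psi 1 ->
  F (fun t => p (phi t)) = F (fun t => p (psi t)).
Proof.
move=> cp cphi cpsi e0 e1.
pose h (st : R * R) := p (phi st.2 + st.1 * (psi st.2 - phi st.2)).
have E0 : (fun t => p (phi t)) = (fun t => h (0, t)).
  by apply/funext => t; rewrite /h /= mul0r addr0.
have E1 : (fun t => p (psi t)) = (fun t => h (1, t)).
  by apply/funext => t; rewrite /h /= mul1r addrC subrK.
rewrite E0 E1; apply: (cocycle_homotopy Fc) => [|s|s]; first by rewrite /h; cts.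
- by rewrite /h /= e0 subrr !mulr0.
- by rewrite /h /= e1 subrr !mulr0.
Qed.

Lemma cocycle_truncate p : continuous p -> F (fun t => p (truncate t)) = F p.
Proof.
move=> cp; apply: (@cocycle_reparam _ _ (fun t => t)) => //.
  + exact: truncate_continuous.
  + exact: cts_id.
  + by rewrite truncate0.
  + by rewrite truncate1.
Qed.

Lemma cocycle_ext p q : continuous p -> continuous q ->
  (forall t, 0 <= t <= 1 -> p t = q t) -> F p = F q.
Proof.
move=> cp cq pq; rewrite -(cocycle_truncate cp) -(cocycle_truncate cq).
congr F; apply/funext => t; apply: pq.
by rewrite truncate_ge0 truncate_le1.
Qed.

Lemma cocycle_cst x : F (fun=> x) = 1%g.
Proof.
have := cocycle_cat Fc (@cts_cst R X x) 0 0 0.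
by rewrite -[X in _ = X]mulg1 => /mulgI; apply.
Qed.

Lemma cocycle_constant p x : (forall t, p t = x) -> F p = 1%g.
Proof. by move=> /funext ->; exact: cocycle_cst. Qed.

Lemma cocycle_back p : continuous p ->
  F (subpath p 1 0) = (F p)^-1%g.
Proof.
move=> cp; apply/eqP; rewrite -mulg_eq1 -{2}(subpath01 p) cocycle_cat //.
by apply/eqP/(@cocycle_constant _ (p 1)) => t; rewrite /subpath subrr mulr0 addr0.
Qed.

(** The two ways around a square are homotopic, both being homotopic to the
    diagonal. *)
Lemma cocycle_square (h : R * R -> X) : continuous h ->
  (F (fun t => h (0%R, t)) * F (fun s => h (s, 1%R)) =
   F (fun s => h (s, 0%R)) * F (fun t => h (1%R, t)))%g.
Proof.
move=> ch.
(* a path of the plane from a corner to the opposite one is homotopic to the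
   diagonal by a linear interpolation *)
have route (c : R -> R * R) : continuous c -> c 0 = (0, 0) -> c 1 = (1, 1) ->
    F (fun t => h (c t)) = F (fun t => h (t, t)).
  move=> cc c0 c1.
  pose k (st : R * R) := h ((1 - st.1) * (c st.2).1 + st.1 * st.2,
                            (1 - st.1) * (c st.2).2 + st.1 * st.2).
  have E0 : (fun t => h (c t)) = (fun t => k (0, t)).
    apply/funext => t; rewrite /k /= subr0 !mul1r !mul0r !addr0.
    by rewrite -surjective_pairing.
  have E1 : (fun t => h (t, t)) = (fun t => k (1, t)).
    by apply/funext => t; rewrite /k /= subrr !mul0r !mul1r !add0r.
  rewrite E0 E1; apply: (cocycle_homotopy Fc) => [|s|s].
  - by rewrite /k; cts; apply: continuous_compose cc _; cts.
  - by rewrite /k /= c0 /= !mulr0 !addr0.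
  - by rewrite /k /= c1 /= !mulr1 !subrK.
pose c1 (t : R) : R * R := (Num.max 0 (2 * t - 1), Num.min 1 (2 * t)).
pose c2 (t : R) : R * R := (Num.min 1 (2 * t), Num.max 0 (2 * t - 1)).
have cc1 : continuous c1 by rewrite /c1; cts.
have cc2 : continuous c2 by rewrite /c2; cts.
have halves (c : R -> R * R) : continuous c ->
    F (fun t => h (c t)) =
    (F (fun t => h (c (t / 2)%R)) * F (fun t => h (c (1 / 2 + t / 2)%R)))%g.
  move=> cc; have chc : continuous (fun t => h (c t)) by cts.
  have := cocycle_cat Fc chc 0 (1 / 2) 1; rewrite subpath01 => <-.
  congr (F _ * F _)%g; apply/funext => t; rewrite /subpath; congr (h (c _)); lra.
have -> : F (fun t => h (0, t)) = F (fun t => h (c1 (t / 2))).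
  apply: cocycle_ext; [cts|rewrite /c1; cts|move=> t /andP[t0 t1]].
  rewrite /c1 max_l; last lra.
  by rewrite min_r; [congr (h (_, _))|]; lra.
have -> : F (fun s => h (s, 1)) = F (fun t => h (c1 (1 / 2 + t / 2))).
  apply: cocycle_ext; [cts|rewrite /c1; cts|move=> t /andP[t0 t1]].
  rewrite /c1 max_r; last lra.
  by rewrite min_l; [congr (h (_, _))|]; lra.
have -> : F (fun s => h (s, 0)) = F (fun t => h (c2 (t / 2))).
  apply: cocycle_ext; [cts|rewrite /c2; cts|move=> t /andP[t0 t1]].
  rewrite /c2 max_l; last lra.
  by rewrite min_r; [congr (h (_, _))|]; lra.
have -> : F (fun t => h (1, t)) = F (fun t => h (c2 (1 / 2 + t / 2))).
  apply: cocycle_ext; [cts|rewrite /c2; cts|move=> t /andP[t0 t1]].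
  rewrite /c2 max_r; last lra.
  by rewrite min_l; [congr (h (_, _))|]; lra.
rewrite -!halves // !route //; rewrite /c1 /c2.
- by rewrite mulr0 sub0r max_l ?min_r //; lra.
- by rewrite mulr1 max_r ?min_l //; [congr (_, _)|..]; lra.
- by rewrite mulr0 sub0r max_l ?min_r //; lra.
- by rewrite mulr1 max_r ?min_l //; [congr (_, _)|..]; lra.
Qed.

End CocycleTheory.

Section CocycleOperations.
Context {R : realType} {X Y : topologicalType} {H K : groupType}.
Variable F : (R -> X) -> H.
Hypothesis Fc : cocycle F.

Lemma cocycle_pullback (g : Y -> X) : continuous g ->
  cocycle (fun p : R -> Y => F (fun t => g (p t))).
Proof.
move=> cg; split => [h ch h0 h1|p cp a b c].
  apply: (cocycle_homotopy Fc (h := fun z => g (h z))) => [|s|s]; first by cts.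
    by rewrite h0.
  by rewrite h1.
by apply: (cocycle_cat Fc (p := fun t => g (p t))); cts.
Qed.

Lemma cocycle_push (f : H -> K) : is_hom f -> cocycle (fun p => f (F p)).
Proof.
move=> fM; split => [h ch h0 h1|p cp a b c].
  by rewrite (cocycle_homotopy Fc).
by rewrite -fM (cocycle_cat Fc).
Qed.

(** The natural isomorphism of functors given by [l]; on the loops at a point it
    is a conjugation. *)
Definition gauge (l : X -> H) (p : R -> X) : H :=
  ((l (p 0%R))^-1 * F p * l (p 1%R))%g.

Lemma cocycle_gauge l : cocycle (gauge l).
Proof.
split => [h ch h0 h1|p cp a b c]; rewrite /gauge.
  by rewrite (h0 1) (h1 1) (cocycle_homotopy Fc).
by rewrite !subpath0 !subpath1 -!mulgA mulVKg (mulgA (F _)) (cocycle_cat Fc).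
Qed.

End CocycleOperations.

(** * Gluing cocycles along an open cover *)

Lemma open_embedding_lift {T U X : topologicalType} (e : U -> X) (h : T -> X) :
  open_embedding e -> continuous h -> (forall z, exists u, e u = h z) ->
  exists2 q : T -> U, continuous q & forall z, e (q z) = h z.
Proof.
move=> [ce ie oe] ch /choice[q qE]; exists q => //.
apply/continuousP => A oA.
have -> : q @^-1` A = h @^-1` (e @` A).
  apply/seteqP; split => z /=; first by move=> Aqz; exists (q z).
  by move=> [u Au]; rewrite -qE => /ie <-.
by apply: open_comp; [move=> z _; exact: ch|exact: oe].
Qed.

Lemma nbhs_real {R : realType} (t : R) (A : set R) : nbhs t A ->
  exists2 e, 0 < e & forall s, t - e < s -> s < t + e -> A s.
Proof.
move=> /nbhs_ballP[e /= e0 eA]; exists e => // s s1 s2; apply: eA.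
rewrite -ball_normE /= ltr_norml; lra.
Qed.

Lemma nbhs_real2 {R : realType} (s t : R) (A : set (R * R)) : nbhs (s, t) A ->
  exists2 e, 0 < e & forall u v, s - e < u -> u < s + e ->
    t - e < v -> v < t + e -> A (u, v).
Proof.
move=> /nbhs_ballP[e /= e0 eA]; exists e => // u v u1 u2 v1 v2; apply: eA.
by split; rewrite -ball_normE /= ltr_norml; lra.
Qed.

Lemma near_min {R : realType} (t d e u v : R) :
  t - Num.min d e < u -> v < t + Num.min d e ->
  [/\ t - d < u, v < t + d, t - e < u & v < t + e].
Proof.
have md : Num.min d e <= d by rewrite ge_min lexx.
have me : Num.min d e <= e by rewrite ge_min lexx orbT.
by move: (Num.min d e) md me => m *; split; lra.
Qed.

Section PathInduction.
Context {R : realType} {X : topologicalType} {J : Type}.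
Variable O : J -> set X.
Hypothesis oO : forall j, open (O j).
Hypothesis covO : forall x, exists j, O j x.

Lemma path_ind (p : R -> X) (P : R -> R -> Prop) (a b : R) :
  continuous p -> a <= b ->
  (forall u v w, u <= v -> v <= w -> P u v -> P v w -> P u w) ->
  (forall j u v, a <= u -> u <= v -> v <= b ->
     (forall s, u <= s -> s <= v -> O j (p s)) -> P u v) ->
  P a b.
Proof.
move=> cp ab Padd Psmall; apply: itv_ind => // t _.
have [j jt] := covO (p t).
have /nbhs_real[e e0 eO] : nbhs t (p @^-1` O j).
  by apply: cp; apply: open_nbhs_nbhs.
exists e => // u v u0 uv v1 ue ve; apply: (Psmall j) => // s us sv.
by apply: eO; lra.
Qed.

(** Interval induction in each direction: a vertical strip around each abscissa
    is thin enough for the first induction, along the ordinate, to go through,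
    and the second one puts the strips together. *)
Lemma square_ind (h : R * R -> X) (P : R -> R -> R -> R -> Prop) :
  continuous h ->
  (forall u v w c d, u <= v -> v <= w -> P u v c d -> P v w c d -> P u w c d) ->
  (forall u v c d e, c <= d -> d <= e -> P u v c d -> P u v d e -> P u v c e) ->
  (forall j u v c d, u <= v -> c <= d ->
     (forall s t, u <= s -> s <= v -> c <= t -> t <= d -> O j (h (s, t))) ->
     P u v c d) ->
  P 0 1 0 1.
Proof.
move=> ch Padd1 Padd2 Psmall.
apply: (@itv_ind _ (fun u v => P u v 0 1)) => // [u v w|s _]; first exact: Padd1.
suff [e e0 He] : exists2 e, 0 < e & forall u v, u <= v -> s - e < u ->
    v < s + e -> P u v 0 1.
  by exists e => // u v *; exact: He.
apply: (@itv_ind _ (fun c d => exists2 e, 0 < e & forall u v, u <= v ->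
    s - e < u -> v < s + e -> P u v c d)) => // [c d f cd df|t _].
  move=> [e e0 He] [e' e'0 He']; exists (Num.min e e').
    by rewrite lt_min e0.
  move=> u v uv tu tv; have [? ? ? ?] := near_min tu tv.
  by apply: (Padd2 _ _ _ _ _ cd df); [apply: He|apply: He'] => //; lra.
have [j jt] := covO (h (s, t)).
have /nbhs_real2[e e0 eO] : nbhs (s, t) (h @^-1` O j).
  by apply: ch; apply: open_nbhs_nbhs.
exists e => // c d c0 cd d1 ce de; exists e => // u v uv ue ve.
by apply: (Psmall j) => // s' t' *; apply: eO; lra.
Qed.

End PathInduction.

(** Cocycles [F j] on the members of an open cover, which agree on the overlaps,
    extend to the whole space.  The value of the extension on [p] is found by
    lifting [p] to [H]: a primitive of [p] is a function [L] such that
    [(L u)^-1 * L v] is the value given by some [F j] on the piece of [p] between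
    [u] and [v], whenever [u] and [v] are close to each other. *)
Section Glue.
Context {R : realType} {X : topologicalType} {H : groupType} {J : Type}.
Variables (U : J -> topologicalType) (e : forall j, U j -> X).
Variable F : forall j, (R -> U j) -> H.
Hypothesis e_emb : forall j, open_embedding (@e j).
Hypothesis e_cover : forall x, exists j u, @e j u = x.
Hypothesis Fc : forall j, cocycle (@F j).
Hypothesis F_compat : forall i j (p : R -> U i) (q : R -> U j),
  continuous p -> continuous q -> (forall t, e (p t) = e (q t)) -> F p = F q.

Let O j : set X := range (@e j).
Let oO j : open (O j).
Proof. by have [_ _ oe] := e_emb j; apply: oe; exact: openT. Qed.
Let covO x : exists j, O j x.
Proof. by have [j [u ux]] := e_cover x; exists j, u. Qed.
Let ce j : continuous (@e j). Proof. by have [] := e_emb j. Qed.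

Definition local_value (p : R -> X) (u v : R) (g : H) :=
  exists j (q : R -> U j), [/\ continuous q,
    forall t, e (q t) = subpath p u v (truncate t) & g = F q].

Lemma local_value_uniq p u v g g' :
  local_value p u v g -> local_value p u v g' -> g = g'.
Proof.
move=> [i [q [cq qE ->]]] [j [q' [cq' qE' ->]]].
by apply: F_compat => // t; rewrite qE qE'.
Qed.

Lemma local_value_sym p u v g :
  local_value p u v g -> local_value p v u g^-1%g.
Proof.
move=> [j [q [cq qE ->]]]; exists j, (subpath q 1 0); split.
- exact: subpath_continuous.
- move=> t; rewrite {1}/subpath qE /subpath; congr p.
  have -> : truncate (1 + t * (0 - 1)) = 1 - truncate t.
    by rewrite sub0r mulrN1 truncate_flip.
  by ring.
- by rewrite cocycle_back.
Qed.

Lemma local_value_small p j a b : continuous p -> a <= b ->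
  (forall s, a <= s -> s <= b -> O j (p s)) ->
  exists2 q : R -> U j, continuous q &
    forall u v, a <= u <= b -> a <= v <= b ->
      local_value p u v (F (subpath q u v)).
Proof.
move=> cp ab pO.
pose clip s := Num.min b (Num.max a s).
have cclip : continuous clip by rewrite /clip; cts.
have [q cq qE] : exists2 q : R -> U j, continuous q &
    forall s, e (q s) = p (clip s).
  apply: open_embedding_lift => // [|s]; first by cts.
  have [||u _ <-] := pO (clip s); last by exists u.
    by rewrite /clip le_min ab le_max lexx.
  by rewrite /clip ge_min lexx.
exists q => // u v /andP[au ub] /andP[av vb].
exists j, (fun t => subpath q u v (truncate t)); split.
- apply: (continuous_compose (@subpath_continuous _ _ q u v cq)).
  exact: truncate_continuous.
- move=> t; rewrite {1}/subpath qE; congr p; rewrite /clip.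
  have := truncate_ge0 t; have := truncate_le1 t; move: (truncate t) => r r1 r0.
  by rewrite max_r ?min_r //; nra.
- by rewrite (cocycle_truncate (Fc j)) //; exact: subpath_continuous.
Qed.

Definition primitive (p : R -> X) (L : R -> H) (a b : R) :=
  forall t, a <= t <= b -> exists2 d, 0 < d & forall u v,
    a <= u <= b -> a <= v <= b -> t - d < u < t + d -> t - d < v < t + d ->
    local_value p u v ((L u)^-1 * L v)%g.

Lemma primitive_le p L a b :
  (forall t, a <= t <= b -> exists2 d, 0 < d & forall u v,
    u <= v -> a <= u -> v <= b -> t - d < u -> v < t + d ->
    local_value p u v ((L u)^-1 * L v)%g) -> primitive p L a b.
Proof.
move=> Lp t /Lp[d d0 dL]; exists d => // u v /andP[? ?] /andP[? ?].
move=> /andP[? ?] /andP[? ?]; have [uv|vu] := leP u v; first exact: dL.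
have := local_value_sym (dL v u (ltW vu) _ _ _ _).
by rewrite invgM invgK; apply.
Qed.

Lemma primitive_join p L1 L2 a b c : continuous p -> a <= c -> c <= b ->
  primitive p L1 a c -> primitive p L2 c b -> exists L, primitive p L a b.
Proof.
move=> cp ac cb P1 P2.
pose L s := if s <= c then L1 s else (L1 c * (L2 c)^-1 * L2 s)%g.
have LE1 s : s <= c -> L s = L1 s by rewrite /L => ->.
have LE2 s : c <= s -> L s = (L1 c * (L2 c)^-1 * L2 s)%g.
  rewrite /L => cs; case: ifPn => // sc.
  have -> : s = c by apply/eqP; rewrite eq_le sc.
  by rewrite mulgVK.
have LM2 u v : c <= u -> c <= v -> ((L u)^-1 * L v = (L2 u)^-1 * L2 v)%g.
  by move=> cu cv; rewrite !LE2 // invgM -mulgA mulKg.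
exists L; apply: primitive_le => t /andP[at_ tb].
have [tc|ct|tc] := ltgtP t c.
- have [|d d0 dL] := P1 t; first by rewrite at_ ltW.
  exists (Num.min d (c - t)); first by rewrite lt_min d0; lra.
  move=> u v uv au vb tu tv; have [? ? ? ?] := near_min tu tv.
  rewrite !LE1; try lra.
  by apply: dL; lra.
- have [|d d0 dL] := P2 t; first by rewrite tb ltW.
  exists (Num.min d (t - c)); first by rewrite lt_min d0; lra.
  move=> u v uv au vb tu tv; have [? ? ? ?] := near_min tu tv; rewrite LM2; try lra.
  by apply: dL; lra.
- subst t; have [|d1 d10 dL1] := P1 c; first by rewrite ac lexx.
  have [|d2 d20 dL2] := P2 c; first by rewrite cb lexx.
  have [j jc] := covO (p c).
  have /nbhs_real[d3 d30 dO] : nbhs c (p @^-1` O j).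
    by apply: cp; apply: open_nbhs_nbhs.
  exists (Num.min d1 (Num.min d2 d3)); first by rewrite !lt_min d10 d20.
  move=> u v uv au vb tu tv; have [? ? tu' tv'] := near_min tu tv.
  have [? ? ? ?] := near_min tu' tv'.
  have [vc|cv] := leP v c; first by rewrite !LE1; [apply: dL1|..]; lra.
  have [uc|cu] := leP u c; last by rewrite LM2; [apply: dL2|..]; lra.
  have [q cq qE] : exists2 q : R -> U j, continuous q &
      forall s t, u <= s <= v -> u <= t <= v ->
      local_value p s t (F (subpath q s t)).
    by apply: local_value_small => // s us sv; apply: dO; lra.
  have -> : ((L u)^-1 * L v)%g = F (subpath q u v).
    rewrite -(cocycle_cat (Fc j) cq u c v) LE1 // LE2 ?(ltW cv) // !mulgA.
    rewrite -(mulgA _ (L2 c)^-1)%g; congr (_ * _)%g.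
      apply: (@local_value_uniq p u c); last by apply: qE; lra.
      by apply: dL1; lra.
    apply: (@local_value_uniq p c v); last by apply: qE; lra.
    by apply: dL2; lra.
  by apply: qE; lra.
Qed.

Lemma primitive_exists p : continuous p -> exists L, primitive p L 0 1.
Proof.
move=> cp; apply: (path_ind oO covO (P := fun a b => exists L, primitive p L a b)
  cp) => // [u v w uv vw [L1 P1] [L2 P2]|j u v _ uv _ pO].
  exact: primitive_join P1 P2.
have [q cq qE] := local_value_small cp uv pO.
exists (fun s => F (subpath q u s)) => t _; exists 1 => // s s' us us' _ _.
rewrite -(cocycle_cat (Fc j) cq u s s') mulKg; exact: qE.
Qed.

Lemma primitive_uniq p L L' : continuous p ->
  primitive p L 0 1 -> primitive p L' 0 1 ->
  ((L 0%R)^-1 * L 1%R = (L' 0%R)^-1 * L' 1%R)%g.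
Proof.
move=> cp PL PL'.
apply: (@itv_ind _ (fun u v => ((L u)^-1 * L v = (L' u)^-1 * L' v)%g)) => //.
  move=> u v w _ _ uv vw.
  have E (N : R -> H) :
      ((N u)^-1 * N w = ((N u)^-1 * N v) * ((N v)^-1 * N w))%g.
    by rewrite mulgA mulgK.
  by rewrite (E L) (E L') uv vw.
move=> t t01; have [d d0 dL] := PL t t01; have [d' d'0 dL'] := PL' t t01.
exists (Num.min d d'); first by rewrite lt_min d0.
move=> u v u0 uv v1 tu tv; have [? ? ? ?] := near_min tu tv.
by apply: (@local_value_uniq p u v); [apply: dL|apply: dL']; lra.
Qed.

Definition glue (p : R -> X) : H :=
  xget 1%g [set g | exists2 L, primitive p L 0 1 & g = ((L 0%R)^-1 * L 1%R)%g].

Lemma glueE p L : continuous p -> primitive p L 0 1 ->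
  glue p = ((L 0%R)^-1 * L 1%R)%g.
Proof.
move=> cp PL; rewrite /glue; case: xgetP => [g _ [L' PL' ->]|no].
  exact: primitive_uniq.
by case: (no ((L 0%R)^-1 * L 1%R)%g); exists L.
Qed.

Lemma primitive_subpath p L a b : 0 <= a <= 1 -> 0 <= b <= 1 ->
  primitive p L 0 1 ->
  primitive (subpath p a b) (fun t => L (a + t * (b - a))) 0 1.
Proof.
move=> /andP[a0 a1] /andP[b0 b1] PL.
have in01 u : 0 <= u <= 1 -> 0 <= a + u * (b - a) <= 1.
  by move=> /andP[u0 u1]; apply/andP; split; nra.
move=> t /in01/PL[d d0 dL]; exists d => // u v u01 v01 ud vd.
have near w : 0 <= w <= 1 -> t - d < w < t + d ->
    a + t * (b - a) - d < a + w * (b - a) < a + t * (b - a) + d.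
  move=> _ /andP[w1 w2].
  have : `|(w - t) * (b - a)| < d.
    rewrite normrM; apply: (@le_lt_trans _ _ (`|w - t| * 1)).
      by apply: ler_wpM2l => //; rewrite ler_norml; lra.
    by rewrite mulr1 ltr_norml; lra.
  rewrite ltr_norml => /andP[h1 h2]; apply/andP; split; lra.
(* [subpath p a b] goes slower than [p], so that the same [d] is suitable *)
have [j [q [cq qE gE]]] := dL _ _ (in01 _ u01) (in01 _ v01)
  (near _ u01 ud) (near _ v01 vd).
by exists j, q; split => // s; rewrite subpath_sub.
Qed.

Lemma primitive_ext p p' L : (forall t, 0 <= t <= 1 -> p t = p' t) ->
  primitive p L 0 1 -> primitive p' L 0 1.
Proof.
move=> pp' PL t t01; have [d d0 dL] := PL t t01; exists d => // u v u01 v01 ud vd.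
have [j [q [cq qE gE]]] := dL u v u01 v01 ud vd.
exists j, q; split => // s; rewrite qE /subpath; apply: pp'.
have := truncate_ge0 s; have := truncate_le1 s; move: (truncate s) => r r1 r0.
by move: u01 v01 => /andP[? ?] /andP[? ?]; apply/andP; split; nra.
Qed.

Lemma glue_ext (p p' : R -> X) : continuous p -> continuous p' ->
  (forall t, 0 <= t <= 1 -> p t = p' t) -> glue p = glue p'.
Proof.
move=> cp cp' pp'; have [L PL] := primitive_exists cp.
by rewrite (glueE cp PL) (glueE cp' (primitive_ext pp' PL)).
Qed.

Lemma glue_emb j (p : R -> U j) : continuous p -> glue (fun t => e (p t)) = F p.
Proof.
move=> cp; have cep : continuous (fun t => e (p t)).
  exact: continuous_compose (@ce j) cp.
rewrite (@glueE _ (fun s => F (subpath p 0 s))) //.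
  by rewrite -(cocycle_cat (Fc j) cp 0 0 1) mulKg subpath01.
move=> t _; exists 1 => // u v u01 v01 _ _.
rewrite -(cocycle_cat (Fc j) cp 0 u v) mulKg.
exists j, (fun t => subpath p u v (truncate t)); split => //.
  apply: (continuous_compose (@subpath_continuous _ _ p u v cp)).
  exact: truncate_continuous.
by rewrite (cocycle_truncate (Fc j)) //; exact: subpath_continuous.
Qed.

(** A primitive of [p] on the unit interval yields primitives of its subpaths.
    To reach all real [a], [b] and [c], the path is first restricted to an
    interval that contains them; the margin of 1 on each side is there to make
    this interval nondegenerate. *)
Lemma glue_cat (p : R -> X) a b c : continuous p ->
  (glue (subpath p a b) * glue (subpath p b c) = glue (subpath p a c))%g.
Proof.
move=> cp.
have cat01 q u v w : continuous q -> 0 <= u <= 1 -> 0 <= v <= 1 ->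
    0 <= w <= 1 ->
    (glue (subpath q u v) * glue (subpath q v w) = glue (subpath q u w))%g.
  move=> cq u01 v01 w01; have [L PL] := primitive_exists cq.
  rewrite !(glueE (subpath_continuous cq) (primitive_subpath _ _ PL)) //.
  by rewrite !mul0r !mul1r !addr0 !(addrC _ (_ - _)) !subrK mulgA mulgK.
pose m := Num.min a (Num.min b c) - 1; pose M := Num.max a (Num.max b c) + 1.
have [ma mb mc] : [/\ m < a, m < b & m < c].
  rewrite /m; have := lexx (Num.min a (Num.min b c)).
  by rewrite {2 3}/Num.min !le_min => /and3P[]; split; lra.
have [aM bM cM] : [/\ a < M, b < M & c < M].
  rewrite /M; have := lexx (Num.max a (Num.max b c)).
  by rewrite {1 2}/Num.max !ge_max => /and3P[]; split; lra.
have mM : m < M by lra.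
pose r s := (s - m) / (M - m).
have rE s : m + r s * (M - m) = s.
  by rewrite /r divfK ?subr_eq0 ?gt_eqF // addrC subrK.
have r01 s : m < s -> s < M -> 0 <= r s <= 1.
  move=> ms sM; rewrite /r divr_ge0 ?subr_ge0 ?(ltW ms) ?(ltW mM) //=.
  by rewrite ler_pdivrMr ?subr_gt0 // mul1r lerB // ltW.
have := cat01 (subpath p m M) (r a) (r b) (r c) (subpath_continuous cp)
  (r01 a ma aM) (r01 b mb bM) (r01 c mc cM).
by rewrite !subpath_sub !rE.
Qed.

(** Homotopy invariance, in the form of [cocycle_square]: this relation is
    additive on rectangles, and for a small rectangle it is known for [F j]. *)
Lemma glue_square (h : R * R -> X) : continuous h ->
  (glue (fun t => h (0%R, t)) * glue (fun s => h (s, 1%R)) =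
   glue (fun s => h (s, 0%R)) * glue (fun t => h (1%R, t)))%g.
Proof.
move=> ch.
pose vert s t t' := glue (subpath (fun r => h (s, r)) t t').
pose horz t s s' := glue (subpath (fun r => h (r, t)) s s').
have chv s : continuous (fun r => h (s, r)) by cts.
have chh t : continuous (fun r => h (r, t)) by cts.
have vcat s a b c : (vert s a b * vert s b c = vert s a c)%g by apply: glue_cat.
have hcat t a b c : (horz t a b * horz t b c = horz t a c)%g by apply: glue_cat.
suff : (vert 0%R 0%R 1%R * horz 1%R 0%R 1%R =
         horz 0%R 0%R 1%R * vert 1%R 0%R 1%R)%g.
  by rewrite /vert /horz !subpath01.
apply: (square_ind oO covO (P := fun s s' t t' =>
  (vert s t t' * horz t' s s' = horz t s s' * vert s' t t')%g) ch).
- move=> u v w c d _ _ E1 E2.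
  by rewrite -(hcat d u v w) -(hcat c u v w) mulgA E1 -mulgA E2 mulgA.
- move=> u v c d f _ _ E1 E2.
  by rewrite -(vcat u c d f) -(vcat v c d f) -mulgA E2 mulgA E1 mulgA.
move=> j u v c d uv cd hO.
pose clip a b (s : R) := Num.min b (Num.max a s).
have cclip a b : continuous (clip a b) by rewrite /clip; cts.
have clipE a b s : a <= s -> s <= b -> clip a b s = s.
  by move=> as_ sb; rewrite /clip max_r // min_r.
have clip_ge a b s : a <= b -> a <= clip a b s.
  by move=> ab; rewrite /clip le_min ab le_max lexx.
have clip_le a b s : clip a b s <= b by rewrite /clip ge_min lexx.
have [q cq qE] : exists2 q : R * R -> U j, continuous q &
    forall z, e (q z) = h (clip u v z.1, clip c d z.2).
  apply: open_embedding_lift => // [|z].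
    by have cuv := cclip u v; have ccd := cclip c d; cts.
  have [] := hO (clip u v z.1) (clip c d z.2); rewrite ?clip_ge ?clip_le //.
  by move=> w _ <-; exists w.
have vE s : u <= s <= v -> vert s c d = F (subpath (fun r => q (s, r)) c d).
  move=> /andP[us sv]; rewrite -glue_emb; last first.
    by apply: subpath_continuous; cts.
  apply: glue_ext => [||t /andP[t0 t1]].
  - exact: subpath_continuous.
  - apply: (continuous_compose (@ce j)); apply: subpath_continuous; cts.
  - rewrite /subpath qE /= clipE // clipE //; nra.
have hE t : c <= t <= d -> horz t u v = F (subpath (fun r => q (r, t)) u v).
  move=> /andP[ct td]; rewrite -glue_emb; last first.
    by apply: subpath_continuous; cts.
  apply: glue_ext => [||s /andP[s0 s1]].
  - exact: subpath_continuous.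
  - apply: (continuous_compose (@ce j)); apply: subpath_continuous; cts.
  - rewrite /subpath qE /= clipE ?clipE //; nra.
rewrite !vE ?lexx ?uv // !hE ?lexx ?cd //.
have cz : continuous (fun z : R * R => q (u + z.1 * (v - u), c + z.2 * (d - c))).
  by cts.
have := cocycle_square (Fc j) cz; rewrite /= !mul0r !mul1r !addr0.
by rewrite !(addrC _ (_ - _)) !subrK.
Qed.

Theorem glue_cocycle : cocycle glue.
Proof.
split => [h ch h0 h1|p cp a b c]; last exact: glue_cat.
have E := glue_square ch.
have K q : continuous q -> (forall s, q s = q 0) -> glue q = 1%g.
  move=> cq qE; have := glue_cat 0 0 0 cq.
  have -> : subpath q 0 0 = q by apply/funext => s; rewrite /subpath !qE.
  by rewrite -[X in _ = X]mulg1 => /mulgI.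
rewrite (K (fun s => h (s, 0))) in E; [|by cts|by []].
by move: E; rewrite (K (fun s => h (s, 1))) ?mulg1 ?mul1g //; cts.
Qed.

End Glue.

Lemma glue_exists {R : realType} {X : topologicalType} {H : groupType}
    {J : Type} (U : J -> topologicalType) (e : forall j, U j -> X)
    (F : forall j, (R -> U j) -> H) :
  (forall j, open_embedding (@e j)) ->
  (forall x, exists j u, @e j u = x) ->
  (forall j, cocycle (@F j)) ->
  (forall i j (p : R -> U i) (q : R -> U j), continuous p -> continuous q ->
    (forall t, e i (p t) = e j (q t)) -> F i p = F j q) ->
  exists2 C : (R -> X) -> H, cocycle C &
    forall j (p : R -> U j), continuous p -> C (fun t => e j (p t)) = F j p.
Proof.
move=> e_emb e_cov Fc Fcompat; exists (glue e F); first exact: glue_cocycle.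
by move=> j p cp; exact: glue_emb.
Qed.

(** * Cocycles and the fundamental group *)

Section Joined.
Context {R : realType} {X : topologicalType}.

Definition joined (S : set X) (u v : X) := exists p : R -> X,
  [/\ continuous p, forall t, S (p t), p 0 = u & p 1 = v].

Lemma joined_sym S u v : joined S u v -> joined S v u.
Proof.
move=> [p [cp Sp p0 p1]]; exists (fun t => p (1 - t)); split => //; first by cts.
  by rewrite subr0.
by rewrite subrr.
Qed.

Lemma joined_trans S u v w : joined S u v -> joined S v w -> joined S u w.
Proof.
move=> [p [cp Sp p0 p1]] [q [cq Sq q0 q1]].
exists (fun t => if t <= 1 / 2 then p (2 * t) else q (2 * t - 1)); split.
- apply: continuous_paste => [|||t ->]; [by cts|by cts|by cts|].
  have -> : (2 : R) * (1 / 2) = 1 by lra.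
  by rewrite subrr p1.
- by move=> t; case: ifP.
- by rewrite ifT ?mulr0 //; lra.
- by rewrite ifF; [rewrite -[RHS]q1; congr q|]; lra.
Qed.

Lemma joined_sub S S' u v : S `<=` S' -> joined S u v -> joined S' u v.
Proof. by move=> SS' [p [? Sp ? ?]]; exists p; split => // t; exact: SS'. Qed.

Definition path_connected (S : set X) := forall u v, S u -> S v -> joined S u v.

(** For a path-connected set [S], this is a form of simple connectedness. *)
Definition coboundary_on (S : set X) := forall (H : groupType)
  (F : (R -> X) -> H), cocycle F -> exists l : X -> H, forall p,
    continuous p -> (forall t, S (p t)) -> F p = ((l (p 0%R))^-1 * l (p 1%R))%g.

Definition trivial_on (H : groupType) (S : set X) (F : (R -> X) -> H) :=
  forall p, continuous p -> (forall t, S (p t)) -> F p = 1%g.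

End Joined.

Lemma joined_map {R : realType} {X Y : topologicalType} (f : X -> Y)
    (S : set X) (u v : X) : continuous f ->
  @joined R X S u v -> @joined R Y (f @` S) (f u) (f v).
Proof.
move=> cf [p [cp Sp <- <-]]; exists (fun t => f (p t)); split => //; first by cts.
by move=> t; exists (p t).
Qed.

Lemma coboundary_on_emb {R : realType} {V X : topologicalType} (e : V -> X)
    (S : set V) :
  open_embedding e -> @coboundary_on R V S -> @coboundary_on R X (e @` S).
Proof.
move=> ee cobS H F Fc; have [ce ie _] := ee.
have [l lE] := cobS _ _ (cocycle_pullback Fc ce).
pose L x := xget 1%g [set g | exists2 v, e v = x & g = l v].
have LE v : L (e v) = l v.
  rewrite /L; case: xgetP => [g _ [w /ie -> ->] //|no].
  by case: (no (l v)); exists v.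
exists L => p cp Sp.
have [|q cq qE] := open_embedding_lift ee cp.
  by move=> t; have [v _ vE] := Sp t; exists v.
have -> : p = (fun t => e (q t)) by apply/funext.
rewrite lE // => [|t]; first by rewrite !LE.
by have [v Sv] := Sp t; rewrite -qE => /ie <-.
Qed.

Section PathObjects.
Context {R : realType} {X : topologicalType}.
Local Notation I := (unit_itv R).

(** [line_of] and [path_of] translate between the bundled paths defined on the
    unit interval and the continuous functions on the real line. *)
Definition line_of {u v : X} (q : {path I from u to v}) (t : R) : X := q (clamp t).

Lemma line_of_continuous u v (q : {path I from u to v}) : continuous (line_of q).
Proof. exact: path_clamp_continuous. Qed.

Lemma line_of0 u v (q : {path I from u to v}) : line_of q 0 = u.
Proof. by rewrite /line_of clamp0 path_zero. Qed.

Lemma line_of1 u v (q : {path I from u to v}) : line_of q 1 = v.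
Proof. by rewrite /line_of clamp1 path_one. Qed.

Lemma clampK (t : R) : 0 <= t <= 1 -> itv_val (clamp t) = t.
Proof. by move=> /andP[t0 t1]; rewrite clamp_val (max_r t0) (min_r t1). Qed.

Section Restrict.
Variables (p : R -> X) (cp : continuous p) (u v : X).
Hypotheses (p0 : p 0 = u) (p1 : p 1 = v).

Lemma restrict_continuous : continuous (fun t : I => p (itv_val t)).
Proof. by cts. Qed.

Lemma restrict0 : p (itv_val (zero : I)) = u. Proof. by rewrite itv_val0. Qed.
Lemma restrict1 : p (itv_val (one : I)) = v. Proof. by rewrite itv_val1. Qed.

Definition path_of : {path I from u to v} :=
  mk_path restrict_continuous restrict0 restrict1.

End Restrict.

Lemma path_cat_subpath (p : R -> X) (a b c : R) u v w (cp : continuous p)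
    (q : {path I from u to v}) (q' : {path I from v to w})
    (q'' : {path I from u to w}) :
  (forall t, q t = subpath p a b (itv_val t)) ->
  (forall t, q' t = subpath p b c (itv_val t)) ->
  (forall t, q'' t = subpath p a c (itv_val t)) ->
  path_homotopic (path_cat q q') q''.
Proof.
move=> qE q'E q''E.
have q''0 : u = p a by rewrite -(path_zero (s := q'')) q''E itv_val0 subpath0.
have q''1 : w = p c by rewrite -(path_one (s := q'')) q''E itv_val1 subpath1.
pose phi t := a + Num.min 1 (2 * t) * (b - a) + Num.max 0 (2 * t - 1) * (c - b).
apply: (@path_homotopicI _ _ _ _ _ _ (fun st : R * R =>
  p ((1 - st.1) * phi st.2 + st.1 * (a + st.2 * (c - a))))).
- by rewrite /phi; cts.
- move=> t; have t0 := itv_val_ge0 t; have t1 := itv_val_le1 t.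
  rewrite path_catE; case: ifPn => th; rewrite ?qE ?q'E /subpath clamp_val.
    rewrite max_r; last lra.
    rewrite min_r; last lra.
    rewrite /phi /= min_r; last lra.
    by rewrite max_l; [congr p; ring|lra].
  rewrite max_r; last lra.
  rewrite min_r; last lra.
  rewrite /phi /= min_l; last lra.
  by rewrite max_r; [congr p; ring|lra].
- by move=> t; rewrite q''E /subpath /=; congr p; ring.
- move=> s; rewrite q''0 /phi /= min_r; last lra.
  by rewrite max_l; [congr p; ring|lra].
- move=> s; rewrite q''1 /phi /= min_l; last lra.
  by rewrite max_r; [congr p; ring|lra].
Qed.

Section CocycleOnPaths.
Context {H : groupType} (C : (R -> X) -> H).
Hypothesis Cc : cocycle C.

Lemma cocycle_line_cat u v w (q : {path I from u to v})
    (q' : {path I from v to w}) :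
  C (line_of (path_cat q q')) = (C (line_of q) * C (line_of q'))%g.
Proof.
have cqq := @line_of_continuous _ _ (path_cat q q').
rewrite -[in LHS](subpath01 (line_of _)) -(cocycle_cat Cc cqq 0 (1 / 2) 1).
congr (_ * _)%g; apply: (cocycle_ext Cc);
  do 1 ?[exact: subpath_continuous|exact: line_of_continuous];
  move=> t /andP[t0 t1]; rewrite /subpath /line_of path_catE.
  rewrite clampK; last lra.
  by rewrite ifT; [congr (q (clamp _))|]; lra.
rewrite clampK; last lra.
case: ifPn => th; last by congr (q' (clamp _)); lra.
have -> : t = 0 by lra.
by rewrite clamp0 path_zero clamp_ge1 ?path_one //; lra.
Qed.

Lemma cocycle_line_rev u v (q : {path I from u to v}) :
  C (line_of (path_rev q)) = (C (line_of q))^-1%g.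
Proof.
have cq := @line_of_continuous _ _ q.
rewrite -(cocycle_back Cc cq).
apply: (cocycle_ext Cc);
  do 1 ?[exact: subpath_continuous|exact: line_of_continuous].
move=> t /andP[t0 t1]; rewrite /subpath /line_of path_revE.
by rewrite clampK ?t0 //; congr (q (clamp _)); lra.
Qed.

Lemma cocycle_line_homotopic u v (q q' : {path I from u to v}) :
  path_homotopic q q' -> C (line_of q) = C (line_of q').
Proof.
move=> /path_homotopicE[h [ch hq hq' hu hv]].
have -> : line_of q = (fun t => h (0, t)) by apply/funext => t; rewrite hq.
have -> : line_of q' = (fun t => h (1, t)) by apply/funext => t; rewrite hq'.
by apply: (cocycle_homotopy Cc) => // s; [rewrite !hu|rewrite !hv].
Qed.

(** The morphism of groups that a cocycle induces on the loops at [x]. *)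
Definition monodromy (x : X) (c : fundamental_group R x) : H :=
  C (line_of (repr c)).

Lemma monodromyE x (l : {path I from x to x}) :
  monodromy (homotopy_class l) = C (line_of l).
Proof.
by apply: cocycle_line_homotopic; apply/homotopy_classP/homotopy_class_surj.
Qed.

Lemma monodromy_hom x : is_hom (@monodromy x).
Proof.
move=> a b; rewrite -[a]homotopy_class_surj -[b]homotopy_class_surj.
rewrite -[(_ * _)%g]/(pi1_mul _ _) pi1_mulE !monodromyE.
exact: cocycle_line_cat.
Qed.

End CocycleOnPaths.
End PathObjects.

(** The universal cocycle: closing up paths by means of chosen paths [gamma z]
    from the base point to each point [z] gives a cocycle with values in the
    fundamental group itself. *)
Section Tautological.
Context {R : realType} {X : topologicalType}.
Local Notation I := (unit_itv R).
Variables (x : X) (gamma : forall z : X, {path I from x to z}).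

Definition close_up u v (q : {path I from u to v}) : fundamental_group R x :=
  homotopy_class (path_cat (path_cat (gamma u) q) (path_rev (gamma v))).

Lemma close_up_homotopic u v (q q' : {path I from u to v}) :
  path_homotopic q q' -> close_up q = close_up q'.
Proof.
move=> qq'; apply/homotopy_classP.
have hr := @path_homotopic_refl R X.
by do 2 (apply: path_cat_homotopic => //).
Qed.

Lemma close_up_cat u v w (q : {path I from u to v}) (q' : {path I from v to w}) :
  close_up (path_cat q q') = (close_up q * close_up q')%g.
Proof.
rewrite -[(_ * _)%g]/(pi1_mul _ _) pi1_mulE; apply/homotopy_classP.
have hr := @path_homotopic_refl R X.
have ht := @path_homotopic_trans R X.
have hs := @path_homotopic_sym R X.
have hA := @path_catA R X.
apply: (ht _ _ _ (path_cat (path_cat (path_cat (gamma u) q) q') _)).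
  by apply: path_cat_homotopic; [exact: hA|exact: hr].
apply: (ht _ _ _ (path_cat (path_cat (gamma u) q)
                    (path_cat q' (path_rev (gamma w))))).
  exact/hs/hA.
apply: (ht _ _ _ (path_cat (path_cat (gamma u) q)
  (path_cat (path_rev (gamma v))
     (path_cat (path_cat (gamma v) q') (path_rev (gamma w)))))); last exact: hA.
apply: path_cat_homotopic; first exact: hr.
apply: path_homotopic_sym; apply: (ht _ _ _ _ _ (hA _ _ _ _ _ _ _)).
apply: path_cat_homotopic; last exact: hr.
apply: (ht _ _ _ _ _ (hA _ _ _ _ _ _ _)).
apply: (ht _ _ _ (path_cat (path_cst R v) q')); last exact: path_cst_cat.
by apply: path_cat_homotopic; [exact: path_rev_cat|exact: hr].
Qed.

(** The existential form avoids transporting bundled paths along equalities of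
    their end points. *)
Definition tautological (p : R -> X) : fundamental_group R x :=
  xget 1%g [set c | exists u v (q : {path I from u to v}),
    (forall t, q t = p (itv_val t)) /\ c = close_up q].

Lemma tautologicalE p u v (q : {path I from u to v}) :
  (forall t, q t = p (itv_val t)) -> tautological p = close_up q.
Proof.
move=> qE; rewrite /tautological; case: xgetP => [c _|no]; last first.
  by case: (no (close_up q)); exists u, v, q.
move=> [u' [v' [q' [q'E ->]]]].
have uu' : u' = u by rewrite -(path_zero (s := q)) -(path_zero (s := q')) qE q'E.
have vv' : v' = v by rewrite -(path_one (s := q)) -(path_one (s := q')) qE q'E.
subst u' v'; congr close_up; apply/path_eqP => t; by rewrite qE q'E.
Qed.

Lemma tautological_line u v (q : {path I from u to v}) :
  tautological (line_of q) = close_up q.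
Proof. by apply: tautologicalE => t; rewrite /line_of itv_valK. Qed.

Lemma tautological_cocycle : cocycle tautological.
Proof.
split => [h ch h0 h1|p cp a b c].
  have c0 : continuous (fun t => h (0, t)) by cts.
  have c1 : continuous (fun t => h (1, t)) by cts.
  rewrite (tautologicalE (q := path_of c0 erefl erefl)) //.
  rewrite (tautologicalE (q := path_of c1 (h0 1) (h1 1))) //.
  by apply: close_up_homotopic; apply: (path_homotopicI ch).
have cs u v : continuous (subpath p u v) by exact: subpath_continuous.
pose q u v := path_of (cs u v) (subpath0 p u v) (subpath1 p u v).
have qE u v : tautological (subpath p u v) = close_up (q u v).
  exact: tautologicalE.
rewrite !qE -close_up_cat; apply: close_up_homotopic.
exact: (path_cat_subpath cp).
Qed.

Lemma close_up_loop (l : {path I from x to x}) : close_up l =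
  (homotopy_class (gamma x) * homotopy_class l * (homotopy_class (gamma x))^-1)%g.
Proof.
rewrite -[RHS]/(pi1_mul (pi1_mul _ _) (pi1_inv _)).
by rewrite pi1_invE !pi1_mulE.
Qed.

Lemma monodromy_close_up {H : groupType} (C : (R -> X) -> H) u v
    (q : {path I from u to v}) : cocycle C ->
  monodromy C (close_up q) =
  (C (line_of (gamma u)) * C (line_of q) * (C (line_of (gamma v)))^-1)%g.
Proof.
move=> Cc; rewrite monodromyE // cocycle_line_cat // cocycle_line_cat //.
by rewrite cocycle_line_rev.
Qed.

End Tautological.

Lemma path_exists {R : realType} {X : topologicalType} (x : X) :
  (forall z, @joined R X setT x z) ->
  exists gamma : forall z : X, {path (unit_itv R) from x to z}, True.
Proof.
move=> jx.
have H z : exists q : {path (unit_itv R) from x to z}, True.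
  by have [p [cp _ p0 p1]] := jx z; exists (path_of cp p0 p1).
by exists (fun z => projT1 (cid (H z))).
Qed.

(** The tautological cocycle can be made trivial on [S] by a gauge that keeps its
    values on the loops at the base point [y] of [S].  It is then universal for
    the cocycles that are trivial on [S]: such a [C] is the image of [T] under its
    monodromy, up to a gauge that is 1 on [S].  The gauge [nu] is 1 at [y],
    and it is constant on [S] because [C] and [T] are trivial there. *)
Theorem based_cocycle {R : realType} {X : topologicalType} (S : set X) (y : X) :
  @path_connected R X setT -> @path_connected R X S -> @coboundary_on R X S ->
  S y ->
  exists T : (R -> X) -> fundamental_group R y, [/\ cocycle T, trivial_on S T,
    forall l : {path (unit_itv R) from y to y},
      T (line_of l) = homotopy_class l &
    forall (H : groupType) (C : (R -> X) -> H), cocycle C -> trivial_on S C ->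
      exists2 nu : X -> H, (forall z, S z -> nu z = 1%g) &
        forall p, continuous p -> C p =
          ((nu (p 0%R))^-1 * monodromy C (T p) * nu (p 1%R))%g].
Proof.
move=> cX cS bS Sy.
have [gamma _] := path_exists (fun z => cX y z Logic.I Logic.I).
have T0c := tautological_cocycle gamma.
set T0 := tautological gamma in T0c.
have [l lE] := bS _ _ T0c.
pose g : fundamental_group R y := homotopy_class (gamma y).
(* [(l z)^-1] trivializes the cocycle on [S], and the constant on the right gives
   [mu y = g], which undoes the conjugation by [gamma y] *)
pose mu z := ((l z)^-1 * (l y * g))%g.
have muy : mu y = g by rewrite /mu mulKg.
exists (gauge T0 mu); split.
- exact: cocycle_gauge.
- move=> p cp Sp; rewrite /gauge lE // /mu invgM invgK -!mulgA.
  by rewrite mulVKg mulVKg mulVg.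
- move=> q; rewrite /gauge line_of0 line_of1 muy /T0 tautological_line.
  by rewrite close_up_loop -/g !mulgA mulVg mul1g mulgVK.
- move=> H C Cc CS.
  have mM := monodromy_hom Cc (x := y).
  pose nu z := ((monodromy C (mu z))^-1 * C (line_of (gamma z)))%g.
  have nuE p : continuous p ->
      C p = ((nu (p 0%R))^-1 * monodromy C (gauge T0 mu p) * nu (p 1%R))%g.
    move=> cp; rewrite /gauge mM mM (homV mM) /nu.
    have -> : T0 p = close_up gamma (path_of cp erefl erefl).
      exact: tautologicalE.
    rewrite monodromy_close_up //.
    have -> : C (line_of (path_of cp erefl erefl)) = C p.
      by rewrite -[RHS](cocycle_truncate Cc cp); congr C.
    by rewrite invgM invgK -!mulgA mulVKg mulKg mulVKg mulVg mulg1.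
  have nuy : nu y = 1%g.
    by rewrite /nu muy /g monodromyE // mulVg.
  exists nu => // z Sz; have [p [cp Sp p0 p1]] := cS y z Sy Sz.
  have := CS p cp Sp; rewrite nuE // p0 p1 nuy invg1 mul1g.
  move=> E; rewrite -[RHS]E.
  have -> : gauge T0 mu p = 1%g.
    rewrite /gauge lE // /mu invgM invgK -!mulgA.
    by rewrite mulVKg mulVKg mulVg.
  by rewrite (hom1 mM) mul1g.
Qed.

(** * The free product decomposition *)

Lemma choice_dep {I : Type} {T : I -> Type} (P : forall i, T i -> Prop) :
  (forall i, exists a : T i, P i a) ->
  exists g : forall i, T i, forall i, P i (g i).
Proof.
by move=> H; exists (fun i => projT1 (cid (H i))) => i; case: cid.
Qed.

Section TwoPieces.
Context {R : realType} {X U V : topologicalType}.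
Variables (e : U -> X) (f : V -> X).
Hypotheses (e_emb : open_embedding e) (f_emb : open_embedding f).
Hypothesis cover : forall x, (exists u, e u = x) \/ (exists v, f v = x).

Let piece (b : bool) : topologicalType := if b then U else V.
Let emb (b : bool) : piece b -> X := if b return piece b -> X then e else f.
Let emb_emb b : open_embedding (@emb b). Proof. by case: b. Qed.
Let emb_cover x : exists b u, @emb b u = x.
Proof. by have [[u ux]|[v vx]] := cover x; [exists true, u|exists false, v]. Qed.

Lemma glue_two {H : groupType} (F : (R -> U) -> H) (G : (R -> V) -> H) :
  cocycle F -> cocycle G ->
  (forall p q, continuous p -> continuous q -> (forall t, e (p t) = f (q t)) ->
     F p = G q) ->
  exists C : (R -> X) -> H, [/\ cocycle C,
    forall p, continuous p -> C (fun t => e (p t)) = F p &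
    forall p, continuous p -> C (fun t => f (p t)) = G p].
Proof.
move=> Fc Gc FG; have [_ ie _] := e_emb; have [_ if_ _] := f_emb.
pose L (b : bool) : (R -> piece b) -> H :=
  if b return (R -> piece b) -> H then F else G.
have [||||C Cc CE] := @glue_exists R X H bool piece emb L.
- exact: emb_emb.
- exact: emb_cover.
- by case.
- case=> [] [] p q cp cq pq //=; last 2 first.
  + by apply/esym; apply: FG.
  + by congr G; apply/funext => t; apply: if_; exact: pq.
  + by congr F; apply/funext => t; apply: ie; exact: pq.
  + exact: FG.
- by exists C; split => // p cp; [exact: (CE true)|exact: (CE false)].
Qed.

(** A property of paths that is local and additive can be checked on the paths
    that lie in one of the two pieces. *)
Lemma subpath_ind (P : (R -> X) -> Prop) (p : R -> X) : continuous p ->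
  (forall q q' : R -> X, continuous q -> continuous q' ->
     (forall t, 0 <= t <= 1 -> q t = q' t) -> P q -> P q') ->
  (forall u v w : R, P (subpath p u v) -> P (subpath p v w) ->
     P (subpath p u w)) ->
  (forall q : R -> U, continuous q -> P (fun t => e (q t))) ->
  (forall q : R -> V, continuous q -> P (fun t => f (q t))) ->
  P p.
Proof.
move=> cp Pext Padd PU PV; rewrite -(subpath01 p).
apply: (@path_ind R X bool (fun b => range (@emb b)) _ _ p
  (fun u v => P (subpath p u v))) => //.
- by move=> b; have [_ _ oe] := emb_emb b; apply: oe; exact: openT.
- by move=> x; have [b [u ux]] := emb_cover x; exists b, u.
- by move=> u v w _ _; exact: Padd.
move=> b u v _ uv _ pO.
have ch : continuous (fun t => subpath p u v (truncate t)).
  apply: (continuous_compose (@subpath_continuous _ _ p u v cp)).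
  exact: truncate_continuous.
have [|q cq qE] := open_embedding_lift (emb_emb b) ch.
  move=> t; have t0 := truncate_ge0 t; have t1 := truncate_le1 t.
  have [||s _ sE] := pO (u + truncate t * (v - u)); [nra|nra|].
  by exists s.
have ce : continuous (fun t => emb (q t)).
  by have [ce _ _] := emb_emb b; exact: continuous_compose ce cq.
apply: (Pext (fun t => emb (q t))) => //.
- exact: subpath_continuous.
- by move=> t /andP[t0 t1]; rewrite qE truncate_id.
- by case: b pO q cq qE ce => _ q cq _ _; [exact: PU|exact: PV].
Qed.

Lemma cocycle_uniq {H : groupType} (F G : (R -> X) -> H) p :
  cocycle F -> cocycle G -> continuous p ->
  (forall q, continuous q -> F (fun t => e (q t)) = G (fun t => e (q t))) ->
  (forall q, continuous q -> F (fun t => f (q t)) = G (fun t => f (q t))) ->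
  F p = G p.
Proof.
move=> Fc Gc cp FGe FGf.
apply: (@subpath_ind (fun q => F q = G q)) => // [q q' cq cq' qq' E|u v w E1 E2].
  by rewrite -(cocycle_ext Fc cq cq' qq') -(cocycle_ext Gc cq cq' qq').
by rewrite -(cocycle_cat Fc cp u v w) E1 E2 (cocycle_cat Gc).
Qed.

End TwoPieces.

Lemma cocycle_one {R : realType} {X : topologicalType} {H : groupType} :
  cocycle (fun _ : R -> X => 1%g : H).
Proof. by split => // p cp a b c; rewrite mulg1. Qed.

(** The data of a connected sum: [M] is covered by open sets [k i (U i)], which meet
    in the image of [W] (R^3 minus a point in the application), and [N i] is
    obtained from [U i] by filling in [W] with [E] (R^3 in the application).  The
    two parametrizations of the overlap by [W] are only required to have the same
    image.  Base points are chosen in the overlaps. *)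
Section SumData.
Context {R : realType} {N : bool -> topologicalType} {M : topologicalType}.
Context {U : bool -> topologicalType} {E W : topologicalType}.
Variables (j : forall i, U i -> N i) (f : forall i, E -> N i).
Variables (k : forall i, U i -> M) (w : forall i, W -> U i).
Hypothesis j_emb : forall i, open_embedding (@j i).
Hypothesis f_emb : forall i, open_embedding (f i).
Hypothesis k_emb : forall i, open_embedding (@k i).
Hypothesis w_emb : forall i, open_embedding (w i).
Hypothesis N_cover :
  forall i (z : N i), (exists u, j u = z) \/ (exists v, f i v = z).
Hypothesis M_cover : forall m, exists i u, @k i u = m.
Hypothesis N_overlap : forall i (u : U i) v, j u = f i v -> range (w i) u.
Hypothesis jw : forall i z, range (f i) (j (w i z)).
Hypothesis M_overlap : forall i i' (u : U i) (u' : U i'),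
  i != i' -> k u = k u' -> range (w i) u.
Hypothesis kw : forall z, exists z', k (w true z) = k (w false z').
Hypothesis W_coboundary : @coboundary_on R W setT.
Hypothesis E_coboundary : @coboundary_on R E setT.
Hypothesis W_connected : @path_connected R W setT.
Hypothesis E_connected : @path_connected R E setT.
Hypothesis N_connected : forall i, @path_connected R (N i) setT.
Hypothesis M_connected : @path_connected R M setT.
Variables (z0 : W) (v0 : E).

Let x i : N i := f i v0.
Let y : M := k (w false z0).
Let Gs i : groupType := fundamental_group R (x i).
Let G : groupType := fundamental_group R y.
Let B : forall i, set (N i) := fun i => range (f i).
Let O : set M := (fun z => k (w false z)) @` setT.

Let kw_emb i : open_embedding (fun z => k (w i z)).
Proof.
have [ck ik ok] := k_emb i; have [cw iw ow] := w_emb i; split.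
- exact: continuous_compose ck cw.
- by move=> z z' /ik/iw.
- move=> A oA; have -> : (fun z => k (w i z)) @` A = @k i @` (w i @` A).
    by rewrite image_comp.
  by apply: ok; exact: ow.
Qed.

Let kwO i z : O (k (w i z)).
Proof. by case: i; [have [z' ->] := kw z; exists z'|exists z]. Qed.

Let range_connected {X Y : topologicalType} (e : X -> Y) : continuous e ->
  @path_connected R X setT -> @path_connected R Y (range e).
Proof.
move=> ce cX _ _ [a _ <-] [b _ <-].
by have := joined_map ce (cX a b Logic.I Logic.I).
Qed.

Let B_connected i : @path_connected R (N i) (@B i).
Proof. by apply: range_connected => //; have [] := f_emb i. Qed.

Let O_connected : @path_connected R M O.
Proof. by apply: range_connected => //; have [] := kw_emb false. Qed.

Let B_coboundary i : @coboundary_on R (N i) (@B i).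
Proof. exact: coboundary_on_emb. Qed.

Let O_coboundary : @coboundary_on R M O.
Proof. by apply: coboundary_on_emb => //; exact: kw_emb. Qed.

Let Bx i : B (x i). Proof. by exists v0. Qed.
Let Oy : O y. Proof. exact: kwO. Qed.

(** Van Kampen's theorem for a connected sum.  Let [T] and [TN i] be the based
    cocycles of [M] and [N i].  Restricting [T] to [U i] and extending it by 1 over
    [E] defines a cocycle [Phi i] on [N i] whose monodromy is the morphism from the
    [i]-th factor.  Generation: up to a gauge, the values of [T] on the paths of
    [k i (U i)] are in the image of that morphism, and every path is a product of
    such paths.  Universality: morphisms [alpha i] turn [TN i] into cocycles that
    are trivial on [E], hence glue on [M] to a cocycle whose monodromy is the
    required morphism. *)
Theorem connected_sum_free_product :
  exists phi : forall i, Gs i -> G, free_product phi.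
Proof.
have cj i : continuous (@j i) by have [] := j_emb i.
have ck i : continuous (@k i) by have [] := k_emb i.
have cf i : continuous (f i) by have [] := f_emb i.
have ik i : injective (@k i) by have [] := k_emb i.
have [T [Tc TO Tl Tuniv]] :=
  based_cocycle M_connected O_connected O_coboundary Oy.
have /choice_dep[TN TNP] : forall i, exists TN : (R -> N i) -> Gs i,
    [/\ cocycle TN, trivial_on (@B i) TN,
    forall l : {path (unit_itv R) from (x i) to (x i)},
      TN (line_of l) = homotopy_class l &
    forall (H : groupType) (C : (R -> N i) -> H), cocycle C ->
      trivial_on (@B i) C ->
      exists2 nu : N i -> H, (forall z, @B i z -> nu z = 1%g) &
        forall p, continuous p -> C p =
          ((nu (p 0%R))^-1 * monodromy C (TN p) * nu (p 1%R))%g].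
  move=> i.
  exact: based_cocycle (@N_connected i) (@B_connected i) (@B_coboundary i) (Bx i).
have kpath i (p : R -> U i) : continuous p -> continuous (fun t => k (p t)).
  exact: continuous_compose.
have jpath i (p : R -> U i) : continuous p -> continuous (fun t => j (p t)).
  exact: continuous_compose.
have fpath i (p : R -> E) : continuous p -> continuous (fun t => f i (p t)).
  exact: continuous_compose.
have /choice_dep[Phi PhiP] : forall i, exists Phi : (R -> N i) -> G,
    [/\ cocycle Phi,
      forall p, continuous p -> Phi (fun t => j (p t)) = T (fun t => k (p t)) &
      forall p, continuous p -> Phi (fun t => f i (p t)) = 1%g].
  move=> i; apply: (glue_two (j_emb i) (f_emb i) (@N_cover i)).
  - exact: (cocycle_pullback Tc (@ck i)).
  - exact: cocycle_one.
  move=> p q cp cq pq; apply: TO => [|t]; first exact: kpath.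
  by have [z _ <-] := N_overlap (pq t); exact: kwO.
have PhiB i : trivial_on (@B i) (Phi i).
  have [_ _ Phif] := PhiP i; move=> p cp pB.
  have [|q cq qE] := open_embedding_lift (f_emb i) cp.
    by move=> t; have [v _ <-] := pB t; exists v.
  have -> : p = (fun t => f i (q t)) by apply/funext.
  exact: Phif.
exists (fun i => monodromy (Phi i) (x := x i)); split.
- by move=> i; apply: monodromy_hom; have [] := PhiP i.
- move=> g.
  have /choice_dep[nuN nuNP] : forall i, exists nu : N i -> G,
      (forall z, @B i z -> nu z = 1%g) /\ forall p, continuous p -> Phi i p =
        ((nu (p 0%R))^-1 * monodromy (Phi i) (TN i p) * nu (p 1%R))%g.
    move=> i; have [_ _ _ /(_ _ (Phi i))[||nu nu1 nuE]] := TNP i.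
    + by have [] := PhiP i.
    + exact: PhiB.
    + by exists nu.
  pose nu m := xget 1%g [set h : G | exists i u, @k i u = m /\ h = nuN i (j u)].
  (* the gauges [nuN i] define a gauge on [M] because they are 1 on the overlap *)
  have nuE i (u : U i) : nu (k u) = nuN i (j u).
    rewrite /nu; case: xgetP => [h _|no]; last first.
      by case: (no (nuN i (j u))); exists i, u.
    move=> [i' [u' [kk ->]]].
    have [ii|ii] := eqVneq i i'; first by subst i'; rewrite (ik _ _ _ kk).
    have [z _ <-] := M_overlap ii (esym kk).
    have [z' _ <-] : range (w i') u' by apply: M_overlap kk; rewrite eq_sym.
    by rewrite (proj1 (nuNP i) _ (jw i z)) (proj1 (nuNP i') _ (jw i' z')).
  have key p : continuous p -> exists s : seq {i & Gs i},
      (nu (p 0%R) * T p * (nu (p 1%R))^-1)%g =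
      (\prod_(e <- s) monodromy (Phi (tag e)) (tagged e))%g.
    move=> cp.
    have small i (q : R -> U i) : continuous q -> exists s : seq {i & Gs i},
        (nu (k (q 0%R)) * T (fun t => k (q t)) * (nu (k (q 1%R)))^-1)%g =
        (\prod_(e <- s) monodromy (Phi (tag e)) (tagged e))%g.
      move=> cq; exists [:: Tagged Gs (TN i (fun t => j (q t)))].
      have [_ Phij _] := PhiP i.
      rewrite big_seq1 /= -Phij // (proj2 (nuNP i)) ?nuE; last exact: jpath.
      by rewrite !mulgA mulgV mul1g mulgK.
    have cov m : (exists u, @k true u = m) \/ (exists u, @k false u = m).
      by have [[] [u um]] := M_cover m; [left|right]; exists u.
    apply: (subpath_ind (k_emb true) (k_emb false) cov (P := fun p =>
      exists s : seq {i & Gs i}, (nu (p 0%R) * T p * (nu (p 1%R))^-1)%g =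
      (\prod_(e <- s) monodromy (Phi (tag e)) (tagged e))%g)) => //.
    + move=> q q' cq cq' qq' [s sE]; exists s; rewrite -sE.
      by rewrite (cocycle_ext Tc cq cq' qq') !qq' // ?lexx ?ler01.
    + move=> a b c [s sE] [s' s'E]; exists (s ++ s').
      rewrite big_cat /= -sE -s'E !subpath0 !subpath1.
      by rewrite -(cocycle_cat Tc cp a b c) !mulgA mulgVK.
    + exact: small.
    + exact: small.
  have [s sE] := key _ (@line_of_continuous R M y y (repr g)).
  exists s; rewrite -sE line_of0 line_of1 Tl homotopy_class_surj.
  have -> : nu y = 1%g by rewrite nuE; apply: (proj1 (nuNP _)); exact: jw.
  by rewrite invg1 mulg1 mul1g.
- move=> H alpha alphaM.
  pose C' i := fun p => alpha i (TN i p).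
  have C'c i : cocycle (C' i).
    by apply: cocycle_push; [have [] := TNP i|exact: alphaM].
  have C'B i : trivial_on (@B i) (C' i).
    move=> p cp pB; rewrite /C'; have [_ TB _ _] := TNP i.
    by rewrite TB // (hom1 (alphaM i)).
  have C'w i (p : R -> U i) : continuous p -> (forall t, range (w i) (p t)) ->
      C' i (fun t => j (p t)) = 1%g.
    move=> cp pw; apply: C'B => [|t]; first exact: jpath.
    by have [z _ <-] := pw t; exact: jw.
  have [||||C Cc CE] := @glue_exists R M H bool U k
      (fun i p => C' i (fun t => j (p t))).
  + exact: k_emb.
  + exact: M_cover.
  + by move=> i; exact: (cocycle_pullback (C'c i) (@cj i)).
  + move=> i i' p q cp cq pq; have [ii|ii] := eqVneq i i'.
      subst i'; congr (C' _ _); apply/funext => t.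
      by rewrite (ik _ _ _ (pq t)).
    rewrite !C'w // => t; first by apply: M_overlap (esym (pq t)); rewrite eq_sym.
    exact: M_overlap (pq t).
  have CO : trivial_on O C.
    move=> p cp pO; have [|q cq qE] := open_embedding_lift (kw_emb false) cp.
      by move=> t; have [z _ <-] := pO t; exists z.
    have cwq : continuous (fun t => w false (q t)).
      by have [cw _ _] := w_emb false; exact: continuous_compose cw cq.
    have -> : p = (fun t => k (w false (q t))) by apply/funext.
    by rewrite (CE false) // C'w // => t; exists (q t).
  have [nu nuO nuE] := Tuniv H C Cc CO.
  exists (monodromy C (x := y)); first exact: monodromy_hom.
  move=> i c.
  (* the gauge [nu], transported to [N i], and extended by 1 at the missing points *)
  pose n (z : N i) := xget 1%g [set h : H | exists u, j u = z /\ h = nu (k u)].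
  have nj u : n (j u) = nu (k u).
    rewrite /n; case: xgetP => [h _ [u' [uu ->]]|no]; last first.
      by case: (no (nu (k u))); exists u.
    by have [_ ij _] := j_emb i; rewrite (ij _ _ uu).
  have nf v : n (f i v) = 1%g.
    rewrite /n; case: xgetP => [h _ [u [uv ->]]|//].
    by have [z _ <-] := N_overlap uv; apply: nuO; exact: kwO.
  have [Phic Phij Phif] := PhiP i.
  have mC := monodromy_hom Cc (x := y).
  have CPhi : forall p, continuous p ->
      C' i p = gauge (fun p => monodromy C (Phi i p)) n p.
    move=> p cp; apply: (cocycle_uniq (j_emb i) (f_emb i) (@N_cover i)) => //.
    * by apply: cocycle_gauge; exact: cocycle_push.
    * move=> q cq; rewrite -(CE i) // nuE; last exact: kpath.
      by rewrite /gauge !nj Phij.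
    * move=> q cq; rewrite C'B.
        by rewrite /gauge !nf Phif // (hom1 mC) invg1 !mulg1.
        exact: fpath.
      by move=> t; exists (q t).
  have := CPhi _ (@line_of_continuous R _ _ _ (repr c)).
  rewrite /C' /gauge line_of0 line_of1 nf invg1 mul1g mulg1.
  by have [_ _ -> _] := TNP i; rewrite homotopy_class_surj.
Qed.

End SumData.

(** * Cocycles on space and on space minus a point *)

Section SetType.
Context {X : topologicalType} (A : set X).

Lemma set_val_continuous : continuous (set_val : set_type A -> X).
Proof. exact: initial_continuous. Qed.

Lemma set_val_inj : injective (set_val : set_type A -> X).
Proof. exact: val_inj. Qed.

Lemma set_type_in (u : set_type A) : A (set_val u).
Proof. by have := set_valP u. Qed.

Lemma set_type_sub z : A z -> exists u : set_type A, set_val u = z.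
Proof. by move=> Az; exists (exist _ z (mem_set Az)). Qed.

Lemma set_val_open_embedding : open A -> open_embedding (set_val : set_type A -> X).
Proof.
move=> oA; split; [exact: set_val_continuous|exact: set_val_inj|].
move=> _ [B oB <-].
suff -> : set_val @` (set_val @^-1` B : set (set_type A)) = A `&` B.
  exact: openI.
apply/seteqP; split => z /=.
  by move=> [u Bu <-]; split => //; exact: set_type_in.
by move=> [/set_type_sub[u <-] Bu]; exists u.
Qed.

End SetType.

Lemma closed_point {R : realType} {V : normedModType R} (x : V) : closed [set x].
Proof. exact/accessible_closed_set1/hausdorff_accessible/norm_hausdorff. Qed.

Section Vectors.
Context {R : realType}.
Local Notation E := 'rV[R]_3.

Lemma ctsZ {T : topologicalType} (f : T -> R) (g : T -> E) :
  continuous f -> continuous g -> continuous (fun z => f z *: g z).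
Proof. by move=> cf cg z; apply: cvgZ; [exact: cf|exact: cg]. Qed.

Lemma ctsVD {T : topologicalType} (f g : T -> E) :
  continuous f -> continuous g -> continuous (fun z => f z + g z).
Proof. by move=> cf cg z; apply: cvgD; [exact: cf|exact: cg]. Qed.

Definition segment (u v : E) (t : R) : E := u + t *: (v - u).

Lemma segment_continuous {T : topologicalType} (u : E) (f : T -> E) (g : T -> R) :
  continuous f -> continuous g -> continuous (fun z => segment u (f z) (g z)).
Proof.
move=> cf cg; rewrite /segment.
apply: (@ctsVD _ (fun=> u)); first exact: cts_cst.
apply: ctsZ => //; apply: (@ctsVD _ f (fun=> - u)) => //; exact: cts_cst.
Qed.

Lemma segment0 u v : segment u v 0 = u.
Proof. by rewrite /segment scale0r addr0. Qed.

Lemma segment1 u v : segment u v 1 = v.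
Proof. by rewrite /segment scale1r addrC subrK. Qed.

Lemma segmentE u v t i j : segment u v t i j = u i j + t * (v i j - u i j).
Proof. by rewrite /segment !mxE. Qed.

Section Chart.
Context {Y : topologicalType} (e : Y -> E).
Hypothesis ee : open_embedding e.

Lemma joined_segment (A : set Y) (u v : Y) :
  (forall t, 0 <= t <= 1 -> (e @` A) (segment (e u) (e v) t)) ->
  @joined R Y A u v.
Proof.
move=> Auv; have [_ ie _] := ee.
have [|t|p cp pE] := @open_embedding_lift R Y E e
  (fun t => segment (e u) (e v) (truncate t)) ee.
- by apply: segment_continuous; [exact: cts_cst|exact: truncate_continuous].
- have [|a _ <-] := Auv (truncate t); last by exists a.
  by rewrite truncate_ge0 truncate_le1.
- exists p; split => //.
  + move=> t; have [|a Aa aE] := Auv (truncate t).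
      by rewrite truncate_ge0 truncate_le1.
    by have -> : p t = a by apply: ie; rewrite pE.
  + by apply: ie; rewrite pE truncate0 segment0.
  + by apply: ie; rewrite pE truncate1 segment1.
Qed.

(** On a star-shaped set, the value on the segment from the centre [c] to [v] is a
    primitive: the cone over a path is a square one side of which is
    collapsed to [c]. *)
Lemma star_coboundary (A : set Y) (c : Y) : A c ->
  (forall v t, A v -> 0 <= t <= 1 -> (e @` A) (segment (e c) (e v) t)) ->
  @coboundary_on R Y A.
Proof.
move=> Ac Astar H F Fc; have [ce ie _] := ee.
have /choice[q qP] v : exists q : R -> Y, A v ->
    continuous q /\ forall t, e (q t) = segment (e c) (e v) (truncate t).
  have [Av|] := pselect (A v); last by exists (fun=> c).
  have [|t|q cq qE] := @open_embedding_lift R Y E e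
    (fun t => segment (e c) (e v) (truncate t)) ee.
  - by apply: segment_continuous; [exact: cts_cst|exact: truncate_continuous].
  - have [|a _ <-] := Astar _ (truncate t) Av; last by exists a.
    by rewrite truncate_ge0 truncate_le1.
  - by exists q.
exists (fun v => F (q v)) => p cp Ap.
have [|z|h ch hE] := @open_embedding_lift (R * R)%type Y E e
  (fun z => segment (e c) (e (p z.2)) (truncate z.1)) ee.
- apply: segment_continuous.
    apply: (continuous_compose ce); apply: (continuous_compose cp).
    exact: continuous_pi2.
  by apply: (continuous_compose truncate_continuous); exact: continuous_pi1.
- have [|a _ <-] := Astar _ (truncate z.1) (Ap z.2); last by exists a.
  by rewrite truncate_ge0 truncate_le1.
have := cocycle_square Fc ch.
have -> : (fun t => h (0, t)) = (fun=> c).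
  by apply/funext => t; apply: ie; rewrite hE /= truncate0 segment0.
have -> : (fun t => h (1, t)) = p.
  by apply/funext => t; apply: ie; rewrite hE /= truncate1 segment1.
have side t : (fun s => h (s, t)) = q (p t).
  apply/funext => s; apply: ie; rewrite hE /=.
  by have [_ ->] := qP _ (Ap t).
by rewrite !side (cocycle_cst Fc) mul1g => ->; rewrite mulKg.
Qed.

End Chart.

Lemma id_open_embedding {X : topologicalType} : open_embedding (fun x : X => x).
Proof. by split=> // A oA; [exact: cts_id|rewrite image_id]. Qed.

Lemma rV3_coboundary : @coboundary_on R E setT.
Proof.
by apply: (star_coboundary id_open_embedding (c := 0)) => // v t _ _;
  rewrite image_id.
Qed.

Lemma rV3_connected : @path_connected R E setT.
Proof.
by move=> u v _ _; apply: (joined_segment id_open_embedding); rewrite image_id.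
Qed.

Definition punctured_space : set E := [set v | v != 0].
Local Notation W := (set_type punctured_space).

Definition cx (v : E) : R := v ord0 ord0.
Definition cy (v : E) : R := v ord0 (lift ord0 ord0).
Definition cz (v : E) : R := v ord0 ord_max.

Definition vec3 (a b c : R) : E :=
  \row_i (if i == ord0 then a else if i == ord_max then c else b).

Lemma cx_vec a b c : cx (vec3 a b c) = a. Proof. by rewrite /cx mxE. Qed.
Lemma cy_vec a b c : cy (vec3 a b c) = b. Proof. by rewrite /cy mxE. Qed.
Lemma cz_vec a b c : cz (vec3 a b c) = c. Proof. by rewrite /cz mxE. Qed.

Lemma coords_eq0 (v : E) : cx v = 0 -> cy v = 0 -> cz v = 0 -> v = 0.
Proof.
move=> x0 y0 z0; apply/rowP => i; rewrite !mxE.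
have : (i < 3)%N by [].
case: i => [[|[|[|//]]] hi] _.
- by rewrite -[RHS]x0; congr (v _ _); apply: val_inj.
- by rewrite -[RHS]y0; congr (v _ _); apply: val_inj.
- by rewrite -[RHS]z0; congr (v _ _); apply: val_inj.
Qed.

Lemma coords_neq0 (v : E) : [\/ cx v <> 0, cy v <> 0 | cz v <> 0] -> v != 0.
Proof.
by move=> h; apply/eqP => v0; move: h; rewrite v0 /cx /cy /cz !mxE; case.
Qed.

Lemma segment_x u v t : cx (segment u v t) = cx u + t * (cx v - cx u).
Proof. exact: segmentE. Qed.
Lemma segment_y u v t : cy (segment u v t) = cy u + t * (cy v - cy u).
Proof. exact: segmentE. Qed.
Lemma segment_z u v t : cz (segment u v t) = cz u + t * (cz v - cz u).
Proof. exact: segmentE. Qed.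

Lemma open_punctured_space : open punctured_space.
Proof.
rewrite (_ : punctured_space = ~` [set 0]); first exact/closed_openC/closed_point.
by apply/seteqP; split => v /=; [move/eqP|move=> h; apply/eqP].
Qed.

Let W_emb : open_embedding (set_val : W -> E).
Proof. by apply: set_val_open_embedding; exact: open_punctured_space. Qed.

Let W_mem (v : E) : v != 0 -> exists w : W, set_val w = v.
Proof. exact: (@set_type_sub _ punctured_space v). Qed.

Let off_axis : set W := [set w | cy (set_val w) <> 0 \/ cz (set_val w) <> 0].

Let image_set (P : set E) : (forall v, P v -> v != 0) ->
  forall v, P v -> (set_val @` [set w : W | P (set_val w)]) v.
Proof.
by move=> P0 v Pv; have [w wE] := W_mem (P0 v Pv); exists w; rewrite /= ?wE.
Qed.

Let b_ex : exists b : W, set_val b = vec3 0 1 0.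
Proof.
by apply/W_mem/coords_neq0/Or32; rewrite cy_vec; apply/eqP; exact: oner_neq0.
Qed.
Let b'_ex : exists b : W, set_val b = vec3 0 0 1.
Proof.
by apply/W_mem/coords_neq0/Or33; rewrite cz_vec; apply/eqP; exact: oner_neq0.
Qed.

(** Two segments suffice.  A point with [cz <> 0] or [cy > 0] is joined to (0, 1, 0)
    by a segment that avoids the axis; a point of the remaining half-plane is
    first joined to (0, 0, 1). *)
Let off_axis_join b u : set_val b = vec3 0 1 0 -> off_axis u ->
  @joined R W off_axis u b.
Proof.
move=> bE uO; have [b' b'E] := b'_ex.
have img := @image_set [set v | cy v <> 0 \/ cz v <> 0].
have img0 v : cy v <> 0 \/ cz v <> 0 -> v != 0.
  by move=> h; apply: coords_neq0; case: h; [exact: Or32|exact: Or33].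
have step w : cz (set_val w) <> 0 \/ 0 < cy (set_val w) ->
    @joined R W off_axis w b.
  move=> wz; apply: (joined_segment W_emb) => t /andP[t0 t1].
  apply: (img img0) => /=; rewrite segment_y segment_z bE cy_vec cz_vec.
  case: wz => [wz|wy]; last by left; nra.
  have [t1'|t1'] := eqVneq t 1; first by left; rewrite t1'; lra.
  right; have t2 : t < 1 by rewrite lt_neqAle t1'.
  by rewrite sub0r => h; apply: wz; nra.
have [uz|uz] := pselect (cz (set_val u) <> 0 \/ 0 < cy (set_val u)).
  exact: step.
apply: (@joined_trans _ _ _ _ b'); last first.
  by apply: step; left; rewrite b'E cz_vec; lra.
have uz0 : cz (set_val u) = 0 by apply: contrapT => h; apply: uz; left.
have uy : cy (set_val u) < 0.
  case: uO => uy; last by case: uz; left.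
  rewrite ltNge le_eqVlt; apply/negP => /orP[/eqP h|h].
    by apply: uy; rewrite h.
  by apply: uz; right.
apply: (joined_segment W_emb) => t /andP[t0 t1].
apply: (img img0) => /=; rewrite segment_y segment_z b'E cy_vec cz_vec uz0.
have [->|t1'] := eqVneq t 1; first by right; lra.
have t2 : t < 1 by rewrite lt_neqAle t1'.
by left; nra.
Qed.

Lemma punctured_connected : @path_connected R W setT.
Proof.
have [b bE] := b_ex.
suff H u : @joined R W setT u b.
  by move=> u v _ _; exact: joined_trans (H u) (joined_sym (H v)).
have [uO|uO] := pselect (off_axis u).
  by apply: joined_sub (off_axis_join bE uO).
have uy : cy (set_val u) = 0 by apply: contrapT => h; apply: uO; left.
have uz : cz (set_val u) = 0 by apply: contrapT => h; apply: uO; right.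
apply: (joined_segment W_emb) => t /andP[t0 t1].
have [|w wE] := @W_mem (segment (set_val u) (set_val b) t); last by exists w.
apply: coords_neq0; have [t0'|/eqP t0'] := eqVneq t 0; last first.
  by apply: Or32; rewrite segment_y bE cy_vec uy; lra.
apply: Or31; rewrite t0' segment_x mul0r addr0 => ux.
by have := set_type_in u; rewrite /punctured_space /= (coords_eq0 ux uy uz) eqxx.
Qed.

(** The complement of the half-line spanned by (s, 0, 0), for [s] equal to 1 or -1;
    it is star-shaped with respect to (-s, 0, 0). *)
Let slit (s : R) : set W := [set w | [\/ s * cx (set_val w) < 0,
  cy (set_val w) <> 0 | cz (set_val w) <> 0]].

Let slit_coboundary s : s * s = 1 -> @coboundary_on R W (slit s).
Proof.
move=> ss; have s0 : s <> 0 by move=> s0; move: ss; rewrite s0; lra.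
have img0 v : [\/ s * cx v < 0, cy v <> 0 | cz v <> 0] -> v != 0.
  move=> h; apply: coords_neq0; case: h => h; [apply: Or31|exact: Or32|exact: Or33].
  by move=> x0; move: h; rewrite x0; lra.
have img := @image_set [set v | [\/ s * cx v < 0, cy v <> 0 | cz v <> 0]] img0.
have [|c cE] := @W_mem (vec3 (- s) 0 0).
  by apply/coords_neq0/Or31; rewrite cx_vec => h; apply: s0; lra.
apply: (star_coboundary W_emb (c := c)) => /=.
  by apply: Or31; rewrite cE cx_vec mulrN ss; lra.
move=> v t vS /andP[t0 t1]; apply: img => /=.
rewrite segment_x segment_y segment_z cE cx_vec cy_vec cz_vec.
have [t0'|/eqP t0'] := eqVneq t 0.
  by apply: Or31; rewrite t0' mul0r addr0 mulrN ss; lra.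
have tp : 0 < t by rewrite lt_neqAle t0 andbT eq_sym; apply/eqP.
case: vS => h.
- apply: Or31; have -> : s * (- s + t * (cx (set_val v) - - s)) =
    (t - 1) * (s * s) + t * (s * cx (set_val v)) by ring.
  by rewrite ss; nra.
- by apply: Or32; rewrite !subr0 add0r => /eqP; rewrite mulf_eq0 => /orP[] /eqP.
- by apply: Or33; rewrite !subr0 add0r => /eqP; rewrite mulf_eq0 => /orP[] /eqP.
Qed.

Let coord_cts i : continuous (fun w : W => (set_val w : E) ord0 i).
Proof.
apply: (continuous_compose (g := fun v : E => v ord0 i)).
  exact: coord_continuous.
exact: set_val_continuous.
Qed.

Let slit_open s : open (slit s).
Proof.
have -> : slit s = ((fun w : W => s * cx (set_val w)) @^-1` [set r | r < 0]) `|`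
    (((fun w : W => cy (set_val w)) @^-1` [set~ 0]) `|`
     ((fun w : W => cz (set_val w)) @^-1` [set~ 0])).
  apply/seteqP; split => w /=; first by case; tauto.
  by move=> [|[]]; [exact: Or31|exact: Or32|exact: Or33].
have o0 : open [set~ (0 : R)] by exact/closed_openC/(@closed_point R R^o).
have cxc : continuous (fun w : W => cx (set_val w)) := @coord_cts _.
have cyc : continuous (fun w : W => cy (set_val w)) := @coord_cts _.
have czc : continuous (fun w : W => cz (set_val w)) := @coord_cts _.
have cs : continuous (fun w : W => s * cx (set_val w)).
  by apply: (@ctsM _ _ (fun=> s)) => //; exact: cts_cst.
apply: openU; last apply: openU.
- apply: open_comp; last exact: open_lt.
  by move=> w _; exact: cs.
- by apply: open_comp => // w _; exact: cyc.
- by apply: open_comp => // w _; exact: czc.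
Qed.

(** This is van Kampen's proof that the sphere is simply connected: space minus a
    point is the union of two star-shaped open sets, the complements of opposite
    half-lines, and their intersection is path-connected, so that the primitives
    on the two sets can be adjusted by a constant to agree there. *)
Theorem punctured_coboundary : @coboundary_on R W setT.
Proof.
move=> H F Fc; have [b bE] := b_ex.
have [L LE] := slit_coboundary (mulr1 1) Fc.
have [|L' L'E] := slit_coboundary (s := -1) _ Fc; first by rewrite mulrNN mulr1.
have offS s w : off_axis w -> slit s w.
  by case; [exact: Or32|exact: Or33].
pose d := ((L b) * (L' b)^-1)%g.
have LL' u : off_axis u -> L u = (d * L' u)%g.
  move=> uO; have [p [cp Op p0 p1]] := off_axis_join bE uO.
  have := LE p cp (fun t => offS 1 _ (Op t)).
  rewrite (L'E p cp (fun t => offS (-1) _ (Op t))) p0 p1 => E.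
  rewrite /d; apply: (@mulIg _ (L' u)^-1%g); rewrite mulgK.
  have -> : L b = (L u * ((L u)^-1 * L b))%g by rewrite mulVKg.
  by rewrite -E mulgA mulgK.
pose l w := if pselect (slit 1 w) then L w else (d * L' w)%g.
have lE w : slit 1 w -> l w = L w by rewrite /l; case: pselect.
have lE' w : slit (-1) w -> l w = (d * L' w)%g.
  rewrite /l => w'; case: pselect => // w1; apply: LL'.
  case: w1 => h; [|by left|by right]; case: w' => h'; [|by left|by right].
  move: h h'; rewrite mul1r mulN1r oppr_lt0 => h /(lt_trans h).
  by rewrite ltxx.
exists l => p cp _.
have cov w : exists b : bool, slit (if b then 1 else -1) w.
  have [w0|w0] := pselect (off_axis w); first by exists true; exact: offS.
  have [x0|x0|x0] := ltgtP (cx (set_val w)) 0.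
  - by exists true; apply: Or31; rewrite mul1r.
  - by exists false; apply: Or31; rewrite mulN1r oppr_lt0.
  - have y0 : cy (set_val w) = 0 by apply: contrapT => h; apply: w0; left.
    have z0 : cz (set_val w) = 0 by apply: contrapT => h; apply: w0; right.
    have := set_type_in w.
    by rewrite /punctured_space /= (coords_eq0 x0 y0 z0) eqxx.
rewrite -[in LHS](subpath01 p).
have ext u v : F (subpath p u v) = F (fun t => subpath p u v (truncate t)).
  by rewrite cocycle_truncate //; exact: subpath_continuous.
have key := @path_ind R W bool (fun b => slit (if b then 1 else -1)) _ cov p
  (fun u v => F (subpath p u v) = ((l (p u))^-1 * l (p v))%g) 0 1 cp ler01.
apply: key.
- by move=> b'; exact: slit_open.
- move=> u v w _ _ E1 E2; rewrite -(cocycle_cat Fc cp u v w) E1 E2.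
  by rewrite mulgA mulgK.
move=> b' u v _ uv _ pS; rewrite ext.
have cs : continuous (fun t => subpath p u v (truncate t)).
  apply: (continuous_compose (@subpath_continuous _ _ p u v cp)).
  exact: truncate_continuous.
have Ss t : slit (if b' then 1 else -1) (subpath p u v (truncate t)).
  have t0 := truncate_ge0 t; have t1 := truncate_le1 t.
  by apply: pS; nra.
have Su := pS u (lexx u) uv; have Sv := pS v uv (lexx v).
case: b' {pS} Ss Su Sv => Ss Su Sv.
  by rewrite LE // truncate0 truncate1 subpath0 subpath1 !lE.
rewrite L'E // truncate0 truncate1 subpath0 subpath1 !lE' //.
by rewrite invgM mulgA mulgVK.
Qed.

End Vectors.

(** * Connectedness of manifolds *)

Lemma set_type_lift {T X : topologicalType} (A : set X) (h : T -> X) :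
  continuous h -> (forall z, A (h z)) ->
  exists2 q : T -> set_type A, continuous q & forall z, set_val (q z) = h z.
Proof.
move=> ch Ah; exists (fun z => exist _ (h z) (mem_set (Ah z)) : set_type A) => //.
by apply: continuous_comp_initial.
Qed.

Lemma open_embedding_comp {X Y Z : topologicalType} (f : X -> Y) (g : Y -> Z) :
  open_embedding f -> open_embedding g -> open_embedding (fun x => g (f x)).
Proof.
move=> [cf if_ of_] [cg ig og]; split.
- exact: continuous_compose cg cf.
- by move=> x x' /ig/if_.
- move=> A oA; have -> : (fun x => g (f x)) @` A = g @` (f @` A).
    by rewrite image_comp.
  by apply: og; exact: of_.
Qed.

Lemma open_embedding_corestrict {X Y : topologicalType} (A : set Y)
    (f : X -> set_type A) : continuous f ->
  open_embedding (fun x => set_val (f x)) -> open_embedding f.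
Proof.
move=> cf [_ ivf ovf]; split => //; first by move=> x x' xx'; apply: ivf; rewrite xx'.
move=> B oB; exists ((fun x => set_val (f x)) @` B); first exact: ovf.
apply/seteqP; split => u /=; last by move=> [x Bx <-]; exists x.
by move=> [x Bx /set_val_inj <-]; exists x.
Qed.

Lemma continuous_cover {U V Y Z : topologicalType} (a : U -> Y) (b : V -> Y)
    (h : Y -> Z) : open_embedding a -> open_embedding b ->
  (forall y, (exists u, a u = y) \/ (exists v, b v = y)) ->
  continuous (fun u => h (a u)) -> continuous (fun v => h (b v)) ->
  continuous h.
Proof.
have loc (V' : topologicalType) (e : V' -> Y) v : open_embedding e ->
    continuous (fun u => h (e u)) -> continuous_at (e v) h.
  move=> [_ _ oe] che B /che; rewrite nbhsE => -[A [oA Av] AB].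
  rewrite nbhs_simpl /=; apply: (@filterS _ _ _ (e @` A)).
    by move=> _ [u Au <-]; exact: AB.
  by apply: open_nbhs_nbhs; split; [exact: oe|exists v].
move=> ae be cov cha chb y.
by case: (cov y) => -[u <-]; exact: loc.
Qed.

Lemma punctured_space_nonempty {R : realType} :
  exists v : set_type (@punctured_space R), True.
Proof.
have [|v _] := @set_type_sub _ (@punctured_space R) (vec3 1 0 0).
  by apply/coords_neq0/Or31; rewrite cx_vec; apply/eqP; exact: oner_neq0.
by exists v.
Qed.

Section LocallyPathConnected.
Context {R : realType} {N : topologicalType}.
Hypothesis mN : manifold3 R N.
Local Notation E := 'rV[R]_3.

Lemma half_space_segment (u v : E) (t : R) : half_space R u -> half_space R v ->
  0 <= t <= 1 -> half_space R (segment u v t).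
Proof. by rewrite /half_space /= segmentE => u0 v0 /andP[t0 t1]; nra. Qed.

Lemma ball_segment (u v : E) (e t : R) : 0 < e -> ball u e v -> 0 <= t <= 1 ->
  ball u e (segment u v t).
Proof.
move=> e0; rewrite -!ball_normE /= => uv /andP[t0 t1].
have -> : u - segment u v t = t *: (u - v).
  by rewrite /segment opprD addrA subrr sub0r -scalerN opprB.
rewrite normrZ ger0_norm //; apply: le_lt_trans uv.
by rewrite ler_piMl.
Qed.

(** In a chart, the intersection of a ball with the half-space is convex. *)
Lemma locally_path_connected (V : set N) (z : N) : open V -> V z ->
  exists B, [/\ open B, B z & forall z', B z' -> @joined R N V z z'].
Proof.
move=> oV Vz; have [U [oU Uz] [phi phiP]] := manifold3_chart mN z.
have [cphi iphi ophi] := phiP.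
have [cv iv ov] := set_val_open_embedding oU.
have [u0 u0E] := set_type_sub Uz.
pose A : set (set_type U) := set_val @^-1` V.
have oA : open A by apply: open_comp => // u _; exact: cv.
have [Q oQ QE] := ophi A oA.
have inQ u : Q (set_val (phi u)) <-> A u.
  rewrite -[Q _]/((set_val @^-1` Q) (phi u)) QE.
  by split => [[u' Au' /iphi <-]|Au] //; exists u.
have /nbhs_ballP[e /= e0 eQ] : nbhs (set_val (phi u0)) Q.
  by apply: open_nbhs_nbhs; split => //; apply/inQ; rewrite /A /= u0E.
pose D : set E := ball (set_val (phi u0)) e.
exists (set_val @` [set u | D (set_val (phi u))]); split.
- apply: ov; apply: (@open_comp _ _ (fun u => set_val (phi u))); last first.
    exact: ball_open.
  by move=> u _; apply: continuous_comp; [exact: cphi|exact: set_val_continuous].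
- by exists u0 => //=; exact: ballxx.
move=> _ [u Du <-].
have tr (t : R) : 0 <= truncate t <= 1 by rewrite truncate_ge0 truncate_le1.
have [||h ch hE] := @set_type_lift R E (half_space R)
  (fun t => segment (set_val (phi u0)) (set_val (phi u)) (truncate t)).
- by apply: segment_continuous; [exact: cts_cst|exact: truncate_continuous].
- by move=> t; apply: half_space_segment => //; exact: set_type_in.
have hQ t : Q (set_val (h t)) by apply: eQ; rewrite hE; exact: ball_segment.
have [|q cq qE] := open_embedding_lift phiP ch.
  move=> t; have : (set_val @^-1` Q) (h t) by exact: hQ.
  by rewrite QE => -[u' _ <-]; exists u'.
exists (fun t => set_val (q t)); split.
- exact: continuous_compose cv cq.
- by move=> t; apply/inQ; rewrite qE.
- rewrite -u0E; congr set_val; apply: iphi; apply: set_val_inj.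
  by rewrite qE hE truncate0 segment0.
- congr set_val; apply: iphi; apply: set_val_inj.
  by rewrite qE hE truncate1 segment1.
Qed.

Variable f : ball_embedding R N.

Let S : set N := ~` [set f 0].

Lemma open_pointless : open S.
Proof.
apply: closed_openC; apply/accessible_closed_set1/hausdorff_accessible.
exact: (manifold3_hausdorff mN).
Qed.

(** Removing the centre of a ball does not disconnect [N].  The points that can be
    joined to a given point [e] of the punctured ball by a path avoiding the
    centre, together with the centre, form a set that is open, because the
    punctured ball is path-connected and [N] is locally path-connected, and closed
    for the latter reason; so it is all of [N]. *)
Lemma pointless_connected : @path_connected R N S.
Proof.
have [cf if_ of_] := ball_embP f.
have oS := open_pointless.
have [v1 _] := @punctured_space_nonempty R.
pose e := f (set_val v1).
pose P : set N := [set z | @joined R N S e z \/ z = f 0].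
have PC z : ~ P z -> S z by move=> Pz z0; apply: Pz; right.
have nearby z : S z -> nbhs z [set z' | @joined R N S z z'].
  move=> Sz; have [B [oB Bz BS]] := locally_path_connected oS Sz.
  by apply: filterS BS _; apply: open_nbhs_nbhs.
have oP : open P.
  rewrite openE => z [ez|->].
    have Sz : S z by have [p [_ Sp _ <-]] := ez.
    apply: filterS (nearby z Sz) => z' zz'; left; exact: joined_trans ez zz'.
  apply: (@filterS _ _ _ (range f)); last first.
    by apply: open_nbhs_nbhs; split; [apply: of_; exact: openT|exists 0].
  move=> _ [v _ <-]; have [->|v0] := eqVneq v 0; first by right.
  left; have [w wE] := @set_type_sub _ (@punctured_space R) v v0.
  have cfv : continuous (fun w : set_type (@punctured_space R) => f (set_val w)).
    exact: continuous_compose cf (@set_val_continuous _ _).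
  have := joined_map cfv (@punctured_connected R v1 w Logic.I Logic.I).
  rewrite wE; apply: joined_sub => _ [w' _ <-] /if_ w'0.
  by have := set_type_in w'; rewrite /punctured_space /= w'0 eqxx.
have cP : closed P.
  rewrite -[P]setCK; apply: open_closedC; rewrite openE => z Pz.
  apply: filterS (nearby z (PC z Pz)) => z' zz' [ez'|z'0].
    by apply: Pz; left; exact: joined_trans ez' (joined_sym zz').
  by have [p [_ Sp _ p1]] := zz'; apply: (Sp 1); rewrite p1.
have PT : P = setT.
  apply: (manifold3_connected mN).
  - by exists (f 0); right.
  - by exists P => //; rewrite setTI.
  - by exists P => //; rewrite setTI.
have join u : S u -> @joined R N S e u.
  by move=> Su; have [|/Su] : P u by rewrite PT.
by move=> u v /join eu /join ev; exact: joined_trans (joined_sym eu) ev.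
Qed.

Lemma manifold_path_connected : @path_connected R N setT.
Proof.
have [cf if_ of_] := ball_embP f.
have [v1 _] := @punctured_space_nonempty R.
have S1 : S (f (set_val v1)).
  by move=> /if_ h; have := set_type_in v1; rewrite /punctured_space /= h eqxx.
suff H z : @joined R N setT (f (set_val v1)) z.
  by move=> u v _ _; exact: joined_trans (joined_sym (H u)) (H v).
have [->|Sz] := pselect (z = f 0).
  by apply: joined_sub (joined_map cf
    (@rV3_connected R (set_val v1) 0 Logic.I Logic.I)).
by apply: joined_sub (pointless_connected S1 Sz).
Qed.

End LocallyPathConnected.

(** Conjugation by a path from [x'] to [x] is the monodromy at [x] of the
    tautological cocycle based at [x'].  Going back with the tautological cocycle
    based at [x] gives a conjugation in the fundamental group at [x], whence
    injectivity. *)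
Lemma base_point_change {R : realType} {X : topologicalType} (x x' : X) :
  @path_connected R X setT ->
  exists2 h : fundamental_group R x -> fundamental_group R x', is_hom h &
    forall a, h a = 1%g -> a = 1%g.
Proof.
move=> cX.
have [g _] := path_exists (fun z => cX x z Logic.I Logic.I).
have [g' _] := path_exists (fun z => cX x' z Logic.I Logic.I).
have Tc := tautological_cocycle g; have Tc' := tautological_cocycle g'.
exists (monodromy (tautological g') (x := x)); first exact: monodromy_hom.
move=> a; rewrite -[a]homotopy_class_surj; move: (repr a) => l {a}.
rewrite monodromyE // tautological_line => l1.
have := monodromy_close_up g' l Tc; rewrite l1 (hom1 (monodromy_hom Tc (x := x'))).
have conj1 (G : groupType) (a b : G) : (1 = a * b * a^-1)%g -> b = 1%g.
  by move=> /esym/eqP; rewrite divg_eq1 -{2}[a]mulg1 => /eqP/mulgI.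
move=> /conj1; rewrite tautological_line close_up_loop => /esym/conj1.
exact.
Qed.

(** * The two open pieces of a connected sum *)

Lemma ctsV {T : topologicalType} {R : realType} (f : T -> R) :
  continuous f -> (forall z, f z != 0) -> continuous (fun z => (f z)^-1).
Proof. by move=> cf f0 z; apply: cvgV; [exact: f0|exact: cf]. Qed.

Lemma neq_negb (k l : bool) : k != l -> k = ~~ l.
Proof. by case: k; case: l. Qed.

Section Inversion.
Context {R : realType}.
Local Notation E := 'rV[R]_3.
Local Notation W := (set_type (@punctured_space R)).

Definition norm2 (v : E) : R := \sum_i v ord0 i ^+ 2.

Lemma norm2E v : norm2 v = cx v * cx v + cy v * cy v + cz v * cz v.
Proof.
rewrite /norm2 !big_ord_recl big_ord0 addr0 !expr2 addrA /cx /cy /cz.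
by have -> : lift ord0 (lift ord0 ord0) = ord_max :> 'I_3 by apply: val_inj.
Qed.

Lemma norm2Z (a : R) v : norm2 (a *: v) = a ^+ 2 * norm2 v.
Proof. by rewrite /norm2 mulr_sumr; apply: eq_bigr => i _; rewrite mxE exprMn. Qed.

Lemma norm2_ge0 v : 0 <= norm2 v.
Proof. by apply: sumr_ge0 => i _; exact: sqr_ge0. Qed.

Lemma norm2_0 : norm2 0 = 0.
Proof. by rewrite -(scale0r 0) norm2Z expr0n mul0r. Qed.

Lemma norm2_gt0 v : v != 0 -> 0 < norm2 v.
Proof.
move=> v0; rewrite lt_neqAle norm2_ge0 andbT eq_sym; apply: contra v0.
rewrite /norm2 psumr_eq0 => [|i _]; last exact: sqr_ge0.
move=> /allP v0; apply/eqP/rowP => i; rewrite mxE; apply/eqP.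
by rewrite -sqrf_eq0; apply: v0; rewrite mem_index_enum.
Qed.

Lemma norm2_continuous : continuous norm2.
Proof.
rewrite (_ : norm2 = fun v => cx v * cx v + cy v * cy v + cz v * cz v); last first.
  by apply/funext => v; exact: norm2E.
have cxc : continuous (@cx R) by move=> v; exact: coord_continuous.
have cyc : continuous (@cy R) by move=> v; exact: coord_continuous.
have czc : continuous (@cz R) by move=> v; exact: coord_continuous.
by cts.
Qed.

Lemma unit_ball_compact : compact [set v : E | norm2 v <= 1].
Proof.
apply: bounded_closed_compact; last first.
  apply: (@preimage_closed _ _ norm2 [set r | r <= 1]); last exact: closed_le.
  by move=> v _; exact: norm2_continuous.
exists 1; split => // r r1 v /= v1; rewrite [leLHS]/Num.Def.normr /= mx_normrE.
apply/bigmax_leP; split; first by rewrite (le_trans ler01) // ltW.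
move=> [i j] _ /=; rewrite ord1; apply: le_trans (ltW r1).
rewrite -(@ler_pXn2r _ 2) ?nnegrE // expr1n real_normK ?num_real //.
apply: le_trans v1; rewrite /norm2 (bigD1 j) //= lerDl.
by apply: sumr_ge0 => k _; exact: sqr_ge0.
Qed.

Lemma val_neq0 (w : W) : set_val w != 0.
Proof. exact: (@set_type_in _ (@punctured_space R) w). Qed.

Let norm2W_gt0 (w : W) : 0 < norm2 (set_val w).
Proof. exact/norm2_gt0/val_neq0. Qed.

Let norm2W_continuous : continuous (fun w : W => norm2 (set_val w)).
Proof. exact: continuous_compose norm2_continuous (@set_val_continuous _ _). Qed.

Let norm2V_continuous : continuous (fun w : W => (norm2 (set_val w))^-1).
Proof.
by apply: ctsV; [exact: norm2W_continuous|move=> w; rewrite gt_eqF].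
Qed.

Lemma inversion_exists : exists2 inv : W -> W, continuous inv &
  forall w, set_val (inv w) = (norm2 (set_val w))^-1 *: set_val w.
Proof.
apply: (@set_type_lift W E (@punctured_space R)
  (fun w => (norm2 (set_val w))^-1 *: set_val w)).
  by apply: ctsZ; [exact: norm2V_continuous|exact: set_val_continuous].
by move=> w; rewrite /punctured_space /= scaler_eq0 invr_eq0 gt_eqF //= val_neq0.
Qed.

Definition inversion : W -> W := projT1 (cid2 inversion_exists).

Lemma inversion_continuous : continuous inversion.
Proof. by rewrite /inversion; case: cid2. Qed.

Lemma inversionE w : set_val (inversion w) = (norm2 (set_val w))^-1 *: set_val w.
Proof. by rewrite /inversion; case: cid2. Qed.

Lemma norm2_inversion w : norm2 (set_val (inversion w)) = (norm2 (set_val w))^-1.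
Proof.
rewrite inversionE norm2Z expr2 -mulrA mulVf ?mulr1 //.
by rewrite gt_eqF.
Qed.

Lemma inversionK : involutive inversion.
Proof.
move=> w; apply: set_val_inj; rewrite inversionE norm2_inversion invrK.
by rewrite inversionE scalerA divff ?scale1r // gt_eqF.
Qed.

(** The retraction of R^3 minus a point onto the outside of the open unit ball that
    is the inversion inside the ball.  The maximum makes its continuity immediate
    and prevents a case distinction. *)
Definition outward (w : W) : E := Num.max 1 (norm2 (set_val w))^-1 *: set_val w.

Lemma outward_continuous : continuous outward.
Proof.
apply: ctsZ; last exact: set_val_continuous.
by apply: cts_max; [exact: cts_cst|exact: norm2V_continuous].
Qed.

Lemma outward_in w : norm2 (set_val w) <= 1 -> outward w = set_val (inversion w).
Proof. by move=> w1; rewrite inversionE /outward max_r // invf_ge1. Qed.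

Lemma outward_out w : 1 <= norm2 (set_val w) -> outward w = set_val w.
Proof. by move=> w1; rewrite /outward max_l ?scale1r // invf_le1. Qed.

Lemma norm2_outward w : 1 <= norm2 (outward w).
Proof.
have [w1|w1] := leP 1 (norm2 (set_val w)); first by rewrite outward_out.
by rewrite outward_in ?(ltW w1) // norm2_inversion invf_ge1 // ltW.
Qed.

End Inversion.

Section Geometry.
Context {R : realType} {N : bool -> topologicalType} {M : topologicalType}.
Hypothesis hN : forall i, hausdorff_space (N i).
Variable f : forall i, ball_embedding R (N i).
Local Notation E := 'rV[R]_3.
Local Notation W := (set_type (@punctured_space R)).
Local Notation sum := (connected_sum f).

Definition pointless i : set (N i) := ~` [set f i 0].
Arguments pointless : clear implicits.
Local Notation U i := (set_type (pointless i)).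
Local Notation P i := (set_type (@punctured R N f i)).

Let cf i : continuous (f i). Proof. by have [] := ball_embP (f i). Qed.
Let fI i : injective (f i). Proof. by have [] := ball_embP (f i). Qed.
Let of_ i A : open A -> open (f i @` A).
Proof. by have [_ _] := ball_embP (f i); apply. Qed.

Let oU i : open (pointless i).
Proof.
exact/closed_openC/accessible_closed_set1/hausdorff_accessible.
Qed.

Let j_emb i : open_embedding (set_val : U i -> N i).
Proof. exact: set_val_open_embedding. Qed.

Definition proj i (z : P i) : sum :=
  \pi_sum%qT (existT (fun i => P i) i z : punctured_sum f).

Lemma proj_continuous i : continuous (@proj i).
Proof.
apply: (@continuous_compose _ _ _ (\pi_sum)%qT (existT (fun i => P i) i)).
  exact: pi_continuous.
exact: (@existT_continuous bool (fun i => P i : topologicalType) i).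
Qed.

Lemma proj_surj (c : sum) : exists i z, c = @proj i z.
Proof.
rewrite -[c]reprK; case: (repr c) => i z; by exists i, z.
Qed.

Lemma projP i i' (z : P i) (z' : P i') : proj z = proj z' <->
  (existT (fun i => P i) i z = existT (fun i => P i) i' z' \/
   exists2 v, norm2 v = 1 & f i v = set_val z /\ f i' v = set_val z').
Proof.
split.
  move=> /eqmodP/asboolP[->|[v v1 [vz vz']]]; first by left.
  by right; exists v.
move=> H; apply/eqmodP/asboolP; case: H => [->|[v v1 [vz vz']]]; first by left.
by right; exists v.
Qed.

Lemma proj_inj i : injective (@proj i).
Proof.
move=> z z' /projP[|[v _ [vz vz']]]; first exact: eq_from_Tagged.
by apply: set_val_inj; rewrite -vz.
Qed.

Lemma proj_glue i i' (z : P i) (z' : P i') v : norm2 v = 1 ->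
  set_val z = f i v -> set_val z' = f i' v -> proj z = proj z'.
Proof. by move=> v1 zv z'v; apply/projP; right; exists v. Qed.

Lemma proj_neq i i' (z : P i) (z' : P i') : i != i' -> proj z = proj z' ->
  exists2 v, norm2 v = 1 & f i v = set_val z /\ f i' v = set_val z'.
Proof. by move=> /eqP ii /projP[/(congr1 tag)|]. Qed.

Lemma puncturedE i v : @punctured R N f i (f i v) <-> 1 <= norm2 v.
Proof.
split => [h|v1 [v' v'1 /fI vv']]; last first.
  by move: v'1; rewrite vv' /open_ball3 /= -/(norm2 v) ltNge v1.
by rewrite leNgt; apply/negP => v1; apply: h; exists v.
Qed.

Lemma collar_exists i : exists2 b : W -> P i, continuous b &
  forall w, set_val (b w) = f i (outward w).
Proof.
apply: (@set_type_lift W (N i) (@punctured R N f i) (fun w => f i (outward w))).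
  exact: continuous_compose (@cf i) outward_continuous.
by move=> w; apply/puncturedE; exact: norm2_outward.
Qed.

Definition collar i : W -> P i := projT1 (cid2 (collar_exists i)).

Lemma collar_continuous i : continuous (collar i).
Proof. by rewrite /collar; case: cid2. Qed.

Lemma collarE i w : set_val (collar i w) = f i (outward w).
Proof. by rewrite /collar; case: cid2. Qed.

Lemma ring_exists i : exists2 w : W -> U i, continuous w &
  forall z, set_val (w z) = f i (set_val z).
Proof.
apply: (@set_type_lift W (N i) (pointless i) (fun w => f i (set_val w))).
  exact: continuous_compose (@cf i) (@set_val_continuous _ _).
by move=> w /fI w0; have := val_neq0 w; rewrite w0 eqxx.
Qed.

Definition shell i : W -> U i := projT1 (cid2 (ring_exists i)).

Lemma shell_continuous i : continuous (shell i).
Proof. by rewrite /shell; case: cid2. Qed.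

Lemma shellE i w : set_val (shell i w) = f i (set_val w).
Proof. by rewrite /shell; case: cid2. Qed.

Lemma shell_emb i : open_embedding (shell i).
Proof.
apply: open_embedding_corestrict; first exact: shell_continuous.
rewrite (_ : (fun _ => _) = fun w : W => f i (set_val w)); last first.
  by apply/funext => w; exact: shellE.
apply: (open_embedding_comp _ (ball_embP (f i))).
by apply: set_val_open_embedding; exact: open_punctured_space.
Qed.

Lemma pointlessP i (u : U i) : (exists z : P i, set_val z = set_val u) \/
  (exists2 w, norm2 (set_val w) < 1 & u = shell i w).
Proof.
have [up|up] := pselect (@punctured R N f i (set_val u)).
  by left; have [z zE] := set_type_sub up; exists z.
right; have [v v1 vE] : (f i @` open_ball3 R) (set_val u) by exact: contrapT.
have [|w wE] := @set_type_sub _ (@punctured_space R) v.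
  by apply/eqP => v0; have := set_type_in u; rewrite /pointless /= -vE v0.
exists w; first by rewrite wE.
by apply: set_val_inj; rewrite shellE wE.
Qed.

Lemma punctured_pointless i (z : P i) : exists u : U i, set_val u = set_val z.
Proof.
apply: set_type_sub => z0.
have : @punctured R N f i (f i 0) by rewrite -z0; exact: set_type_in.
by move=> /puncturedE; rewrite norm2_0 ler10.
Qed.

Lemma shell_range i (u : U i) v : f i v = set_val u -> range (shell i) u.
Proof.
move=> vu; have [|w wE] := @set_type_sub _ (@punctured_space R) v.
  by apply/eqP => v0; have := set_type_in u; rewrite /pointless /= -vu v0.
by exists w => //; apply: set_val_inj; rewrite shellE wE.
Qed.

(** The embedding of [N i] minus the centre of the ball: outside the ball it is the
    projection to the quotient, and inside the punctured ball it is the inversion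
    followed by the projection from the other summand.  The two descriptions agree
    on the sphere by definition of the gluing. *)
Lemma piece_exists i (u : U i) : exists c : sum,
  (forall z : P i, set_val z = set_val u -> c = proj z) /\
  (forall w, norm2 (set_val w) <= 1 -> u = shell i w -> c = proj (collar (~~ i) w)).
Proof.
have meet (z : P i) w : norm2 (set_val w) <= 1 -> set_val z = f i (set_val w) ->
    proj z = proj (collar (~~ i) w).
  move=> w1 zw; have w1' : norm2 (set_val w) = 1.
    apply/eqP; rewrite eq_le w1 /=; apply/(@puncturedE i); rewrite -zw.
    exact: set_type_in.
  apply: (proj_glue w1' zw); rewrite collarE outward_out //.
  by rewrite w1'.
have [[z zu]|[w w1 uw]] := pointlessP u.
  exists (proj z); split => [z' z'u|w w1 uw].
    by congr proj; apply: set_val_inj; rewrite zu z'u.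
  by apply: meet => //; rewrite zu uw shellE.
exists (proj (collar (~~ i) w)); split => [z zu|w' w'1 uw'].
  by apply/esym/meet; rewrite ?(ltW w1) // zu uw shellE.
congr (proj (collar _ _)); apply: set_val_inj; apply: (@fI i).
by rewrite -!shellE -uw -uw'.
Qed.

Definition piece i (u : U i) : sum := projT1 (cid (piece_exists u)).

Lemma piece_out i (u : U i) (z : P i) : set_val z = set_val u -> piece u = proj z.
Proof. by rewrite /piece; case: cid => c /= [h _]; exact: h. Qed.

Lemma piece_in i w : norm2 (set_val w) <= 1 ->
  piece (shell i w) = proj (collar (~~ i) w).
Proof. by rewrite /piece; case: cid => c /= [_ h] /h; apply. Qed.

Lemma piece_in_neq i (z : P (~~ i)) w : norm2 (set_val w) < 1 ->
  piece (shell i w) = proj z -> set_val z = f (~~ i) (set_val (inversion w)).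
Proof.
move=> w1; rewrite piece_in ?(ltW w1) // => /proj_inj <-.
by rewrite collarE outward_in // ltW.
Qed.

(** The inversion exchanges the two cases of the definition of [piece]. *)
Lemma piece_shell i w : piece (shell i w) = piece (shell (~~ i) (inversion w)).
Proof.
have w0 : 0 < norm2 (set_val w) by exact/norm2_gt0/val_neq0.
have [w1|w1] := leP (norm2 (set_val w)) 1.
  rewrite piece_in //; apply/esym/piece_out.
  by rewrite collarE outward_in // shellE.
rewrite [RHS]piece_in ?norm2_inversion ?invf_le1 ?(ltW w1) //.
rewrite negbK; apply/piece_out; rewrite collarE shellE outward_in ?inversionK //.
by rewrite norm2_inversion invf_le1 // ltW.
Qed.

Lemma piece_inj i : injective (@piece i).
Proof.
have mixed (u : U i) (z : P i) w : set_val z = set_val u -> norm2 (set_val w) < 1 ->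
    piece u <> piece (shell i w).
  move=> zu w1; rewrite (piece_out zu) (piece_in i (ltW w1)).
  move=> /proj_neq[|v v1 [_]]; first by case: (i).
  rewrite collarE outward_in ?(ltW w1) // => /fI vw.
  move: v1; rewrite vw norm2_inversion => /(congr1 (fun r => r^-1)).
  by rewrite invrK invr1 => w1'; move: w1; rewrite w1' ltxx.
move=> u u'; have [[z zu]|[w w1 uw]] := pointlessP u;
  have [[z' zu']|[w' w1' uw']] := pointlessP u'.
- rewrite (piece_out zu) (piece_out zu') => /proj_inj zz'.
  by apply: set_val_inj; rewrite -zu -zu' zz'.
- by rewrite uw' => /(mixed _ _ _ zu w1').
- by rewrite uw => /esym/(mixed _ _ _ zu' w1).
- rewrite uw uw' !piece_in ?(ltW w1) ?(ltW w1') // => /proj_inj.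
  move=> /(congr1 set_val); rewrite !collarE !outward_in ?(ltW w1) ?(ltW w1') //.
  by move=> /fI/set_val_inj/(can_inj inversionK) ->.
Qed.

Lemma piece_overlap i i' (u : U i) (u' : U i') :
  i != i' -> piece u = piece u' -> range (shell i) u.
Proof.
move=> ii; have [[z zu]|[w _ ->]] := pointlessP u; last by exists w.
have [[z' zu']|[w' w1' ->]] := pointlessP u'.
  rewrite (piece_out zu) (piece_out zu') => /(proj_neq ii)[v _ [vz _]].
  by apply: (@shell_range _ _ v); rewrite vz.
have E := neq_negb ii.
rewrite (piece_out zu); subst i.
move=> /esym/(piece_in_neq w1') zE.
by apply: shell_range; rewrite -zu; exact/esym/zE.
Qed.

Lemma piece_cover c : exists i u, @piece i u = c.
Proof.
have [i [z ->]] := proj_surj c; exists i.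
by have [u uE] := punctured_pointless z; exists u; exact: piece_out.
Qed.

(** Local on two open sets: the shell, where the two descriptions are pasted along
    the sphere, and the complement of the closed ball.  The latter is open because
    the closed ball is compact and [N i] is Hausdorff. *)
Lemma piece_continuous i : continuous (@piece i).
Proof.
pose D : set (U i) := ~` (set_val @^-1` (f i @` [set v | norm2 v <= 1])).
have oD : open D.
  apply: closed_openC; apply: preimage_closed; last first.
    apply: compact_closed; first exact: hN.
    apply: continuous_compact unit_ball_compact.
    exact/continuous_subspaceT/cf.
  by move=> u _; exact: set_val_continuous.
apply: (continuous_cover (shell_emb i) (set_val_open_embedding oD)).
- move=> u; have [uD|uD] := pselect (D u).
    by right; have [v vE] := set_type_sub uD; exists v.
  by left; have [v v1 /shell_range[w _ wu]] := contrapT uD; exists w.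
- have -> : (fun w => piece (shell i w)) = (fun w =>
      if norm2 (set_val w) <= 1 then proj (collar (~~ i) w)
      else proj (collar i w)).
    apply/funext => w; case: ifPn => w1; first exact: piece_in.
    apply: piece_out; rewrite collarE shellE outward_out //.
    by rewrite ltW // ltNge.
  apply: continuous_paste.
  + exact: continuous_compose (@proj_continuous _) (@collar_continuous _).
  + exact: continuous_compose (@proj_continuous _) (@collar_continuous _).
  + exact: continuous_compose norm2_continuous (@set_val_continuous _ _).
  + by move=> w w1; apply: (proj_glue w1); rewrite collarE outward_out // w1.
- have [||g cg gE] := @set_type_lift (set_type D) (N i) (@punctured R N f i)
      (fun d => set_val (set_val d)).
  + exact: continuous_compose (@set_val_continuous _ _) (@set_val_continuous _ _).
  + move=> d [v v1 vE]; apply: (set_type_in d); exists v => //=; exact: ltW.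
  rewrite (_ : (fun _ => _) = fun d => proj (g d)).
    exact: continuous_compose (@proj_continuous _) cg.
  by apply/funext => d; exact: piece_out.
Qed.

(** The trace of [piece @` A] on the outside of the ball of [N i] is that of [A]; on
    the other summand, it is the trace of the image of [A] under the inversion of
    the shell. *)
Lemma piece_open i (A : set (U i)) : open A -> open (@piece i @` A).
Proof.
move=> oA; apply/sigT_openP => i'.
have [_ _ oj] := j_emb i.
have [->|ii] := eqVneq i' i.
  rewrite (_ : _ @^-1` _ = set_val @^-1` (set_val @` A)).
    by apply: open_comp; [move=> z _; exact: set_val_continuous|exact: oj].
  apply/seteqP; split => z /=.
    move=> [u Au uz]; exists u => //; have [u' u'E] := punctured_pointless z.
    rewrite -u'E; congr set_val; apply: piece_inj.
    by rewrite uz (piece_out (esym u'E)).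
  by move=> [u Au uz]; exists u => //; exact: piece_out.
have E := neq_negb ii.
subst i'.
pose C : set W := (fun w => shell i (inversion w)) @^-1` A.
rewrite (_ : _ @^-1` _ = set_val @^-1` ((fun w : W => f (~~ i) (set_val w)) @` C)).
  apply: open_comp; first by move=> z _; exact: set_val_continuous.
  have [_ _ ofw] := open_embedding_comp
    (set_val_open_embedding (@open_punctured_space R)) (ball_embP (f (~~ i))).
  apply: ofw; apply: open_comp => // w _.
  apply: (continuous_compose (@shell_continuous i) inversion_continuous).
apply/seteqP; split => z /=.
  move=> [u Au uz]; have [u' u'E] := punctured_pointless z.
  have uu' : piece u = piece u' by rewrite uz (piece_out (esym u'E)).
  have ii' : i != ~~ i by case: (i).
  have [w _ wu] := piece_overlap ii' uu'.
  exists (inversion w); first by rewrite /C /= inversionK wu.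
  rewrite -u'E -shellE; congr set_val; apply: piece_inj.
  by rewrite -piece_shell wu.
move=> [w Cw wz]; exists (shell i (inversion w)) => //.
rewrite piece_shell inversionK; apply: piece_out.
by rewrite shellE.
Qed.

Lemma piece_emb i : open_embedding (@piece i).
Proof.
split; [exact: piece_continuous|exact: piece_inj|exact: piece_open].
Qed.

End Geometry.
Arguments pointless {R N} f i.
Arguments shell {R N} f i.

(** * The fundamental group of a connected sum *)

Lemma homeomorphism_open_embedding {X Y : topologicalType} (g : X -> Y)
    (h : Y -> X) :
  continuous g -> continuous h -> cancel g h -> cancel h g -> open_embedding g.
Proof.
move=> cg ch gK hK; split => //; first exact: can_inj gK.
move=> A oA; have -> : g @` A = h @^-1` A.
  apply/seteqP; split => y /=; first by move=> [x Ax <-]; rewrite gK.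
  by move=> Ay; exists (h y).
by apply: open_comp => // y _; exact: ch.
Qed.

(** The decomposition is proved for base points in the balls and in the overlap, where
    all the cocycles are trivial; [base_point_change] moves them elsewhere. *)
Theorem pi1_connected_sum {R : realType} {N : bool -> topologicalType}
    {M : topologicalType} :
  (forall i, manifold3 R (N i)) -> is_connected_sum R M N ->
  @path_connected R M setT /\ exists (x : forall i, N i) (y : M)
    (phi : forall i, fundamental_group R (x i) -> fundamental_group R y),
    free_product phi.
Proof.
move=> mN [f [h [g [ch cg hK gK]]]].
have hN i := manifold3_hausdorff (mN i).
have g_emb := homeomorphism_open_embedding cg ch gK hK.
pose k i (u : set_type (pointless f i)) : M := g (piece u).
have k_emb i : open_embedding (@k i).
  exact: open_embedding_comp (piece_emb hN f i) g_emb.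
have gI : injective g := can_inj gK.
have [w0 _] := @punctured_space_nonempty R.
have U_connected i (u u' : set_type (pointless f i)) :
    @joined R (set_type (pointless f i)) setT u u'.
  have [p [cp Sp p0 p1]] :=
    pointless_connected (mN i) (set_type_in u) (set_type_in u').
  have [q cq qE] := set_type_lift cp Sp.
  exists q; split => //; apply: set_val_inj; rewrite qE //.
have ck i : continuous (@k i) by have [] := k_emb i.
have k_join i (u u' : set_type (pointless f i)) :
    @joined R M setT (k i u) (k i u').
  by apply: joined_sub (joined_map (ck i) (U_connected i u u')).
have M_cover m : exists i u, k i u = m.
  have [i [u uE]] := piece_cover (h m).
  by exists i, u; rewrite /k uE hK.
have k_shell w : k true (shell f true w) = k false (shell f false (inversion w)).
  by rewrite /k piece_shell.
have M_connected : @path_connected R M setT.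
  suff H m : @joined R M setT m (k false (shell f false w0)).
    by move=> u v _ _; exact: joined_trans (H u) (joined_sym (H v)).
  have [[] [u <-]] := M_cover m; last exact: k_join.
  apply: joined_trans (k_join true u (shell f true w0)) _.
  by rewrite k_shell; exact: k_join.
split => //; exists (fun i => f i 0), (k false (shell f false w0)).
apply: (@connected_sum_free_product R N M (fun i => set_type (pointless f i))
  'rV[R]_3 (set_type (@punctured_space R)) (fun i => set_val) (fun i => f i)
  k (fun i => shell f i)).
- move=> i; apply: set_val_open_embedding.
  exact/closed_openC/accessible_closed_set1/hausdorff_accessible.
- by move=> i; exact: ball_embP.
- exact: k_emb.
- by move=> i; exact: shell_emb.
- move=> i z; have [->|zf] := pselect (z = f i 0); first by right; exists 0.
  by left; have [u uE] := @set_type_sub _ (pointless f i) z zf; exists u.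
- exact: M_cover.
- by move=> i u v /esym; exact: shell_range.
- by move=> i w; exists (set_val w) => //; rewrite shellE.
- by move=> i i' u u' ii /gI; exact: piece_overlap.
- by move=> w; exists (inversion w); exact: k_shell.
- exact: punctured_coboundary.
- exact: rV3_coboundary.
- exact: punctured_connected.
- exact: rV3_connected.
- by move=> i; exact: (manifold_path_connected (mN i) (f i)).
- exact: M_connected.
Qed.

Theorem proposition1p2 (R : realType) (N : bool -> topologicalType)
    (M : topologicalType) (x : forall i : bool, N i) (y : M) :
  (forall i : bool, manifold3 R (N i)) ->
  is_connected_sum R M N ->
  (forall i : bool,
     bi_orderable (fundamental_group R (x i)) <->
     ~ (exists g : fundamental_group R (x i), generalized_torsion g)) ->
  (bi_orderable (fundamental_group R y) <->
   ~ (exists g : fundamental_group R y, generalized_torsion g)).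
Proof.
move=> mN MN ordN; split; first exact: bi_orderable_torsion_free.
have [cM [x' [y' [phi fp]]]] := pi1_connected_sum mN MN.
have cN i : @path_connected R (N i) setT.
  by have [f _] := MN; exact: (manifold_path_connected (mN i) (f i)).
move=> torsion_free.
have [a aM a1] := base_point_change y y' cM.
have [b bM b1] := base_point_change y' y cM.
apply: (bi_orderable_hom aM a1); apply: (free_product_bi_orderable fp) => i.
have [c cMor c1] := base_point_change (x i) (x' i) (@cN i).
have [d dM d1] := base_point_change (x' i) (x i) (@cN i).
apply: (bi_orderable_hom dM d1); apply/ordN => -[g gt].
apply: torsion_free; exists (b (phi i (c g))).
apply: (generalized_torsion_hom bM b1).
have [phiM _ _] := fp.
apply: (generalized_torsion_hom (@phiM i)) => [z|]; first exact: free_product_inj.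
exact: (generalized_torsion_hom cMor c1).
Qed.
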